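(* Let $H$ be the conformal map of the upper half-plane onto the region in the upper half-plane lying above the curve $\{t+i\arccos e^{-t}:t\ge 0\}$, that is, onto the region above the graph of the function equal to $\arccos e^{-x}$ for $x\ge 0$ and to $0$ for $x\le 0$, normalized by $H(0)=0$ and $H(z)\sim z$ as $z\to\infty$. Then $$\frac{1}{\pi}\int_0^\infty\left(\operatorname{Im} H(t)-\frac{\pi}{2}\chi_{[2,\infty)}(t)\right)\frac{dt}{t}=\frac{1}{2}\log(2\pi).$$
   Context: $\chi_{[2,\infty)}$ is the characteristic function of the ray $[2,\infty)$. For real $t$, $H(t)$ denotes the boundary value of $H$, i.e. its continuous extension to the real line. *)

(* Defs.v *)
From Stdlib Require Import Reals.
From Coquelicot Require Import Coquelicot.

Local Open Scope R_scope.

Definition upper_half_plane (z : C) : Prop := 0 < Im z.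

Definition lower_boundary (x : R) : R :=
  if Rle_dec 0 x then acos (exp (- x)) else 0.

Definition region_above (g : R -> R) (w : C) : Prop := g (Re w) < Im w.

(* A holomorphic bijection of the open set [D] onto [E].  The values of [f]
   outside [D] play no role: since [D] is open, complex differentiability at a
   point of [D] only depends on [f] near that point. *)
Definition conformal_onto (D E : C -> Prop) (f : C -> C) : Prop :=
  (forall z : C, D z -> ex_derive (K := C_AbsRing) (V := C_NormedModule) f z) /\
  (forall z w : C, D z -> D w -> f z = f w -> z = w) /\
  (forall w : C, E w <-> exists z : C, D z /\ f z = w).

(* The filter of neighbourhoods of infinity in the Riemann sphere. *)
Definition C_infinity (P : C -> Prop) : Prop :=
  exists M : R, forall z : C, M < Cmod z -> P z.

(* If such an [l] exists for every [t], these limits, together with [f] itself,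
   form the unique continuous extension of a continuous [f] from the open to the
   closed upper half-plane. *)
Definition is_boundary_value (f : C -> C) (t : R) (l : C) : Prop :=
  filterlim f (within upper_half_plane (locally (RtoC t))) (locally l).

Definition chi_2_infty (t : R) : R := if Rle_dec 2 t then 1 else 0.

(* Main.v *)
Require Import Defs.
From Stdlib Require Import Reals.
From Coquelicot Require Import Coquelicot.
From Stdlib Require Import Lra Psatz Classical ClassicalEpsilon Ranalysis5.
Local Open Scope R_scope.

(** The map is explicit: [H z = log (erfc (sqrt (-z)))].  Indeed [exp H] is real on the
    negative axis and has real part [1] on the positive axis, so by reflection
    [exp H - 1] is [sqrt (-z)] times an entire function.  The product of [sqrt (-z)]
    and the derivative of [exp H] is entire without zeros, and the growth of [H] at infinity
    leaves only a multiple of [exp z].  On the positive axis [Im H t] is thus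
    the argument of [erfc w], equivalently of [cerfcx w = exp (w^2) erfc w], at
    [w = - i sqrt t].

    The integral.  The function [log ((1 + sqrt pi w) cerfcx w)] is holomorphic in
    the closed fourth quadrant, vanishes at [0] and at infinity and is real on the
    real axis.  Integrating it against [dw / w] over the boundary of the quadrant
    shows that the argument of [cerfcx (- i y)] and [atan (sqrt pi y)] differ by a
    function of integral [0] against [dy / y] ([boundary_arg_integral]).  For the
    arctangent the integral follows from [atan (exp s) + atan (exp (- s)) = pi / 2],
    and [log (2 pi)] appears from the scaling by [sqrt pi] and the cut at [t = 2].

    The identification.  Let [K = log_erfc_map].  It maps the upper half-plane into
    the region ([log_erfc_map_in_region]), tends to points outside the region at the
    real axis ([log_erfc_map_boundary]) and is asymptotic to the identity.  So
    [psi = H^-1 o K] is a holomorphic self-map of the upper half-plane with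
    [Im psi -> 0] at the real axis and [psi z / z -> 1] at infinity.  By a
    Phragmen-Lindelof argument applied to [Im psi - Im z] and its negative, [psi] is
    a real translation ([psi_imaginary_part]), and the normalization at [0] makes it
    the identity ([conformal_map_unique]).

    The complex analysis rests on Goursat's theorem for rectangles.  Applied in
    polar coordinates it gives the mean value property, hence the maximum principle
    ([maximum_principle]); from the latter follow that injective holomorphic maps
    are open with nonvanishing derivative ([conformal_inverse]), the
    Phragmen-Lindelof principle, and the positivity of the real and imaginary
    parts of [cerfcx] in the fourth quadrant. *)

(** * Continuity and complex derivatives *)

Lemma Cmod_sym (z w : C) : Cmod (z - w) = Cmod (w - z).
Proof. rewrite <- Cmod_opp. f_equal. ring. Qed.

Lemma Cmod_diag (z : C) : Cmod (z - z) = 0.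
Proof. replace (z - z)%C with (RtoC 0) by ring. apply Cmod_0. Qed.

Lemma Cmod_sub_triangle (z w v : C) : Cmod (z - v) <= Cmod (z - w) + Cmod (w - v).
Proof. replace (z - v)%C with ((z - w) + (w - v))%C by ring. apply Cmod_triangle. Qed.

Lemma Cmod_le_sum (z w : C) : Cmod z <= Cmod (z - w) + Cmod w.
Proof. replace z with ((z - w) + w)%C at 1 by ring. apply Cmod_triangle. Qed.

Lemma Re_le_Cmod (z : C) : Rabs (Re z) <= Cmod z.
Proof. generalize (Rmax_Cmod z) (Rmax_l (Rabs (fst z)) (Rabs (snd z))). unfold Re; lra. Qed.

Lemma Im_le_Cmod (z : C) : Rabs (Im z) <= Cmod z.
Proof. generalize (Rmax_Cmod z) (Rmax_r (Rabs (fst z)) (Rabs (snd z))). unfold Im; lra. Qed.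

Lemma Cmod_le_Re_Im (z : C) : Cmod z <= Rabs (Re z) + Rabs (Im z).
Proof.
  replace z with ((Re z, 0) + (0, Im z))%C
    by (destruct z; unfold Cplus, Re, Im; simpl; f_equal; ring).
  eapply Rle_trans; [apply Cmod_triangle|].
  unfold Cplus, Re, Im; simpl; rewrite !Rplus_0_l, !Rplus_0_r.
  apply Rplus_le_compat; unfold Cmod; simpl;
  match goal with |- sqrt ?a <= Rabs ?b => replace a with (Rsqr b) by (unfold Rsqr; ring) end;
  rewrite sqrt_Rsqr_abs; apply Rle_refl.
Qed.

Lemma Cmod_sqr (z : C) : Cmod z * Cmod z = Re z * Re z + Im z * Im z.
Proof.
  unfold Cmod. rewrite sqrt_sqrt. unfold Re, Im; ring.
  apply Rplus_le_le_0_compat; apply pow2_ge_0.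
Qed.

Lemma Re_minus (z w : C) : Re (z - w) = Re z - Re w.
Proof. unfold Cminus. rewrite re_plus, re_opp. ring. Qed.

Lemma Im_minus (z w : C) : Im (z - w) = Im z - Im w.
Proof. unfold Cminus. rewrite im_plus, im_opp. ring. Qed.

Lemma Cmod_pos_neq (z w : C) : z <> w -> 0 < Cmod (z - w).
Proof. intros H. apply Cmod_gt_0. now apply Cminus_eq_contra. Qed.

Lemma Re_diff_bounds (z w : C) : - Cmod (z - w) <= Re z - Re w <= Cmod (z - w).
Proof. apply Rabs_le_between. rewrite <- Re_minus. apply Re_le_Cmod. Qed.

Lemma Im_diff_bounds (z w : C) : - Cmod (z - w) <= Im z - Im w <= Cmod (z - w).
Proof. apply Rabs_le_between. rewrite <- Im_minus. apply Im_le_Cmod. Qed.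

Lemma C_eq (z w : C) : Re z = Re w -> Im z = Im w -> z = w.
Proof. destruct z, w; unfold Re, Im; simpl; congruence. Qed.

Definition ccont (f : C -> C) (z : C) : Prop :=
  forall eps, 0 < eps -> exists d, 0 < d /\
    forall w, Cmod (w - z) < d -> Cmod (f w - f z) < eps.

(** Differentiability in the form of Caratheodory: the difference quotient, with
    the derivative as its value at [z], is continuous at [z].  Chain rule,
    product rule and inverse function rule become identities between difference
    quotients. *)
Definition cderiv (f : C -> C) (z l : C) : Prop :=
  exists phi : C -> C, ccont phi z /\ phi z = l /\
    forall w, (f w - f z = phi w * (w - z))%C.

Lemma ccont_const (c z : C) : ccont (fun _ => c) z.
Proof.
  intros e He. exists 1. split; [lra|]. intros w _.
  now rewrite Cmod_diag.
Qed.

Lemma ccont_id (z : C) : ccont (fun w => w) z.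
Proof. intros e He. exists e. auto. Qed.

Lemma ccont_plus (f g : C -> C) (z : C) :
  ccont f z -> ccont g z -> ccont (fun w => f w + g w)%C z.
Proof.
  intros Hf Hg e He.
  destruct (Hf (e / 2)) as [d1 [Hd1 H1]]; [lra|].
  destruct (Hg (e / 2)) as [d2 [Hd2 H2]]; [lra|].
  exists (Rmin d1 d2). split; [now apply Rmin_glb_lt|]. intros w Hw.
  specialize (H1 w (Rlt_le_trans _ _ _ Hw (Rmin_l _ _))).
  specialize (H2 w (Rlt_le_trans _ _ _ Hw (Rmin_r _ _))).
  replace (f w + g w - (f z + g z))%C with ((f w - f z) + (g w - g z))%C by ring.
  generalize (Cmod_triangle (f w - f z) (g w - g z)). lra.
Qed.

Lemma ccont_mult (f g : C -> C) (z : C) :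
  ccont f z -> ccont g z -> ccont (fun w => f w * g w)%C z.
Proof.
  intros Hf Hg e He.
  pose proof (Cmod_ge_0 (f z)) as P1. pose proof (Cmod_ge_0 (g z)) as P2.
  set (A := 1 + Cmod (f z) + Cmod (g z)).
  assert (HA : 0 < A) by (unfold A; lra).
  set (r := Rmin 1 (e / (2 * A))).
  assert (He2 : 0 < e / (2 * A)) by (apply Rdiv_lt_0_compat; lra).
  assert (Hr : 0 < r) by (apply Rmin_glb_lt; lra).
  destruct (Hf r Hr) as [d1 [Hd1 H1]]. destruct (Hg r Hr) as [d2 [Hd2 H2]].
  exists (Rmin d1 d2). split; [now apply Rmin_glb_lt|]. intros w Hw.
  specialize (H1 w (Rlt_le_trans _ _ _ Hw (Rmin_l _ _))).
  specialize (H2 w (Rlt_le_trans _ _ _ Hw (Rmin_r _ _))).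
  replace (f w * g w - f z * g z)%C
    with ((f w - f z) * (g w - g z) + (f z * (g w - g z) + (f w - f z) * g z))%C by ring.
  eapply Rle_lt_trans; [apply Cmod_triangle|].
  eapply Rle_lt_trans; [apply Rplus_le_compat_l, Cmod_triangle|].
  rewrite !Cmod_mult.
  pose proof (Cmod_ge_0 (f w - f z)) as P3. pose proof (Cmod_ge_0 (g w - g z)) as P4.
  assert (r <= 1) by apply Rmin_l.
  assert (Hr2 : r * A <= e / 2).
  { replace (e / 2) with (e / (2 * A) * A) by (field; lra).
    apply Rmult_le_compat_r; [lra|apply Rmin_r]. }
  unfold A in Hr2. nra.
Qed.

Lemma ccont_comp (f g : C -> C) (z : C) :
  ccont g z -> ccont f (g z) -> ccont (fun w => f (g w)) z.
Proof.
  intros Hg Hf e He. destruct (Hf e He) as [d [Hd H1]].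
  destruct (Hg d Hd) as [d' [Hd' H2]]. exists d'. auto.
Qed.

Lemma ccont_ext_loc (f g : C -> C) (z : C) (r : R) :
  0 < r -> (forall w, Cmod (w - z) < r -> f w = g w) -> ccont f z -> ccont g z.
Proof.
  intros Hr Hfg Hf e He. destruct (Hf e He) as [d [Hd H]].
  exists (Rmin d r). split; [now apply Rmin_glb_lt|]. intros w Hw.
  rewrite <- !Hfg. apply H.
  eapply Rlt_le_trans; [apply Hw|apply Rmin_l].
  now rewrite Cmod_diag.
  eapply Rlt_le_trans; [apply Hw|apply Rmin_r].
Qed.

Lemma ccont_neq_0 (f : C -> C) (z : C) : ccont f z -> f z <> 0 ->
  exists d, 0 < d /\ forall w, Cmod (w - z) < d -> Cmod (f z) / 2 < Cmod (f w).
Proof.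
  intros Hf Hz. assert (P : 0 < Cmod (f z)) by now apply Cmod_gt_0.
  destruct (Hf (Cmod (f z) / 2)) as [d [Hd H]]; [lra|].
  exists d. split; [easy|]. intros w Hw. specialize (H w Hw).
  generalize (Cmod_le_sum (f z) (f w)). rewrite (Cmod_sym (f z)). lra.
Qed.

Lemma ccont_inv (f : C -> C) (z : C) :
  ccont f z -> f z <> 0 -> ccont (fun w => / f w)%C z.
Proof.
  intros Hf Hz e He. assert (P : 0 < Cmod (f z)) by now apply Cmod_gt_0.
  destruct (ccont_neq_0 f z Hf Hz) as [d1 [Hd1 H1]].
  destruct (Hf (e * (Cmod (f z) * Cmod (f z) / 2))) as [d2 [Hd2 H2]];
    [apply Rmult_lt_0_compat; [easy|nra]|].
  exists (Rmin d1 d2). split; [now apply Rmin_glb_lt|]. intros w Hw.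
  specialize (H1 w (Rlt_le_trans _ _ _ Hw (Rmin_l _ _))).
  specialize (H2 w (Rlt_le_trans _ _ _ Hw (Rmin_r _ _))).
  assert (Hw0 : f w <> 0) by (apply Cmod_gt_0; lra).
  replace (/ f w - / f z)%C with ((f z - f w) / (f w * f z))%C by (field; auto).
  rewrite Cmod_div by now apply Cmult_neq_0. rewrite Cmod_mult, Cmod_sym.
  apply (Rmult_lt_reg_r (Cmod (f w) * Cmod (f z))); [nra|].
  unfold Rdiv. rewrite Rmult_assoc, Rinv_l, Rmult_1_r by nra.
  eapply Rlt_le_trans; [apply H2|]. apply Rmult_le_compat_l; nra.
Qed.

Lemma cderiv_cont (f : C -> C) (z l : C) : cderiv f z l -> ccont f z.
Proof.
  intros [phi [Hc [_ H]]].
  assert (Hc2 : ccont (fun w => f z + phi w * (w + - z))%C z).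
  { apply ccont_plus; [apply ccont_const|]. apply ccont_mult; [easy|].
    apply ccont_plus; [apply ccont_id|apply ccont_const]. }
  apply (ccont_ext_loc _ f z 1 Rlt_0_1) in Hc2; [easy|].
  intros w _. generalize (H w). intros E.
  replace (f w) with (f z + (f w - f z))%C by ring. rewrite E. ring.
Qed.

Lemma cderiv_intro (f : C -> C) (z l : C) :
  (forall eps, 0 < eps -> exists d, 0 < d /\ forall w, Cmod (w - z) < d ->
     Cmod (f w - f z - l * (w - z)) <= eps * Cmod (w - z)) ->
  cderiv f z l.
Proof.
  intros H. exists (fun w => if Ceq_dec w z then l else ((f w - f z) / (w - z))%C).
  repeat split.
  - intros e He. destruct (H (e / 2)) as [d [Hd H1]]; [lra|].
    exists d. split; [easy|]. intros w Hw.
    destruct (Ceq_dec z z) as [_|]; [|easy].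
    destruct (Ceq_dec w z) as [->|Hn].
    + now rewrite Cmod_diag.
    + specialize (H1 w Hw). pose proof (Cmod_pos_neq w z Hn) as P.
      assert (Hz : (w - z)%C <> 0) by now apply Cminus_eq_contra.
      replace ((f w - f z) / (w - z) - l)%C
        with ((f w - f z - l * (w - z)) / (w - z))%C by (field; auto).
      rewrite Cmod_div by easy.
      apply Rle_lt_trans with (e / 2); [|lra].
      apply (Rmult_le_reg_r (Cmod (w - z))); [easy|].
      unfold Rdiv at 1. rewrite Rmult_assoc, Rinv_l, Rmult_1_r by lra. easy.
  - destruct (Ceq_dec z z); easy.
  - intros w. destruct (Ceq_dec w z) as [->|Hn]; [ring|].
    field. now apply Cminus_eq_contra.
Qed.

Lemma cderiv_elim (f : C -> C) (z l : C) : cderiv f z l ->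
  forall eps, 0 < eps -> exists d, 0 < d /\ forall w, Cmod (w - z) < d ->
     Cmod (f w - f z - l * (w - z)) <= eps * Cmod (w - z).
Proof.
  intros [phi [Hc [<- H]]] e He. destruct (Hc e He) as [d [Hd H1]].
  exists d. split; [easy|]. intros w Hw. rewrite H.
  replace (phi w * (w - z) - phi z * (w - z))%C
    with ((phi w - phi z) * (w - z))%C by ring.
  rewrite Cmod_mult. apply Rmult_le_compat_r; [apply Cmod_ge_0|].
  now apply Rlt_le, H1.
Qed.

Lemma cderiv_ext_loc (f g : C -> C) (z l : C) (r : R) :
  0 < r -> (forall w, Cmod (w - z) < r -> f w = g w) -> cderiv f z l -> cderiv g z l.
Proof.
  intros Hr Hfg Hf. apply cderiv_intro. intros e He.
  destruct (cderiv_elim f z l Hf e He) as [d [Hd H]].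
  exists (Rmin d r). split; [now apply Rmin_glb_lt|]. intros w Hw.
  rewrite <- !Hfg. apply H.
  eapply Rlt_le_trans; [apply Hw|apply Rmin_l].
  now rewrite Cmod_diag.
  eapply Rlt_le_trans; [apply Hw|apply Rmin_r].
Qed.

Lemma cderiv_ext (f g : C -> C) (z l : C) :
  (forall w, f w = g w) -> cderiv f z l -> cderiv g z l.
Proof. intros H. apply (cderiv_ext_loc f g z l 1); auto with real. Qed.

Lemma cderiv_eq (f : C -> C) (z l l' : C) : cderiv f z l -> l = l' -> cderiv f z l'.
Proof. now intros H <-. Qed.

Lemma cderiv_const (c z : C) : cderiv (fun _ => c) z 0.
Proof.
  exists (fun _ => RtoC 0). repeat split; [apply ccont_const|]. intros; ring.
Qed.

Lemma cderiv_id (z : C) : cderiv (fun w => w) z 1.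
Proof.
  exists (fun _ => RtoC 1). repeat split; [apply ccont_const|]. intros; ring.
Qed.

Lemma cderiv_plus (f g : C -> C) (z l m : C) :
  cderiv f z l -> cderiv g z m -> cderiv (fun w => f w + g w)%C z (l + m).
Proof.
  intros [p [Cp [Ep Hp]]] [q [Cq [Eq Hq]]].
  exists (fun w => p w + q w)%C. repeat split.
  - now apply ccont_plus.
  - now rewrite Ep, Eq.
  - intros w. replace (f w + g w - (f z + g z))%C with ((f w - f z) + (g w - g z))%C by ring.
    rewrite Hp, Hq. ring.
Qed.

Lemma cderiv_mult (f g : C -> C) (z l m : C) :
  cderiv f z l -> cderiv g z m -> cderiv (fun w => f w * g w)%C z (l * g z + f z * m).
Proof.
  intros [p [Cp [Ep Hp]]] Dg. pose proof (cderiv_cont _ _ _ Dg) as Cg.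
  destruct Dg as [q [Cq [Eq Hq]]].
  exists (fun w => p w * g w + f z * q w)%C. repeat split.
  - apply ccont_plus; apply ccont_mult; auto using ccont_const.
  - now rewrite Ep, Eq.
  - intros w. replace (f w * g w - f z * g z)%C
      with ((f w - f z) * g w + f z * (g w - g z))%C by ring.
    rewrite Hp, Hq. ring.
Qed.

Lemma cderiv_comp (f g : C -> C) (z l m : C) :
  cderiv g z m -> cderiv f (g z) l -> cderiv (fun w => f (g w)) z (l * m).
Proof.
  intros Dg [p [Cp [Ep Hp]]]. pose proof (cderiv_cont _ _ _ Dg) as Cg.
  destruct Dg as [q [Cq [Eq Hq]]].
  exists (fun w => p (g w) * q w)%C. repeat split.
  - apply ccont_mult; [|easy]. now apply (ccont_comp p g).
  - now rewrite Ep, Eq.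
  - intros w. rewrite Hp, Hq. ring.
Qed.

Lemma cderiv_scal (c : C) (f : C -> C) (z l : C) :
  cderiv f z l -> cderiv (fun w => c * f w)%C z (c * l).
Proof.
  intros H. replace (c * l)%C with (0 * f z + c * l)%C by ring.
  apply (cderiv_mult (fun _ => c)); [apply cderiv_const|easy].
Qed.

Lemma cderiv_opp (f : C -> C) (z l : C) :
  cderiv f z l -> cderiv (fun w => - f w)%C z (- l).
Proof.
  intros H. replace (- l)%C with (-(1) * l)%C by ring.
  apply cderiv_ext with (fun w => -(1) * f w)%C; [intros; ring|now apply cderiv_scal].
Qed.

Lemma cderiv_minus (f g : C -> C) (z l m : C) :
  cderiv f z l -> cderiv g z m -> cderiv (fun w => f w - g w)%C z (l - m).
Proof. intros Hf Hg. apply cderiv_plus; [easy|now apply cderiv_opp]. Qed.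

Lemma cderiv_inverse_function (f h : C -> C) (b l : C) (r : R) :
  0 < r -> (forall w, Cmod (w - b) < r -> f (h w) = w) -> ccont h b ->
  cderiv f (h b) l -> l <> 0 -> cderiv h b (/ l).
Proof.
  intros Hr Hfh Ch [p [Cp [Ep Hp]]] Hl.
  assert (Cph : ccont (fun w => p (h w)) b) by now apply (ccont_comp p h).
  assert (Hb : f (h b) = b).
  { apply Hfh. now rewrite Cmod_diag. }
  destruct (ccont_neq_0 _ _ Cph) as [d [Hd Hn]]; [now rewrite Ep|].
  rewrite Ep in Hn.
  apply (cderiv_ext_loc (fun w => h b + / p (h w) * (w - b))%C h b _ (Rmin d r)).
  - now apply Rmin_glb_lt.
  - intros w Hw.
    specialize (Hn w (Rlt_le_trans _ _ _ Hw (Rmin_l _ _))).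
    specialize (Hfh w (Rlt_le_trans _ _ _ Hw (Rmin_r _ _))).
    generalize (Hp (h w)). rewrite Hfh, Hb. intros ->.
    assert (p (h w) <> 0) by (apply Cmod_gt_0; generalize (Cmod_ge_0 l); lra).
    field. auto.
  - exists (fun w => / p (h w))%C. repeat split.
    + apply ccont_inv; [easy|]. now rewrite Ep.
    + now rewrite Ep.
    + intros w. ring.
Qed.

Lemma cderiv_Cinv (z : C) : z <> 0 -> cderiv (fun w => / w)%C z (- (1) / (z * z)).
Proof.
  intros Hz.
  assert (P : 0 < Cmod z) by now apply Cmod_gt_0.
  apply (cderiv_ext_loc (fun w => / z + - (/ w * / z) * (w - z))%C _ z _ (Cmod z) P).
  - intros w Hw. assert (w <> 0).
    { intros ->. replace (0 - z)%C with (- z)%C in Hw by ring. rewrite Cmod_opp in Hw. lra. }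
    field. auto.
  - exists (fun w => -(1) * (/ w * / z))%C. repeat split.
    + apply ccont_mult; [apply ccont_const|]. apply ccont_mult; [|apply ccont_const].
      apply ccont_inv; [apply ccont_id|easy].
    + field. easy.
    + intros w. ring.
Qed.

Lemma is_derive_to_cderiv (f : C -> C) (z l : C) :
  is_derive (K := C_AbsRing) (V := C_NormedModule) f z l -> cderiv f z l.
Proof.
  intros [_ H]. apply cderiv_intro. intros e He.
  assert (Hlim : is_filter_lim (locally (T := AbsRing_UniformSpace C_AbsRing) z) z)
    by (intros P HP; exact HP).
  destruct (H z Hlim (mkposreal e He)) as [d Hd].
  exists d. split; [apply cond_pos|]. intros w Hw.
  specialize (Hd w Hw). simpl in Hd.
  match type of Hd with ?a <= _ => change a with (Cmod ((f w - f z) - (w - z) * l)) in Hd end.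
  change (Cmod ((f w - f z) - (w - z) * l) <= e * Cmod (w - z)) in Hd.
  now rewrite (Cmult_comm (w - z)) in Hd.
Qed.

(** * Goursat's theorem on rectangles *)

Lemma nested_intervals (a b : nat -> R) :
  (forall n, a n <= a (S n)) -> (forall n, b (S n) <= b n) -> (forall n, a n <= b n) ->
  exists x, forall n, a n <= x <= b n.
Proof.
  intros Ha Hb Hab.
  assert (Ma : forall n k, a n <= a (n + k)%nat).
  { intros n k. induction k. rewrite Nat.add_0_r; lra.
    rewrite Nat.add_succ_r. specialize (Ha (n + k)%nat). lra. }
  assert (Mb : forall n k, b (n + k)%nat <= b n).
  { intros n k. induction k. rewrite Nat.add_0_r; lra.
    rewrite Nat.add_succ_r. specialize (Hb (n + k)%nat). lra. }
  assert (Hnm : forall n m, a n <= b m).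
  { intros n m. apply Rle_trans with (a (n + m)%nat); [apply Ma|].
    apply Rle_trans with (b (n + m)%nat); [apply Hab|]. rewrite Nat.add_comm. apply Mb. }
  destruct (completeness (fun x => exists n, x = a n)) as [x [H1 H2]].
  - exists (b 0%nat). intros y [n ->]. apply Hnm.
  - exists (a 0%nat). now exists 0%nat.
  - exists x. intros n. split.
    + apply H1. now exists n.
    + apply H2. intros y [m ->]. apply Hnm.
Qed.

Lemma half_pow_small (L d : R) : 0 < d -> exists n, L * (/ 2) ^ n < d.
Proof.
  intros Hd. destruct (Rle_dec L 0) as [HL|HL].
  - exists 0%nat. simpl. lra.
  - destruct (pow_lt_1_zero (/ 2)) with (y := d / L) as [n Hn].
    + rewrite Rabs_right; lra.
    + apply Rdiv_lt_0_compat; lra.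
    + exists n. specialize (Hn n (le_n _)).
      rewrite Rabs_right in Hn by (apply Rle_ge, pow_le; lra).
      apply (Rmult_lt_compat_l L) in Hn; [|lra].
      replace (L * (d / L)) with d in Hn by (field; lra). easy.
Qed.

(** A property of rectangles holds as soon as it is inherited from the four
    quarters and holds for small rectangles around each point: otherwise some
    nested sequence of failing quarters would shrink to a point.  Goursat's
    theorem and the compactness arguments below are both of this form. *)
Lemma rectangle_bisection (P : R -> R -> R -> R -> Prop) (a b c d : R) :
  a <= b -> c <= d ->
  (forall a' b' c' d', a' <= b' -> c' <= d' ->
     P a' ((a' + b') / 2) c' ((c' + d') / 2) -> P a' ((a' + b') / 2) ((c' + d') / 2) d' ->
     P ((a' + b') / 2) b' c' ((c' + d') / 2) -> P ((a' + b') / 2) b' ((c' + d') / 2) d' ->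
     a <= a' -> b' <= b -> c <= c' -> d' <= d ->
     P a' b' c' d') ->
  (forall x y, a <= x <= b -> c <= y <= d -> exists r, 0 < r /\
     forall a' b' c' d', a <= a' -> b' <= b -> c <= c' -> d' <= d ->
       a' <= x <= b' -> c' <= y <= d' -> b' - a' < r -> d' - c' < r -> P a' b' c' d') ->
  P a b c d.
Proof.
  intros Hab Hcd Hquarter Hlocal. apply NNPP. intros HP.
  set (bad := fun q : (R * R) * (R * R) =>
    ~ P (fst (fst q)) (snd (fst q)) (fst (snd q)) (snd (snd q))).
  set (ok := fun q : (R * R) * (R * R) =>
    a <= fst (fst q) /\ fst (fst q) <= snd (fst q) /\ snd (fst q) <= b /\
    c <= fst (snd q) /\ fst (snd q) <= snd (snd q) /\ snd (snd q) <= d).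
  assert (Hnext : forall q, ok q /\ bad q -> exists q', (ok q' /\ bad q') /\
    fst (fst q) <= fst (fst q') /\ snd (fst q') <= snd (fst q) /\
    fst (snd q) <= fst (snd q') /\ snd (snd q') <= snd (snd q) /\
    snd (fst q') - fst (fst q') = (snd (fst q) - fst (fst q)) * / 2 /\
    snd (snd q') - fst (snd q') = (snd (snd q) - fst (snd q)) * / 2).
  { intros [[a' b'] [c' d']] [Hok Hbad]. unfold ok, bad in *. simpl in *.
    apply NNPP. intros Hno. apply Hbad. clear Hbad.
    assert (Q : forall a1 b1 c1 d1, a' <= a1 -> b1 <= b' -> c' <= c1 -> d1 <= d' ->
      b1 - a1 = (b' - a') * / 2 -> d1 - c1 = (d' - c') * / 2 -> P a1 b1 c1 d1).
    { intros a1 b1 c1 d1 I1 I2 I3 I4 I5 I6. apply NNPP. intros Hn. apply Hno.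
      exists ((a1, b1), (c1, d1)). simpl. repeat split; try easy; lra. }
    apply Hquarter; try lra; apply Q; lra. }
  assert (Hseq : exists p, forall n, (ok (p n) /\ bad (p n)) /\
    fst (fst (p n)) <= fst (fst (p (S n))) /\ snd (fst (p (S n))) <= snd (fst (p n)) /\
    fst (snd (p n)) <= fst (snd (p (S n))) /\ snd (snd (p (S n))) <= snd (snd (p n)) /\
    snd (fst (p n)) - fst (fst (p n)) = (b - a) * (/ 2) ^ n /\
    snd (snd (p n)) - fst (snd (p n)) = (d - c) * (/ 2) ^ n).
  { assert (H0 : ok ((a, b), (c, d)) /\ bad ((a, b), (c, d)))
      by (unfold ok, bad; simpl; repeat split; auto; lra).
    set (next := fun t : {q | ok q /\ bad q} =>
      let e := constructive_indefinite_description _ (Hnext (proj1_sig t) (proj2_sig t)) in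
      exist (fun q => ok q /\ bad q) (proj1_sig e) (proj1 (proj2_sig e))).
    set (s := nat_rect (fun _ => {q | ok q /\ bad q}) (exist _ _ H0) (fun _ t => next t)).
    exists (fun n => proj1_sig (s n)).
    assert (Hstep := fun n => proj2 (proj2_sig (constructive_indefinite_description _
      (Hnext (proj1_sig (s n)) (proj2_sig (s n)))))).
    change (forall n, let q := proj1_sig (s n) in let q' := proj1_sig (s (S n)) in
      fst (fst q) <= fst (fst q') /\ snd (fst q') <= snd (fst q) /\
      fst (snd q) <= fst (snd q') /\ snd (snd q') <= snd (snd q) /\
      snd (fst q') - fst (fst q') = (snd (fst q) - fst (fst q)) * / 2 /\
      snd (snd q') - fst (snd q') = (snd (snd q) - fst (snd q)) * / 2) in Hstep.
    intros n. split; [exact (proj2_sig (s n))|].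
    destruct (Hstep n) as (S1 & S2 & S3 & S4 & _).
    do 4 (split; [easy|]). clear S1 S2 S3 S4.
    induction n as [|n IH]; [simpl; lra|].
    destruct (Hstep n) as (_ & _ & _ & _ & -> & ->).
    destruct IH as [-> ->]. simpl pow. split; ring. }
  destruct Hseq as [p Hp].
  destruct (nested_intervals (fun n => fst (fst (p n))) (fun n => snd (fst (p n)))) as [x Hx];
    try (intros n; destruct (Hp n) as [[O _] ?]; unfold ok in O; lra).
  destruct (nested_intervals (fun n => fst (snd (p n))) (fun n => snd (snd (p n)))) as [y Hy];
    try (intros n; destruct (Hp n) as [[O _] ?]; unfold ok in O; lra).
  simpl in Hx, Hy.
  destruct (Hlocal x y) as [r [Hr HPr]].
  - specialize (Hx 0%nat). destruct (Hp 0%nat) as [[O _] _]. unfold ok in O. lra.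
  - specialize (Hy 0%nat). destruct (Hp 0%nat) as [[O _] _]. unfold ok in O. lra.
  - destruct (half_pow_small (Rmax (b - a) (d - c)) r Hr) as [n Hn].
    destruct (Hp n) as [[On Bn] (_ & _ & _ & _ & S1 & S2)].
    apply Bn. unfold ok in On. specialize (Hx n). specialize (Hy n).
    assert (H2 : 0 <= (/ 2) ^ n) by (apply pow_le; lra).
    generalize (Rmult_le_compat_r _ _ _ H2 (Rmax_l (b - a) (d - c)))
      (Rmult_le_compat_r _ _ _ H2 (Rmax_r (b - a) (d - c))). intros M1 M2.
    apply HPr; lra.
Qed.

(** The real part of the integral of [g dz] around the rectangle, with opposite
    sides paired.  For affine [g] both integrands are constant. *)
Definition rect_circulation (g : C -> C) (a b c d : R) : R :=
  RInt (fun x => Re (g (x, c)) - Re (g (x, d))) a b -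
  RInt (fun y => Im (g (b, y)) - Im (g (a, y))) c d.

Lemma ccont_Re_line (g : C -> C) (p q : C) (t : R) :
  ccont g (p + RtoC t * q)%C -> continuous (fun s => Re (g (p + RtoC s * q)%C)) t.
Proof.
  intros H. apply continuity_pt_filterlim. intros e He.
  destruct (H e He) as [r [Hr H1]].
  assert (P : 0 < 1 + Cmod q) by (generalize (Cmod_ge_0 q); lra).
  exists (r / (1 + Cmod q)). split; [now apply Rdiv_lt_0_compat|].
  intros s [_ Hs]. simpl in *. unfold R_dist in *.
  rewrite <- Re_minus. eapply Rle_lt_trans; [apply Re_le_Cmod|]. apply H1.
  replace (p + RtoC s * q - (p + RtoC t * q))%C with (RtoC (s - t) * q)%C
    by (rewrite RtoC_minus; ring).
  rewrite Cmod_mult, Cmod_R. apply (Rmult_lt_compat_r (1 + Cmod q)) in Hs; [|easy].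
  unfold Rdiv in Hs. rewrite Rmult_assoc, Rinv_l, Rmult_1_r in Hs by lra.
  generalize (Rabs_pos (s - t)). intros. nra.
Qed.

Lemma ccont_rotate (g : C -> C) (k z : C) : ccont g z -> ccont (fun w => k * g w)%C z.
Proof. intros H. apply ccont_mult; [apply ccont_const|easy]. Qed.

Lemma Im_as_Re (z : C) : Im z = Re (- Ci * z).
Proof. destruct z; unfold Re, Im, Ci; simpl; ring. Qed.

Lemma ccont_Im_line (g : C -> C) (p q : C) (t : R) :
  ccont g (p + RtoC t * q)%C -> continuous (fun s => Im (g (p + RtoC s * q)%C)) t.
Proof.
  intros H. apply (continuous_ext (fun s => Re (- Ci * g (p + RtoC s * q)%C))).
  - intros s. now rewrite Im_as_Re.
  - apply (ccont_Re_line (fun w => - Ci * g w)%C). now apply ccont_rotate.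
Qed.

Lemma horizontal_line (x c : R) : ((x, c) : C) = ((0, c) + RtoC x * 1)%C.
Proof. unfold Cplus, Cmult, RtoC; simpl; f_equal; ring. Qed.

Lemma vertical_line (x y : R) : ((x, y) : C) = (RtoC x + RtoC y * Ci)%C.
Proof. unfold Cplus, Cmult, RtoC, Ci; simpl; f_equal; ring. Qed.

Lemma continuous_Re_h (g : C -> C) (x c : R) :
  ccont g (x, c) -> continuous (fun x => Re (g (x, c))) x.
Proof.
  intros H. apply (continuous_ext (fun s => Re (g ((0, c) + RtoC s * 1)%C))).
  - intros s. now rewrite <- horizontal_line.
  - apply ccont_Re_line. now rewrite <- horizontal_line.
Qed.

Lemma continuous_Im_h (g : C -> C) (x c : R) :
  ccont g (x, c) -> continuous (fun x => Im (g (x, c))) x.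
Proof.
  intros H. apply (continuous_ext (fun s => Im (g ((0, c) + RtoC s * 1)%C))).
  - intros s. now rewrite <- horizontal_line.
  - apply ccont_Im_line. now rewrite <- horizontal_line.
Qed.

Lemma continuous_Re_v (g : C -> C) (x y : R) :
  ccont g (x, y) -> continuous (fun y => Re (g (x, y))) y.
Proof.
  intros H. apply (continuous_ext (fun s => Re (g (RtoC x + RtoC s * Ci)%C))).
  - intros s. now rewrite <- vertical_line.
  - apply ccont_Re_line. now rewrite <- vertical_line.
Qed.

Lemma continuous_Im_v (g : C -> C) (x y : R) :
  ccont g (x, y) -> continuous (fun y => Im (g (x, y))) y.
Proof.
  intros H. apply (continuous_ext (fun s => Im (g (RtoC x + RtoC s * Ci)%C))).
  - intros s. now rewrite <- vertical_line.
  - apply ccont_Im_line. now rewrite <- vertical_line.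
Qed.

Lemma ex_derive_continuous_R (f : R -> R) (x : R) : ex_derive f x -> continuous f x.
Proof. apply (ex_derive_continuous (V := R_NormedModule)). Qed.

Lemma ex_RInt_cont (f : R -> R) (a b : R) :
  a <= b -> (forall t, a <= t <= b -> continuous f t) -> ex_RInt f a b.
Proof.
  intros Hab H. apply (ex_RInt_continuous (V := R_CompleteNormedModule)).
  intros z. rewrite Rmin_left, Rmax_right by easy. apply H.
Qed.

Lemma RInt_near_const (f : R -> R) (a b K M : R) :
  a <= b -> ex_RInt f a b -> (forall t, a <= t <= b -> Rabs (f t - K) <= M) ->
  Rabs (RInt f a b - (b - a) * K) <= (b - a) * M.
Proof.
  intros Hab Hf H.
  replace (RInt f a b - (b - a) * K) with (RInt (fun t => f t - K) a b).
  - apply abs_RInt_le_const; [easy| |easy].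
    apply (ex_RInt_minus (V := R_NormedModule)); [easy|apply ex_RInt_const].
  - rewrite (RInt_minus (V := R_CompleteNormedModule)) by (auto; apply ex_RInt_const).
    rewrite RInt_const. reflexivity.
Qed.

(** On a rectangle of half-perimeter [s] around a point of differentiability the
    circulation is [o(s^2)], and [s^2] is additive under division into quarters. *)
Lemma goursat (g : C -> C) (a b c d : R) :
  a <= b -> c <= d ->
  (forall x y, a <= x <= b -> c <= y <= d -> exists l, cderiv g (x, y) l) ->
  rect_circulation g a b c d = 0.
Proof.
  intros Hab Hcd Hg.
  assert (Hc : forall x y, a <= x <= b -> c <= y <= d -> ccont g (x, y)).
  { intros x y Hx Hy. destruct (Hg x y Hx Hy) as [l Hl]. now apply cderiv_cont in Hl. }
  assert (Key : forall eps, 0 < eps -> Rabs (rect_circulation g a b c d) <=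
      eps * (((b - a) + (d - c)) * ((b - a) + (d - c)))).
  { intros eps He.
    apply (rectangle_bisection (fun a b c d => Rabs (rect_circulation g a b c d) <=
      eps * (((b - a) + (d - c)) * ((b - a) + (d - c)))) a b c d Hab Hcd).
    - intros a' b' c' d' Ha' Hc' Q1 Q2 Q3 Q4 I1 I2 I3 I4.
      set (m := (a' + b') / 2) in *. set (n := (c' + d') / 2) in *.
      assert (Hm : a' <= m <= b') by (unfold m; lra).
      assert (Hn : c' <= n <= d') by (unfold n; lra).
      assert (EH : forall y y' u v, a' <= u -> v <= b' -> c' <= y <= d' -> c' <= y' <= d' ->
        u <= v -> ex_RInt (fun x => Re (g (x, y)) - Re (g (x, y'))) u v).
      { intros. apply (ex_RInt_minus (V := R_NormedModule)); apply ex_RInt_cont; try lra;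
        intros; apply continuous_Re_h, Hc; lra. }
      assert (EV : forall x x' u v, c' <= u -> v <= d' -> a' <= x <= b' -> a' <= x' <= b' ->
        u <= v -> ex_RInt (fun y => Im (g (x, y)) - Im (g (x', y))) u v).
      { intros. apply (ex_RInt_minus (V := R_NormedModule)); apply ex_RInt_cont; try lra;
        intros; apply continuous_Im_v, Hc; lra. }
      assert (E : rect_circulation g a' b' c' d' =
        (rect_circulation g a' m c' n + rect_circulation g a' m n d') +
        (rect_circulation g m b' c' n + rect_circulation g m b' n d')).
      { unfold rect_circulation.
        assert (SH : forall u v, a' <= u -> v <= b' -> u <= v ->
          RInt (fun x => Re (g (x, c')) - Re (g (x, d'))) u v =
          RInt (fun x => Re (g (x, c')) - Re (g (x, n))) u v +
          RInt (fun x => Re (g (x, n)) - Re (g (x, d'))) u v).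
        { intros u v Hu Hv Huv.
          rewrite <- (RInt_plus (V := R_CompleteNormedModule)) by (apply EH; lra).
          apply RInt_ext. intros. unfold plus; simpl. ring. }
        assert (SV : forall u v, c' <= u -> v <= d' -> u <= v ->
          RInt (fun y => Im (g (b', y)) - Im (g (a', y))) u v =
          RInt (fun y => Im (g (b', y)) - Im (g (m, y))) u v +
          RInt (fun y => Im (g (m, y)) - Im (g (a', y))) u v).
        { intros u v Hu Hv Huv.
          rewrite <- (RInt_plus (V := R_CompleteNormedModule)) by (apply EV; lra).
          apply RInt_ext. intros. unfold plus; simpl. ring. }
        rewrite <- (RInt_Chasles
          (fun x => Re (g (x, c')) - Re (g (x, d'))) a' m b') by (apply EH; lra).
        rewrite <- (RInt_Chasles
          (fun y => Im (g (b', y)) - Im (g (a', y))) c' n d') by (apply EV; lra).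
        unfold plus; simpl.
        rewrite !SH, !SV by lra. ring. }
      rewrite E.
      eapply Rle_trans; [apply Rabs_triang|].
      eapply Rle_trans; [apply Rplus_le_compat; apply Rabs_triang|].
      replace (m - a') with ((b' - a') / 2) in * by (unfold m; field).
      replace (b' - m) with ((b' - a') / 2) in * by (unfold m; field).
      replace (n - c') with ((d' - c') / 2) in * by (unfold n; field).
      replace (d' - n) with ((d' - c') / 2) in * by (unfold n; field).
      nra.
    - intros x y Hx Hy. destruct (Hg x y Hx Hy) as [l Hl].
      destruct (cderiv_elim _ _ _ Hl (eps / 2)) as [r [Hr H]]; [lra|].
      exists (r / 2). split; [lra|].
      intros a' b' c' d' I1 I2 I3 I4 J1 J2 K1 K2.
      set (s := (b' - a') + (d' - c')).
      assert (Hs : 0 <= s) by (unfold s; lra).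
      assert (B : forall u v, a' <= u <= b' -> c' <= v <= d' ->
        Cmod (g (u, v) - g (x, y) - l * ((u, v) - (x, y))) <= eps / 2 * s).
      { intros u v Hu Hv.
        assert (D : Cmod ((u, v) - (x, y)) <= s).
        { eapply Rle_trans; [apply Cmod_le_Re_Im|].
          unfold Re, Im, s; simpl. apply Rplus_le_compat; apply Rabs_le; lra. }
        eapply Rle_trans; [apply H|].
        - unfold s in D. lra.
        - apply Rmult_le_compat_l; lra. }
      assert (BH : Rabs (RInt (fun x => Re (g (x, c')) - Re (g (x, d'))) a' b' -
        (b' - a') * (Im l * (d' - c'))) <= (b' - a') * (eps * s)).
      { apply RInt_near_const; [lra| |].
        - apply (ex_RInt_minus (V := R_NormedModule)); apply ex_RInt_cont; try lra;
          intros; apply continuous_Re_h, Hc; lra.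
        - intros u Hu.
          replace (Re (g (u, c')) - Re (g (u, d')) - Im l * (d' - c')) with
            (Re ((g (u, c') - g (x, y) - l * ((u, c') - (x, y))) -
                 (g (u, d') - g (x, y) - l * ((u, d') - (x, y))))).
          2:{ rewrite !Re_minus, !re_mult. unfold Re, Im; simpl. ring. }
          eapply Rle_trans; [apply Re_le_Cmod|].
          eapply Rle_trans; [apply Cmod_triangle|]. rewrite Cmod_opp.
          generalize (B u c' Hu ltac:(lra)) (B u d' Hu ltac:(lra)). lra. }
      assert (BV : Rabs (RInt (fun y => Im (g (b', y)) - Im (g (a', y))) c' d' -
        (d' - c') * (Im l * (b' - a'))) <= (d' - c') * (eps * s)).
      { apply RInt_near_const; [lra| |].
        - apply (ex_RInt_minus (V := R_NormedModule)); apply ex_RInt_cont; try lra;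
          intros; apply continuous_Im_v, Hc; lra.
        - intros v Hv.
          replace (Im (g (b', v)) - Im (g (a', v)) - Im l * (b' - a')) with
            (Im ((g (b', v) - g (x, y) - l * ((b', v) - (x, y))) -
                 (g (a', v) - g (x, y) - l * ((a', v) - (x, y))))).
          2:{ rewrite !Im_minus, !im_mult. unfold Re, Im; simpl. ring. }
          eapply Rle_trans; [apply Im_le_Cmod|].
          eapply Rle_trans; [apply Cmod_triangle|]. rewrite Cmod_opp.
          generalize (B b' v ltac:(lra) Hv) (B a' v ltac:(lra) Hv). lra. }
      unfold rect_circulation.
      match goal with |- Rabs (?A - ?B) <= _ =>
        replace (A - B) with ((A - (b' - a') * (Im l * (d' - c'))) -
          (B - (d' - c') * (Im l * (b' - a')))) by ring end.
      eapply Rle_trans; [apply Rabs_triang|]. rewrite Rabs_Ropp.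
      eapply Rle_trans; [apply Rplus_le_compat; [apply BH|apply BV]|].
      unfold s. apply Req_le. ring. }
  set (s2 := ((b - a) + (d - c)) * ((b - a) + (d - c))) in *.
  assert (Hs2 : 0 <= s2) by (unfold s2; nra).
  apply Rabs_eq_0. apply Rle_antisym; [|apply Rabs_pos].
  apply le_epsilon. intros e He. rewrite Rplus_0_l.
  eapply Rle_trans; [apply (Key (e / (s2 + 1)))|].
  - apply Rdiv_lt_0_compat; lra.
  - replace e with (e / (s2 + 1) * (s2 + 1)) at 2 by (field; lra).
    apply Rmult_le_compat_l; [|lra].
    apply Rlt_le, Rdiv_lt_0_compat; lra.
Qed.

(** * The complex exponential and the mean value property *)

Definition cexp (z : C) : C := (exp (Re z) * cos (Im z), exp (Re z) * sin (Im z)).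

Lemma Re_cexp (z : C) : Re (cexp z) = exp (Re z) * cos (Im z).
Proof. reflexivity. Qed.

Lemma Im_cexp (z : C) : Im (cexp z) = exp (Re z) * sin (Im z).
Proof. reflexivity. Qed.

Lemma cexp_plus (z w : C) : cexp (z + w) = (cexp z * cexp w)%C.
Proof.
  unfold cexp. rewrite re_plus, im_plus, exp_plus, cos_plus, sin_plus.
  unfold Cmult; simpl; f_equal; ring.
Qed.

Lemma cexp_0 : cexp 0 = 1.
Proof. unfold cexp, Re, Im, RtoC; simpl. rewrite exp_0, cos_0, sin_0. f_equal; ring. Qed.

Lemma Cmod_cexp (z : C) : Cmod (cexp z) = exp (Re z).
Proof.
  rewrite <- (Rabs_right (exp (Re z))) by (apply Rle_ge, Rlt_le, exp_pos).
  unfold Cmod. rewrite <- sqrt_Rsqr_abs. f_equal. unfold cexp, Rsqr; simpl.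
  generalize (sin2_cos2 (Im z)). unfold Rsqr. intros H.
  replace (exp (Re z) * cos (Im z) * (exp (Re z) * cos (Im z) * 1) +
    exp (Re z) * sin (Im z) * (exp (Re z) * sin (Im z) * 1)) with
    (exp (Re z) * exp (Re z) * (sin (Im z) * sin (Im z) + cos (Im z) * cos (Im z))) by ring.
  rewrite H. ring.
Qed.

Lemma cexp_opp (z : C) : (cexp z * cexp (- z))%C = 1.
Proof. rewrite <- cexp_plus, Cplus_opp_r. apply cexp_0. Qed.

Lemma derive_at_0_bound (f : R -> R) (l eps : R) : derivable_pt_lim f 0 l -> 0 < eps ->
  exists d, 0 < d /\ forall h, Rabs h < d -> Rabs (f h - f 0 - l * h) <= eps * Rabs h.
Proof.
  intros Hf He. destruct (Hf eps He) as [d Hd]. exists d. split; [apply cond_pos|].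
  intros h Hh. destruct (Req_dec h 0) as [->|Hn].
  - rewrite Rabs_R0. replace (f 0 - f 0 - l * 0) with 0 by ring. rewrite Rabs_R0. lra.
  - specialize (Hd h Hn Hh). rewrite Rplus_0_l in Hd.
    replace (f h - f 0 - l * h) with (((f h - f 0) / h - l) * h) by (field; auto).
    rewrite Rabs_mult. apply Rmult_le_compat_r; [apply Rabs_pos|lra].
Qed.

Lemma cderiv_cexp_0 : cderiv cexp 0 1.
Proof.
  apply cderiv_intro. intros e He.
  set (k := Rmin (e / 8) (1 / 2)).
  assert (Hk : 0 < k) by (apply Rmin_glb_lt; lra).
  assert (Hk1 : k <= e / 8) by apply Rmin_l. assert (Hk2 : k <= 1 / 2) by apply Rmin_r.
  destruct (derive_at_0_bound exp 1 k) as [d1 [Hd1 H1]]; [|easy|].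
  { generalize (derivable_pt_lim_exp 0). now rewrite exp_0. }
  destruct (derive_at_0_bound cos 0 k) as [d2 [Hd2 H2]]; [|easy|].
  { generalize (derivable_pt_lim_cos 0). now rewrite sin_0, Ropp_0. }
  destruct (derive_at_0_bound sin 1 k) as [d3 [Hd3 H3]]; [|easy|].
  { generalize (derivable_pt_lim_sin 0). now rewrite cos_0. }
  exists (Rmin (Rmin d1 d2) (Rmin d3 k)). split; [repeat apply Rmin_glb_lt; lra|].
  intros w Hw. replace (w - 0)%C with w in * by ring. rewrite cexp_0.
  assert (M1 := Re_le_Cmod w). assert (M2 := Im_le_Cmod w).
  assert (B1 : Cmod w < d1 /\ Cmod w < d2 /\ Cmod w < d3 /\ Cmod w < k).
  { generalize (Rmin_l (Rmin d1 d2) (Rmin d3 k)) (Rmin_r (Rmin d1 d2) (Rmin d3 k))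
      (Rmin_l d1 d2) (Rmin_r d1 d2) (Rmin_l d3 k) (Rmin_r d3 k). lra. }
  destruct w as [x y]. unfold Re, Im in M1, M2. simpl in M1, M2.
  specialize (H1 x ltac:(lra)). specialize (H2 y ltac:(lra)). specialize (H3 y ltac:(lra)).
  rewrite exp_0 in H1. rewrite cos_0 in H2. rewrite sin_0 in H3.
  assert (C1 : Rabs (cos y) <= 1) by (apply Rabs_le; generalize (COS_bound y); lra).
  assert (S1 : Rabs (sin y) <= 1) by (apply Rabs_le; generalize (SIN_bound y); lra).
  assert (X1 : Rabs (1 + x) <= 2).
  { eapply Rle_trans; [apply Rabs_triang|]. rewrite Rabs_R1. lra. }
  eapply Rle_trans; [apply Cmod_le_Re_Im|].
  unfold cexp, Re, Im, Cminus, Copp, Cplus, Cmult, RtoC; simpl.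
  replace (exp x * cos y + - (1) + - (1 * x - 0 * y)) with
    ((exp x - 1 - 1 * x) * cos y + (1 + x) * (cos y - 1 - 0 * y)) by ring.
  replace (exp x * sin y + - 0 + - (1 * y + 0 * x)) with
    (((exp x - 1 - 1 * x) * sin y + (1 + x) * (sin y - 0 - 1 * y)) + x * y) by ring.
  assert (T1 := Rabs_triang ((exp x - 1 - 1 * x) * cos y) ((1 + x) * (cos y - 1 - 0 * y))).
  assert (T2 := Rabs_triang ((exp x - 1 - 1 * x) * sin y) ((1 + x) * (sin y - 0 - 1 * y))).
  assert (T3 := Rabs_triang
    ((exp x - 1 - 1 * x) * sin y + (1 + x) * (sin y - 0 - 1 * y)) (x * y)).
  rewrite !Rabs_mult in T1, T2, T3. rewrite (Rabs_mult (1 + x)) in T1, T2.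
  assert (Px := Rabs_pos x). assert (Py := Rabs_pos y). set (m := Cmod (x, y)) in *.
  assert (U1 : Rabs (exp x - 1 - 1 * x) * Rabs (cos y) <= (k * m) * 1)
    by (apply Rmult_le_compat; try apply Rabs_pos; nra).
  assert (U2 : Rabs (exp x - 1 - 1 * x) * Rabs (sin y) <= (k * m) * 1)
    by (apply Rmult_le_compat; try apply Rabs_pos; nra).
  assert (U3 : Rabs (1 + x) * Rabs (cos y - 1 - 0 * y) <= 2 * (k * m))
    by (apply Rmult_le_compat; try apply Rabs_pos; nra).
  assert (U4 : Rabs (1 + x) * Rabs (sin y - 0 - 1 * y) <= 2 * (k * m))
    by (apply Rmult_le_compat; try apply Rabs_pos; nra).
  assert (U5 : Rabs x * Rabs y <= k * m) by (apply Rmult_le_compat; lra).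
  assert (U6 : k * m <= e / 8 * m) by (apply Rmult_le_compat_r; lra).
  assert (U7 : 0 <= e / 8 * m) by (apply Rmult_le_pos; lra).
  lra.
Qed.

Lemma cderiv_cexp (z : C) : cderiv cexp z (cexp z).
Proof.
  apply cderiv_ext with (fun w => cexp z * cexp (w - z))%C.
  { intros w. rewrite <- cexp_plus. f_equal. ring. }
  apply cderiv_eq with (cexp z * (1 * (1 - 0)))%C; [|ring]. apply cderiv_scal.
  apply (cderiv_comp cexp (fun w => w - z)%C).
  - apply cderiv_minus; [apply cderiv_id|apply cderiv_const].
  - replace (z - z)%C with (RtoC 0) by ring. apply cderiv_cexp_0.
Qed.

Definition circ (a : C) (r t : R) : C := (Re a + r * cos t, Im a + r * sin t).

Lemma circ_cexp (a : C) (s t : R) : (a + cexp (s, t))%C = circ a (exp s) t.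
Proof. reflexivity. Qed.

Lemma Cmod_circ (a : C) (r t : R) : 0 <= r -> Cmod (circ a r t - a) = r.
Proof.
  intros Hr.
  assert (H : Cmod (circ a r t - a) * Cmod (circ a r t - a) = r * r).
  { rewrite Cmod_sqr. unfold circ, Re, Im; simpl. generalize (sin2_cos2 t). unfold Rsqr.
    intros H. transitivity (r * r * (sin t * sin t + cos t * cos t)); [ring|].
    rewrite H. ring. }
  generalize (Cmod_ge_0 (circ a r t - a)). nra.
Qed.

Definition mean_value_on_circle (v : C -> R) (a : C) (r : R) : Prop :=
  ex_RInt (fun t => v (circ a r t)) 0 (2 * PI) /\
  RInt (fun t => v (circ a r t)) 0 (2 * PI) = 2 * PI * v a.

(** In polar coordinates [a + exp w] a punctured disc becomes a half-strip, and
    its circles vertical segments over one period; by Goursat's theorem in the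
    half-strip the circle means do not depend on the radius.  Continuity at the
    centre identifies their common value. *)
Lemma mean_value_Re (f : C -> C) (a : C) (r : R) : 0 < r -> ccont f a ->
  (forall z, 0 < Cmod (z - a) <= r -> exists l, cderiv f z l) ->
  mean_value_on_circle (fun z => Re (f z)) a r.
Proof.
  intros Hr Hca Hf.
  assert (PIpos := PI_RGT_0).
  set (g := fun w => (Ci * f (a + cexp w))%C).
  assert (Dg : forall x y, x <= ln r -> exists l, cderiv g (x, y) l).
  { intros x y Hx. destruct (Hf (a + cexp (x, y))%C) as [l Hl].
    - replace (a + cexp (x, y) - a)%C with (cexp (x, y)) by ring. rewrite Cmod_cexp.
      unfold Re; simpl. split; [apply exp_pos|].
      rewrite <- (exp_ln r Hr). destruct Hx as [Hx| ->]; [now apply Rlt_le, exp_increasing|lra].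
    - eexists. apply cderiv_scal. apply (cderiv_comp f (fun w => a + cexp w)%C); [|exact Hl].
      apply cderiv_plus; [apply cderiv_const|apply cderiv_cexp]. }
  assert (Img : forall x y, Im (g (x, y)) = Re (f (circ a (exp x) y))).
  { intros x y. unfold g. rewrite circ_cexp. destruct (f (circ a (exp x) y)) as [u v].
    unfold Re, Im, Ci; simpl. ring. }
  assert (Ex : forall x, x <= ln r -> ex_RInt (fun t => Re (f (circ a (exp x) t))) 0 (2 * PI)).
  { intros x Hx. apply ex_RInt_ext with (fun y => Im (g (x, y))); [intros; apply Img|].
    apply ex_RInt_cont; [lra|]. intros t _. apply continuous_Im_v.
    destruct (Dg x t Hx) as [l Hl]. now apply cderiv_cont in Hl. }
  assert (Hconst : forall x, x <= ln r ->
    RInt (fun t => Re (f (circ a (exp x) t))) 0 (2 * PI) =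
    RInt (fun t => Re (f (circ a (exp (ln r)) t))) 0 (2 * PI)).
  { intros x Hx.
    generalize (goursat g x (ln r) 0 (2 * PI) Hx ltac:(lra)
      (fun u v Hu _ => Dg u v (proj2 Hu))).
    unfold rect_circulation.
    rewrite (RInt_ext
      (fun x => Re (g (x, 0)) - Re (g (x, 2 * PI))) (fun _ => 0)).
    2:{ intros u _. unfold g. rewrite !circ_cexp. unfold circ.
        rewrite cos_2PI, sin_2PI, cos_0, sin_0. now apply Rminus_diag_eq. }
    rewrite RInt_const.
    rewrite (RInt_ext
      (fun y => Im (g (ln r, y)) - Im (g (x, y)))
      (fun y => Re (f (circ a (exp (ln r)) y)) - Re (f (circ a (exp x) y)))).
    2:{ intros u _. now rewrite !Img. }
    rewrite (RInt_minus (V := R_CompleteNormedModule)) by (apply Ex; lra).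
    unfold minus, plus, opp, scal; simpl. unfold mult; simpl. lra. }
  unfold mean_value_on_circle. rewrite <- (exp_ln r Hr). split; [apply Ex; lra|].
  match goal with |- ?A = ?B => cut (Rabs (A - B) <= 0) end.
  { intros H. apply Rminus_diag_uniq. apply Rabs_eq_0. apply Rle_antisym; [easy|apply Rabs_pos]. }
  apply le_epsilon. intros e He. rewrite Rplus_0_l.
  destruct (Hca (e / (2 * PI))) as [d [Hd H]]; [apply Rdiv_lt_0_compat; lra|].
  set (x := Rmin (ln r) (ln (d / 2))).
  rewrite <- (Hconst x) by apply Rmin_l.
  replace e with ((2 * PI - 0) * (e / (2 * PI))) by (field; lra).
  replace (2 * PI * Re (f a)) with ((2 * PI - 0) * Re (f a)) by ring.
  apply RInt_near_const; [lra|apply Ex, Rmin_l|].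
  intros t _. rewrite <- Re_minus. eapply Rle_trans; [apply Re_le_Cmod|].
  apply Rlt_le, H. rewrite Cmod_circ by apply Rlt_le, exp_pos.
  apply Rle_lt_trans with (d / 2); [|lra].
  rewrite <- (exp_ln (d / 2)) by lra.
  assert (Hx : x <= ln (d / 2)) by apply Rmin_r.
  destruct Hx as [Hx| ->]; [now apply Rlt_le, exp_increasing|lra].
Qed.

(** * The maximum principle *)

Definition usc_on (X : C -> Prop) (v : C -> R) (a : C) : Prop :=
  forall eps, 0 < eps -> exists d, 0 < d /\
    forall z, X z -> Cmod (z - a) < d -> v z < v a + eps.

Definition set_closed (X : C -> Prop) : Prop :=
  forall p, ~ X p -> exists d, 0 < d /\ forall q, Cmod (q - p) < d -> ~ X q.

Lemma rect_in_disc (x y x' y' d : R) : Rabs (x' - x) < d / 2 -> Rabs (y' - y) < d / 2 ->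
  Cmod ((x', y') - (x, y)) < d.
Proof.
  intros H1 H2. eapply Rle_lt_trans; [apply Cmod_le_Re_Im|].
  unfold Re, Im; simpl. unfold Rminus in *. lra.
Qed.

Lemma usc_attains_max (X : C -> Prop) (v : C -> R) (M : R) (z0 : C) :
  X z0 -> set_closed X -> (forall z, X z -> Cmod z <= M) ->
  (forall a, X a -> usc_on X v a) ->
  exists a, X a /\ forall z, X z -> v z <= v a.
Proof.
  intros Hz0 Hcl Hb Hu. apply NNPP. intros Hno.
  assert (Hbig : forall a, X a -> exists b, X b /\ v a < v b).
  { intros a Ha. apply NNPP. intros Hn. apply Hno. exists a. split; [easy|].
    intros z Hz. apply Rnot_lt_le. intros Hlt. apply Hn. now exists z. }
  assert (HM : 0 <= M) by (eapply Rle_trans; [apply Cmod_ge_0|apply (Hb z0 Hz0)]).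
  assert (H : exists b, X b /\ forall x y, -M <= x <= M -> -M <= y <= M ->
     X (x, y) -> v (x, y) < v b).
  { apply (rectangle_bisection (fun a b c d => exists p, X p /\
      forall x y, a <= x <= b -> c <= y <= d -> X (x, y) -> v (x, y) < v p)
      (-M) M (-M) M ltac:(lra) ltac:(lra)).
    - intros a b c d Hab Hcd [p1 [X1 H1]] [p2 [X2 H2]] [p3 [X3 H3]] [p4 [X4 H4]] _ _ _ _.
      assert (J : forall p q, X p -> X q -> exists s, X s /\ v p <= v s /\ v q <= v s).
      { intros p q Hp Hq. destruct (Rle_dec (v p) (v q)); [exists q|exists p];
        repeat split; auto; lra. }
      destruct (J p1 p2 X1 X2) as [q1 [Y1 [? ?]]]. destruct (J p3 p4 X3 X4) as [q2 [Y2 [? ?]]].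
      destruct (J q1 q2 Y1 Y2) as [q [Y [? ?]]].
      exists q. split; [easy|]. intros x y Hx Hy HX.
      destruct (Rle_dec x ((a + b) / 2)); destruct (Rle_dec y ((c + d) / 2));
      [specialize (H1 x y)|specialize (H2 x y)|specialize (H3 x y)|specialize (H4 x y)];
      match goal with H : _ -> _ -> X _ -> _ |- _ => specialize (H ltac:(lra) ltac:(lra) HX) end;
      lra.
    - intros x y _ _. destruct (classic (X (x, y))) as [HX|HX].
      + destruct (Hbig _ HX) as [b [Hb1 Hb2]].
        destruct (Hu _ HX (v b - v (x, y))) as [d [Hd H]]; [lra|].
        exists (d / 2). split; [lra|].
        intros a' b' c' d' _ _ _ _ J1 J2 K1 K2. exists b. split; [easy|].
        intros x' y' Hx' Hy' HX'. specialize (H _ HX').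
        assert (Cmod ((x', y') - (x, y)) < d) by (apply rect_in_disc; apply Rabs_def1; lra).
        specialize (H H0). lra.
      + destruct (Hcl _ HX) as [d [Hd H]]. exists (d / 2). split; [lra|].
        intros a' b' c' d' _ _ _ _ J1 J2 K1 K2. exists z0. split; [easy|].
        intros x' y' Hx' Hy' HX'. exfalso. apply (H (x', y')); [|easy].
        apply rect_in_disc; apply Rabs_def1; lra. }
  destruct H as [[x y] [HX H]].
  assert (B := Hb _ HX).
  assert (B1 := Re_le_Cmod (x, y)). assert (B2 := Im_le_Cmod (x, y)).
  unfold Re, Im in B1, B2. simpl in B1, B2.
  specialize (H x y).
  assert (-M <= x <= M) by (apply Rabs_le_between; lra).
  assert (-M <= y <= M) by (apply Rabs_le_between; lra).
  specialize (H ltac:(lra) ltac:(lra) HX). lra.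
Qed.

(** Adding a small multiple of [|z|^2] makes the mean value inequality strict,
    which excludes an interior maximum.  Upper semicontinuity admits comparison functions on a
    half-disc that are discontinuous at its two corners. *)
Lemma maximum_principle (X B : C -> Prop) (v : C -> R) (m M : R) :
  set_closed X -> (forall z, X z -> Cmod z <= M) ->
  (forall a, X a -> usc_on X v a) ->
  (forall z, X z -> B z -> v z <= m) ->
  (forall a, X a -> ~ B a -> exists r, 0 < r /\ mean_value_on_circle v a r /\
     forall z, Cmod (z - a) <= r -> X z) ->
  forall z, X z -> v z <= m.
Proof.
  intros Hcl Hb Hu HB Hmv z0 Hz0. apply Rnot_lt_le. intros Hlt.
  assert (HM : 0 <= M) by (eapply Rle_trans; [apply Cmod_ge_0|apply (Hb z0 Hz0)]).
  set (e := (v z0 - m) / (2 * (M * M + 1))).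
  assert (He : 0 < e) by (apply Rdiv_lt_0_compat; nra).
  assert (HeM : e * (M * M) < v z0 - m).
  { apply Rlt_le_trans with (e * (2 * (M * M + 1))); [nra|].
    unfold e. apply Req_le. field. nra. }
  set (w := fun z => v z + e * (Re z * Re z + Im z * Im z)).
  destruct (usc_attains_max X w M z0 Hz0 Hcl Hb) as [a [Ha Hmax]].
  { intros a Ha k Hk. destruct (Hu a Ha (k / 2)) as [d1 [Hd1 H1]]; [lra|].
    set (d2 := k / (2 * (e * (2 * M + 1)))).
    assert (P : 0 < e * (2 * M + 1)) by (apply Rmult_lt_0_compat; lra).
    assert (Hd2 : 0 < d2) by (apply Rdiv_lt_0_compat; lra).
    exists (Rmin d1 d2). split; [now apply Rmin_glb_lt|]. intros z Hz Hza.
    specialize (H1 z Hz (Rlt_le_trans _ _ _ Hza (Rmin_l _ _))).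
    assert (H2 := Rlt_le_trans _ _ _ Hza (Rmin_r _ _)). unfold w.
    rewrite <- !Cmod_sqr.
    assert (T := Cmod_le_sum z a). assert (Bz := Hb z Hz). assert (Ba := Hb a Ha).
    assert (P1 := Cmod_ge_0 z). assert (P2 := Cmod_ge_0 a). assert (P3 := Cmod_ge_0 (z - a)).
    assert (Q : Cmod z * Cmod z - Cmod a * Cmod a <= d2 * (2 * M + 1)) by nra.
    assert (Q2 : e * (d2 * (2 * M + 1)) = k / 2).
    { unfold d2. field. split; lra. }
    assert (Q3 : e * (Cmod z * Cmod z - Cmod a * Cmod a) <= e * (d2 * (2 * M + 1)))
      by (apply Rmult_le_compat_l; lra).
    lra. }
  destruct (classic (B a)) as [HBa|HBa].
  - specialize (HB a Ha HBa). specialize (Hmax z0 Hz0). unfold w in Hmax.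
    rewrite <- !Cmod_sqr in Hmax.
    assert (P1 := Cmod_ge_0 z0). assert (P2 := Cmod_ge_0 a). assert (P3 := Hb a Ha).
    assert (Cmod a * Cmod a <= M * M) by nra.
    assert (e * (Cmod a * Cmod a) <= e * (M * M)) by (apply Rmult_le_compat_l; lra).
    nra.
  - destruct (Hmv a Ha HBa) as [r [Hr [[Hex Hmean] HX]]].
    assert (PIpos := PI_RGT_0).
    set (bound := fun t => (v a - e * (r * r)) + (- (2 * e * r * Re a) * cos t +
      - (2 * e * r * Im a) * sin t)).
    set (prim := fun t => (v a - e * (r * r)) * t + (- (2 * e * r * Re a) * sin t +
      - (2 * e * r * Im a) * - cos t)).
    assert (HI : is_RInt bound 0 (2 * PI) (prim (2 * PI) - prim 0)).
    { apply (is_RInt_derive (V := R_CompleteNormedModule)).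
      - intros t _. unfold prim, bound. auto_derive; [easy|ring].
      - intros t _. apply ex_derive_continuous_R.
        unfold bound. auto_derive. easy. }
    assert (Hle : RInt (fun t => v (circ a r t)) 0 (2 * PI) <= RInt bound 0 (2 * PI)).
    { apply RInt_le; [lra|easy|now exists (prim (2 * PI) - prim 0)|].
      intros t _.
      assert (Hm := Hmax (circ a r t) (HX (circ a r t) ltac:(rewrite Cmod_circ; lra))).
      unfold w in Hm. unfold circ in Hm at 2 3 4 5. unfold Re, Im in Hm. simpl in Hm.
      unfold bound, Re, Im. generalize (sin2_cos2 t). unfold Rsqr. intros SC.
      assert (E : e * (r * r) = e * (r * r) * (sin t * sin t + cos t * cos t))
        by (rewrite SC; ring).
      rewrite E. lra. }
    rewrite (is_RInt_unique _ _ _ _ HI) in Hle. rewrite Hmean in Hle.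
    unfold prim in Hle. rewrite sin_2PI, cos_2PI, sin_0, cos_0 in Hle.
    assert (0 < e * (r * r)) by (apply Rmult_lt_0_compat; nra). nra.
Qed.

(** * Injective holomorphic functions *)

Lemma ccont_usc_Re (X : C -> Prop) (f : C -> C) (a : C) :
  ccont f a -> usc_on X (fun z => Re (f z)) a.
Proof.
  intros H e He. destruct (H e He) as [d [Hd H1]]. exists d. split; [easy|].
  intros z _ Hz. specialize (H1 z Hz).
  assert (H2 := Re_le_Cmod (f z - f a)). rewrite Re_minus in H2.
  generalize (Rle_abs (Re (f z) - Re (f a))). lra.
Qed.

Lemma closed_disc_closed (a : C) (r : R) : set_closed (fun z => Cmod (z - a) <= r).
Proof.
  intros p Hp. exists (Cmod (p - a) - r). split; [lra|].
  intros q Hq Hle. generalize (Cmod_sub_triangle p q a). rewrite (Cmod_sym p q). lra.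
Qed.

Lemma disc_bounded (a z : C) (r : R) : Cmod (z - a) <= r -> Cmod z <= r + Cmod a.
Proof. generalize (Cmod_le_sum z a). lra. Qed.

Lemma continuous_nonvanishing_bounded_below (X : C -> Prop) (f : C -> C) (M : R) :
  set_closed X -> (forall z, X z -> Cmod z <= M) -> (forall z, X z -> ccont f z) ->
  (forall z, X z -> f z <> 0) ->
  exists m, 0 < m /\ forall z, X z -> m <= Cmod (f z).
Proof.
  intros Hcl Hb Hf Hn. destruct (classic (exists z, X z)) as [[z0 Hz0]|He].
  - destruct (usc_attains_max X (fun z => - Cmod (f z)) M z0 Hz0 Hcl Hb) as [a [Ha Hmax]].
    + intros a Ha e Hpe. destruct (Hf a Ha e Hpe) as [d [Hd H]]. exists d.
      split; [easy|]. intros z _ Hz. specialize (H z Hz).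
      generalize (Cmod_le_sum (f a) (f z)). rewrite (Cmod_sym (f a)). lra.
    + exists (Cmod (f a)). split; [now apply Cmod_gt_0, Hn|].
      intros z Hz. specialize (Hmax z Hz). lra.
  - exists 1. split; [lra|]. intros z Hz. exfalso. apply He. now exists z.
Qed.

(** The maximum principle for [1 / g], in a form that applies to difference quotients at
    [a]: on circles about [a] the mean value property follows from continuity there,
    and the circles about other points are taken so small that they avoid [a]. *)
Lemma minimum_modulus (g : C -> C) (a : C) (r m : R) : 0 < r -> 0 < m ->
  ccont g a -> (forall z, z <> a -> Cmod (z - a) <= r -> exists l, cderiv g z l) ->
  (forall z, Cmod (z - a) <= r -> g z <> 0) ->
  (forall z, Cmod (z - a) = r -> m <= Cmod (g z)) ->
  forall z, Cmod (z - a) <= r -> m <= Cmod (g z).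
Proof.
  intros Hr Hm Hca Hd Hn Hcirc z0 Hz0.
  assert (Hg0 : 0 < Cmod (g z0)) by now apply Cmod_gt_0, Hn.
  (* the unimodular factor turning [1 / g] at [z0] into its modulus *)
  set (k := (g z0 / RtoC (Cmod (g z0)))%C).
  set (f := fun z => (k * / g z)%C).
  assert (Hk : Cmod k = 1).
  { unfold k. rewrite Cmod_div.
    - rewrite Cmod_R, Rabs_right by lra. field. lra.
    - intros E. apply RtoC_inj in E. lra. }
  assert (Hc : forall z, Cmod (z - a) <= r -> ccont f z).
  { intros z Hz. apply ccont_rotate, ccont_inv; [|now apply Hn].
    destruct (Ceq_dec z a) as [->|Hza]; [easy|].
    destruct (Hd z Hza Hz) as [l Hl]. now apply cderiv_cont in Hl. }
  assert (Hf : forall z, z <> a -> Cmod (z - a) <= r -> exists l, cderiv f z l).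
  { intros z Hza Hz. destruct (Hd z Hza Hz) as [l Hl]. eexists.
    apply cderiv_scal, (cderiv_comp (fun w => / w)%C g); [exact Hl|].
    now apply cderiv_Cinv, Hn. }
  assert (Hmod : forall z, Cmod (z - a) <= r -> Cmod (f z) = / Cmod (g z)).
  { intros z Hz. unfold f. rewrite Cmod_mult, Hk, Cmod_inv by now apply Hn. ring. }
  assert (Hmax : Re (f z0) <= / m).
  { apply (maximum_principle (fun z => Cmod (z - a) <= r) (fun z => Cmod (z - a) = r)
      (fun z => Re (f z)) (/ m) (r + Cmod a)); try easy.
    - apply closed_disc_closed.
    - intros z. apply disc_bounded.
    - intros z Hz. now apply ccont_usc_Re, Hc.
    - intros z Hz HB. eapply Rle_trans; [apply Rle_abs|].
      eapply Rle_trans; [apply Re_le_Cmod|]. rewrite Hmod by easy.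
      apply Rinv_le_contravar; [easy|now apply Hcirc].
    - intros b Hb HnB. destruct (Ceq_dec b a) as [->|Hba].
      + exists r. split; [easy|]. split; [|easy]. apply mean_value_Re; [easy|now apply Hc|].
        intros z [Hz1 Hz2]. apply Hf; [|easy]. intros ->.
        rewrite Cmod_diag in Hz1. lra.
      + assert (Hlt : Cmod (b - a) < r) by lra.
        assert (Hpos := Cmod_pos_neq b a Hba).
        exists (Rmin (r - Cmod (b - a)) (Cmod (b - a) / 2)).
        assert (M1 := Rmin_l (r - Cmod (b - a)) (Cmod (b - a) / 2)).
        assert (M2 := Rmin_r (r - Cmod (b - a)) (Cmod (b - a) / 2)).
        assert (Hin : forall z, Cmod (z - b) <= Rmin (r - Cmod (b - a)) (Cmod (b - a) / 2) ->
          Cmod (z - a) <= r) by (intros z Hz; generalize (Cmod_sub_triangle z b a); lra).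
        split; [apply Rmin_glb_lt; lra|]. split; [|easy].
        apply mean_value_Re; [apply Rmin_glb_lt; lra|now apply Hc|].
        intros z [Hz1 Hz2]. apply Hf; [|now apply Hin]. intros ->.
        rewrite (Cmod_sym a b) in Hz2. lra. }
  replace (f z0) with (RtoC (/ Cmod (g z0))) in Hmax.
  2:{ unfold f, k. rewrite RtoC_inv by lra. field. split; [now apply Hn|].
      intros E. apply RtoC_inj in E. lra. }
  rewrite re_RtoC in Hmax. apply Rnot_lt_le. intros Hlt.
  apply Rinv_lt_contravar in Hlt; [lra|]. now apply Rmult_lt_0_compat.
Qed.

(** If [w] near [f a] were omitted, [f - w] would have modulus smaller at the centre
    than on the boundary circle and no zero. *)
Lemma injective_holomorphic_open (f : C -> C) (a : C) (r : R) : 0 < r ->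
  (forall z, Cmod (z - a) <= r -> exists l, cderiv f z l) ->
  (forall z w, Cmod (z - a) <= r -> Cmod (w - a) <= r -> f z = f w -> z = w) ->
  exists d, 0 < d /\ forall w, Cmod (w - f a) < d -> exists z, Cmod (z - a) <= r /\ f z = w.
Proof.
  intros Hr Hd Hinj.
  assert (Ha : Cmod (a - a) <= r) by (rewrite Cmod_diag; lra).
  assert (Hc : forall w z, Cmod (z - a) <= r -> ccont (fun z => f z - w)%C z).
  { intros w z Hz. destruct (Hd z Hz) as [l Hl]. apply ccont_plus; [|apply ccont_const].
    now apply cderiv_cont in Hl. }
  destruct (continuous_nonvanishing_bounded_below (fun z => Cmod (z - a) = r)
    (fun z => f z - f a)%C (r + Cmod a)) as [m [Hm H]].
  - intros p Hp. exists (Rabs (Cmod (p - a) - r)). split; [apply Rabs_pos_lt; lra|].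
    intros q Hq E. generalize (Cmod_sub_triangle p q a) (Cmod_sub_triangle q p a).
    rewrite (Cmod_sym p q). intros. rewrite E in *.
    revert Hq. unfold Rabs. destruct (Rcase_abs _); lra.
  - intros z Hz. apply disc_bounded. lra.
  - intros z Hz. apply Hc. lra.
  - intros z Hz E. apply Ceq_minus in E. apply Hinj in E; [|lra|easy]. subst z.
    rewrite Cmod_diag in Hz. lra.
  - exists (m / 2). split; [lra|]. intros w Hw. apply NNPP. intros Hno.
    assert (Hmin : m / 2 <= Cmod (f a - w)).
    { apply (minimum_modulus (fun z => f z - w)%C a r (m / 2)); try easy; try lra.
      - now apply Hc.
      - intros z _ Hz. destruct (Hd z Hz) as [l Hl]. eexists.
        apply cderiv_minus; [exact Hl|apply cderiv_const].
      - intros z Hz E. apply Hno. exists z. split; [easy|]. now apply Ceq_minus.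
      - intros z Hz. specialize (H z Hz).
        generalize (Cmod_sub_triangle (f z) w (f a)). lra. }
    rewrite Cmod_sym in Hmin. lra.
Qed.

Lemma cderiv_path (f : C -> C) (p q l : C) (s : R) : cderiv f (p + RtoC s * q)%C l ->
  is_derive (fun s => Re (f (p + RtoC s * q)%C)) s (Re (l * q)) /\
  is_derive (fun s => Im (f (p + RtoC s * q)%C)) s (Im (l * q)).
Proof.
  intros H.
  assert (K : forall h : C -> R, (forall z w, h (z - w)%C = h z - h w) ->
    (forall (k : R) z, h (RtoC k * z)%C = k * h z) -> (forall z, Rabs (h z) <= Cmod z) ->
    is_derive (fun s => h (f (p + RtoC s * q)%C)) s (h (l * q)%C)).
  { intros h h1 h2 h3. apply is_derive_Reals. intros e He.
    assert (Hq := Cmod_ge_0 q). assert (Hq1 : 0 < 1 + Cmod q) by lra.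
    destruct (cderiv_elim _ _ _ H (e / (2 * (1 + Cmod q)))) as [d [Hd H1]];
      [apply Rdiv_lt_0_compat; lra|].
    exists (mkposreal _ (Rdiv_lt_0_compat _ _ Hd Hq1)). simpl. intros k Hk Hkd.
    specialize (H1 (p + RtoC (s + k) * q)%C).
    replace (p + RtoC (s + k) * q - (p + RtoC s * q))%C with (RtoC k * q)%C in H1
      by (rewrite RtoC_plus; ring).
    rewrite Cmod_mult, Cmod_R in H1.
    assert (Hk0 : 0 < Rabs k) by now apply Rabs_pos_lt.
    assert (Hlt : Rabs k * Cmod q < d).
    { apply (Rmult_lt_compat_r (1 + Cmod q)) in Hkd; [|easy].
      unfold Rdiv in Hkd. rewrite Rmult_assoc, Rinv_l, Rmult_1_r in Hkd by lra. nra. }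
    specialize (H1 Hlt).
    replace ((h (f (p + RtoC (s + k) * q)%C) - h (f (p + RtoC s * q)%C)) / k - h (l * q)%C)
      with (h (f (p + RtoC (s + k) * q) - f (p + RtoC s * q) - l * (RtoC k * q))%C / k).
    2:{ rewrite !h1. replace (l * (RtoC k * q))%C with (RtoC k * (l * q))%C by ring.
        rewrite h2. field. easy. }
    unfold Rdiv. rewrite Rabs_mult, Rabs_inv.
    apply (Rmult_lt_reg_r (Rabs k)); [easy|].
    rewrite Rmult_assoc, Rinv_l, Rmult_1_r by lra.
    eapply Rle_lt_trans; [apply h3|]. eapply Rle_lt_trans; [apply H1|].
    replace (e * Rabs k) with (e / (2 * (1 + Cmod q)) * (2 * (1 + Cmod q) * Rabs k)) by (field; lra).
    apply Rmult_lt_compat_l; [apply Rdiv_lt_0_compat; lra|nra]. }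
  split; apply K.
  - apply Re_minus.
  - apply re_scal_l.
  - apply Re_le_Cmod.
  - apply Im_minus.
  - apply im_scal_l.
  - apply Im_le_Cmod.
Qed.

Lemma cderiv_zero_constant (f : C -> C) (p q : C) :
  (forall s, 0 <= s <= 1 -> cderiv f (p + RtoC s * (q - p))%C 0) -> f p = f q.
Proof.
  intros H. replace p with (p + RtoC 0 * (q - p))%C at 1 by ring.
  replace q with (p + RtoC 1 * (q - p))%C at 2 by ring.
  apply C_eq.
  - apply (eq_is_derive (fun s => Re (f (p + RtoC s * (q - p))%C)) 0 1); [|lra].
    intros t Ht. destruct (cderiv_path f p (q - p) 0 t (H t Ht)) as [H1 _].
    now rewrite Cmult_0_l in H1.
  - apply (eq_is_derive (fun s => Im (f (p + RtoC s * (q - p))%C)) 0 1); [|lra].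
    intros t Ht. destruct (cderiv_path f p (q - p) 0 t (H t Ht)) as [_ H1].
    now rewrite Cmult_0_l in H1.
Qed.

(** Suppose the derivative vanished at [a].  For [b] near [a] the difference
    quotient of [f] at [b] is bounded below on a circle around [b], by
    injectivity, but small at [a]; by the minimum principle it has a zero, which
    by injectivity can only be [b] itself.  So the derivative would vanish in a
    neighbourhood of [a] and [f] would be constant there. *)
Lemma injective_holomorphic_deriv_neq_0 (f f' : C -> C) (a : C) (r : R) : 0 < r ->
  (forall z, Cmod (z - a) <= 2 * r -> cderiv f z (f' z)) ->
  (forall z w, Cmod (z - a) <= 2 * r -> Cmod (w - a) <= 2 * r -> f z = f w -> z = w) ->
  f' a <> 0.
Proof.
  intros Hr Hd Hinj Ha0.
  assert (Haa : Cmod (a - a) = 0) by (apply Cmod_diag).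
  destruct (continuous_nonvanishing_bounded_below
    (fun z => r / 2 <= Cmod (z - a) <= 3 * r / 2)
    (fun z => f z - f a)%C (3 * r / 2 + Cmod a)) as [m [Hm H]].
  - intros p Hp.
    assert (Hp' : Cmod (p - a) < r / 2 \/ 3 * r / 2 < Cmod (p - a)) by lra.
    exists (Rmax (r / 2 - Cmod (p - a)) (Cmod (p - a) - 3 * r / 2)).
    split; [unfold Rmax; destruct (Rle_dec _ _); lra|].
    intros q Hq E. generalize (Cmod_sub_triangle p q a) (Cmod_sub_triangle q p a).
    rewrite (Cmod_sym p q). revert Hq. unfold Rmax; destruct (Rle_dec _ _); lra.
  - intros z Hz. apply disc_bounded. lra.
  - intros z Hz. apply ccont_plus; [|apply ccont_const].
    apply (cderiv_cont f z (f' z)), Hd. lra.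
  - intros z Hz E. apply Ceq_minus in E. apply Hinj in E; [|lra|lra]. subst z. lra.
  - destruct (cderiv_elim _ _ _ (Hd a ltac:(lra)) (m / (4 * r))) as [d1 [Hd1 H1]];
      [apply Rdiv_lt_0_compat; lra|].
    destruct (cderiv_cont _ _ _ (Hd a ltac:(lra)) (m / 2)) as [d2 [Hd2 H2]]; [lra|].
    set (d := Rmin (Rmin d1 d2) (r / 2)).
    assert (D1 : d <= d1) by (eapply Rle_trans; apply Rmin_l).
    assert (D2 : d <= d2) by (eapply Rle_trans; [apply Rmin_l|apply Rmin_r]).
    assert (D3 : d <= r / 2) by apply Rmin_r.
    assert (D0 : 0 < d) by (repeat apply Rmin_glb_lt; lra).
    assert (Key : forall b, Cmod (b - a) < d -> f' b = 0).
    { intros b Hb. apply NNPP. intros Hnb.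
      assert (Hba : b <> a) by now intros ->.
      assert (Hpos := Cmod_pos_neq b a Hba).
      destruct (Hd b ltac:(lra)) as [Q [CQ [Eb HQ]]].
      assert (HQn : forall z, z <> b -> Q z = ((f z - f b) / (z - b))%C).
      { intros z Hz. rewrite HQ. field. now apply Cminus_eq_contra. }
      assert (Hin : forall z, Cmod (z - b) <= r -> Cmod (z - a) <= 2 * r)
        by (intros z Hz; generalize (Cmod_sub_triangle z b a); lra).
      specialize (H1 b ltac:(lra)). specialize (H2 b ltac:(lra)).
      rewrite Ha0, Cmult_0_l in H1. replace (f b - f a - 0)%C with (f b - f a)%C in H1 by ring.
      assert (Hmin : m / (2 * r) <= Cmod (Q a)).
      { apply (minimum_modulus Q b r); auto.
        - apply Rdiv_lt_0_compat; lra.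
        - intros z Hz Hzr. eexists.
          apply (cderiv_ext_loc (fun z => (f z - f b) * / (z - b))%C Q z _ (Cmod (z - b))).
          + now apply Cmod_pos_neq.
          + intros w Hw. rewrite HQn; [reflexivity|]. intros ->. rewrite Cmod_sym in Hw. lra.
          + apply cderiv_mult.
            * apply cderiv_minus; [now apply Hd, Hin|apply cderiv_const].
            * apply (cderiv_comp (fun w => / w)%C (fun z => z - b)%C).
              apply cderiv_minus; [apply cderiv_id|apply cderiv_const].
              now apply cderiv_Cinv, Cminus_eq_contra.
        - intros z Hz. destruct (Ceq_dec z b) as [->|Hzb]; [now rewrite Eb|].
          rewrite HQn by easy. intros E.
          apply Hzb. apply Hinj; [now apply Hin|lra|]. apply Ceq_minus.
          replace (f z - f b)%C with ((f z - f b) / (z - b) * (z - b))%C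
            by (field; now apply Cminus_eq_contra).
          rewrite E. ring.
        - intros z Hz. assert (Hzb : z <> b).
          { intros ->. rewrite Cmod_diag in Hz. lra. }
          rewrite HQn by easy. rewrite Cmod_div by now apply Cminus_eq_contra. rewrite Hz.
          assert (m / 2 <= Cmod (f z - f b)).
          { assert (Hz2 : r / 2 <= Cmod (z - a) <= 3 * r / 2).
            { generalize (Cmod_sub_triangle z b a) (Cmod_sub_triangle z a b).
              rewrite (Cmod_sym a b). lra. }
            specialize (H z Hz2). generalize (Cmod_sub_triangle (f z) (f b) (f a)). lra. }
          replace (m / (2 * r)) with (m / 2 / r) by (field; lra).
          apply Rmult_le_compat_r; [|easy]. now apply Rlt_le, Rinv_0_lt_compat.
        - rewrite Cmod_sym. lra. }
      specialize (HQ a). apply (f_equal Cmod) in HQ. rewrite Cmod_mult in HQ.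
      rewrite (Cmod_sym (f a)), (Cmod_sym a b) in HQ.
      replace (m / (2 * r)) with (2 * (m / (4 * r))) in Hmin by (field; lra).
      assert (0 < m / (4 * r)) by (apply Rdiv_lt_0_compat; lra).
      nra. }
    set (b := (a + RtoC (d / 2))%C).
    assert (Hb : Cmod (b - a) = d / 2).
    { unfold b. replace (a + RtoC (d / 2) - a)%C with (RtoC (d / 2)) by ring.
      rewrite Cmod_R, Rabs_right; lra. }
    assert (E : f a = f b).
    { apply cderiv_zero_constant. intros s Hs.
      assert (Hs1 : Cmod (a + RtoC s * (b - a) - a) < d).
      { replace (a + RtoC s * (b - a) - a)%C with (RtoC s * (b - a))%C by ring.
        rewrite Cmod_mult, Cmod_R, Hb, Rabs_right by lra. nra. }
      rewrite <- (Key _ Hs1). apply Hd. lra. }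
    apply Hinj in E; [|lra|lra]. rewrite <- E in Hb. lra.
Qed.

Definition set_open (D : C -> Prop) : Prop :=
  forall p, D p -> exists r, 0 < r /\ forall q, Cmod (q - p) <= r -> D q.

(** Openness of [f] gives continuity of the inverse, and the nonvanishing derivative of [f]
    then gives differentiability. *)
Lemma conformal_inverse (D E : C -> Prop) (f : C -> C) :
  set_open D -> conformal_onto D E f ->
  exists h : C -> C, forall w, E w ->
    D (h w) /\ f (h w) = w /\ exists l, cderiv h w l.
Proof.
  intros HD [Hd [Hinj Honto]].
  assert (Hd1 : forall z, exists l, D z -> cderiv f z l).
  { intros z. destruct (classic (D z)) as [Hz|Hz].
    - destruct (Hd z Hz) as [l Hl]. exists l. intros _. now apply is_derive_to_cderiv.
    - now exists 0. }
  set (f' := fun z => proj1_sig (constructive_indefinite_description _ (Hd1 z))).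
  assert (Hf' : forall z, D z -> cderiv f z (f' z)).
  { intros z. exact (proj2_sig (constructive_indefinite_description _ (Hd1 z))). }
  assert (Hh : forall w, exists z, E w -> D z /\ f z = w).
  { intros w. destruct (classic (E w)) as [Hw|Hw].
    - apply Honto in Hw. destruct Hw as [z Hz]. now exists z.
    - now exists 0. }
  set (h := fun w => proj1_sig (constructive_indefinite_description _ (Hh w))).
  assert (Hh' : forall w, E w -> D (h w) /\ f (h w) = w).
  { intros w. exact (proj2_sig (constructive_indefinite_description _ (Hh w))). }
  assert (Hloc : forall w eps, E w -> 0 < eps -> exists d, 0 < d /\
    forall w', Cmod (w' - w) < d -> E w' /\ Cmod (h w' - h w) < eps).
  { intros w eps Hw He. destruct (Hh' w Hw) as [Dz Ez].
    destruct (HD _ Dz) as [r [Hr HDr]].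
    set (r' := Rmin r (eps / 2)).
    assert (Hr1 : r' <= r) by apply Rmin_l. assert (Hr2 : r' <= eps / 2) by apply Rmin_r.
    assert (Hin : forall z, Cmod (z - h w) <= r' -> D z) by (intros; apply HDr; lra).
    destruct (injective_holomorphic_open f (h w) r') as [d [Hd0 H]].
    - apply Rmin_glb_lt; lra.
    - intros z Hz. exists (f' z). apply Hf', Hin, Hz.
    - intros z z' Hz Hz'. apply Hinj; auto.
    - exists d. split; [easy|]. intros w' Hw'. rewrite Ez in H.
      destruct (H w' Hw') as [z [Hz1 Hz2]].
      assert (Ew' : E w') by (apply Honto; exists z; auto).
      split; [easy|]. destruct (Hh' w' Ew') as [Dz' Ez'].
      replace (h w') with z; [lra|]. apply Hinj; auto. congruence. }
  exists h. intros w Hw. destruct (Hh' w Hw) as [Dz Ez]. repeat split; auto.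
  exists (/ f' (h w))%C. destruct (Hloc w 1 Hw Rlt_0_1) as [d [Hd0 H]].
  apply (cderiv_inverse_function f h w (f' (h w)) d); auto.
  - intros w' Hw'. apply Hh', H, Hw'.
  - intros e He. destruct (Hloc w e Hw He) as [d' [Hd' H']]. exists d'.
    split; [easy|]. intros w' Hw'. now apply H'.
  - destruct (HD _ Dz) as [r [Hr HDr]].
    apply (injective_holomorphic_deriv_neq_0 f f' (h w) (r / 2)); [lra| |].
    + intros z Hz. apply Hf', HDr. lra.
    + intros z z' Hz Hz'. apply Hinj; apply HDr; lra.
Qed.

(** * The principal logarithm on the right half-plane *)

Lemma ccont_Re (f : C -> C) (z : C) : ccont f z -> ccont (fun w => RtoC (Re (f w))) z.
Proof.
  intros H e He. destruct (H e He) as [d [Hd H1]]. exists d. split; [easy|].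
  intros w Hw. rewrite <- RtoC_minus, Cmod_R, <- Re_minus.
  eapply Rle_lt_trans; [apply Re_le_Cmod|auto].
Qed.

Lemma ccont_Im (f : C -> C) (z : C) : ccont f z -> ccont (fun w => RtoC (Im (f w))) z.
Proof.
  intros H e He. destruct (H e He) as [d [Hd H1]]. exists d. split; [easy|].
  intros w Hw. rewrite <- RtoC_minus, Cmod_R, <- Im_minus.
  eapply Rle_lt_trans; [apply Im_le_Cmod|auto].
Qed.

Lemma ccont_Cmod (f : C -> C) (z : C) : ccont f z -> ccont (fun w => RtoC (Cmod (f w))) z.
Proof.
  intros H e He. destruct (H e He) as [d [Hd H1]]. exists d. split; [easy|].
  intros w Hw. specialize (H1 w Hw). rewrite <- RtoC_minus, Cmod_R.
  generalize (Cmod_le_sum (f w) (f z)) (Cmod_le_sum (f z) (f w)).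
  rewrite (Cmod_sym (f z)). intros. apply Rabs_def1; lra.
Qed.

Lemma ccont_real_comp (g : R -> R) (v : C -> R) (z : C) :
  continuity_pt g (v z) -> ccont (fun w => RtoC (v w)) z ->
  ccont (fun w => RtoC (g (v w))) z.
Proof.
  intros Hg Hv e He. destruct (Hg e He) as [d [Hd H]]. destruct (Hv d Hd) as [d' [Hd' H']].
  exists d'. split; [easy|]. intros w Hw. specialize (H' w Hw).
  rewrite <- RtoC_minus, Cmod_R in *.
  destruct (Req_dec (v w) (v z)) as [E|Hn].
  - rewrite E. replace (g (v z) - g (v z)) with 0 by ring. now rewrite Rabs_R0.
  - apply (H (v w)). split; [|easy]. split; [easy|]. congruence.
Qed.

Lemma ccont_pair (u v : C -> R) (z : C) :
  ccont (fun w => RtoC (u w)) z -> ccont (fun w => RtoC (v w)) z ->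
  ccont (fun w => (u w, v w)) z.
Proof.
  intros Hu Hv. apply ccont_ext_loc with (fun w => RtoC (u w) + RtoC (v w) * Ci)%C 1; [lra| |].
  - intros w _. unfold RtoC, Ci, Cplus, Cmult; simpl. f_equal; ring.
  - apply ccont_plus; [easy|]. apply ccont_mult; [easy|apply ccont_const].
Qed.

Definition Clog (w : C) : C := (ln (Cmod w), atan (Im w / Re w)).

Lemma Re_Clog (w : C) : Re (Clog w) = ln (Cmod w).
Proof. reflexivity. Qed.

Lemma Im_Clog (w : C) : Im (Clog w) = atan (Im w / Re w).
Proof. reflexivity. Qed.

Lemma Re_pos_neq_0 (w : C) : 0 < Re w -> w <> 0.
Proof. intros H ->. rewrite re_RtoC in H. lra. Qed.

Lemma Re_pos_Cmod (w : C) : 0 < Re w -> 0 < Cmod w.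
Proof. intros H. now apply Cmod_gt_0, Re_pos_neq_0. Qed.

Lemma cexp_Clog (w : C) : 0 < Re w -> cexp (Clog w) = w.
Proof.
  intros H. assert (Hm := Re_pos_Cmod w H).
  unfold cexp, Clog, Re, Im. simpl. rewrite exp_ln by easy.
  rewrite cos_atan, sin_atan.
  assert (E : sqrt (1 + Rsqr (Im w / Re w)) = Cmod w / Re w).
  { apply sqrt_lem_1.
    - generalize (Rle_0_sqr (Im w / Re w)); lra.
    - apply Rlt_le, Rdiv_lt_0_compat; lra.
    - unfold Rsqr. transitivity (Cmod w * Cmod w / (Re w * Re w)); [field; lra|].
      rewrite Cmod_sqr. field. lra. }
  change (fst w) with (Re w). change (snd w) with (Im w). rewrite E.
  apply C_eq; unfold Re at 1, Im at 1; simpl; field; lra.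
Qed.

Lemma ccont_Clog (w : C) : 0 < Re w -> ccont Clog w.
Proof.
  intros H. assert (Hm := Re_pos_Cmod w H). apply ccont_pair.
  - apply (ccont_real_comp ln Cmod).
    + apply derivable_continuous_pt. exists (/ Cmod w). now apply derivable_pt_lim_ln.
    + apply (ccont_Cmod (fun w => w)), ccont_id.
  - apply (ccont_real_comp atan (fun w => Im w / Re w)).
    + apply derivable_continuous_pt, derivable_pt_atan.
    + assert (Hi : ccont (fun w => RtoC (Im w) * / RtoC (Re w))%C w).
      { apply ccont_mult; [apply (ccont_Im (fun w => w)), ccont_id|].
        apply ccont_inv; [apply (ccont_Re (fun w => w)), ccont_id|].
        intros E. apply RtoC_inj in E. lra. }
      apply (ccont_ext_loc _ (fun z => RtoC (Im z / Re z)) w (Re w) H) in Hi; [exact Hi|].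
      intros z Hz. unfold Rdiv. rewrite RtoC_mult, RtoC_inv; [easy|].
      generalize (Re_le_Cmod (z - w)). rewrite Re_minus. intros Hle E. rewrite E in Hle.
      rewrite Rabs_left in Hle; lra.
Qed.

Lemma Re_pos_open (w z : C) : Cmod (z - w) < Re w -> 0 < Re z.
Proof.
  intros Hz. generalize (Re_le_Cmod (z - w)). rewrite Re_minus. intros Hle.
  apply Rabs_le_between in Hle. lra.
Qed.

Lemma cderiv_Clog (w : C) : 0 < Re w -> cderiv Clog w (/ w).
Proof.
  intros H. apply (cderiv_inverse_function cexp Clog w w (Re w)); auto.
  - intros z Hz. apply cexp_Clog. now apply (Re_pos_open w).
  - now apply ccont_Clog.
  - apply cderiv_eq with (cexp (Clog w)); [apply cderiv_cexp|now apply cexp_Clog].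
  - now apply Re_pos_neq_0.
Qed.

(** * A Phragmen-Lindelof principle for the upper half-plane *)

Lemma mean_value_ext (v v' : C -> R) (a : C) (r : R) : 0 <= r ->
  (forall z, Cmod (z - a) <= r -> v z = v' z) ->
  mean_value_on_circle v a r -> mean_value_on_circle v' a r.
Proof.
  intros Hr H [Hex Hm]. split.
  - apply ex_RInt_ext with (2 := Hex). intros t _. apply H. rewrite Cmod_circ; lra.
  - rewrite <- (H a).
    + rewrite <- Hm. apply RInt_ext. intros t _. symmetry. apply H. rewrite Cmod_circ; lra.
    + now rewrite Cmod_diag.
Qed.

(** The sum of the angles at [-r] and [r] in the triangle with vertices [-r], [r],
    [z]: in the upper half-disc a positive harmonic function with value [pi/2] on the
    arc, by the theorem of Thales, and [0] on the diameter.  It is the real part of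
    this holomorphic function. *)
Definition thales_angle (r : R) (z : C) : C :=
  (- Ci * (Clog (RtoC r + z) - Clog (RtoC r - z)))%C.

Lemma Re_thales_angle (r : R) (z : C) :
  Re (thales_angle r z) = atan (Im z / (r + Re z)) + atan (Im z / (r - Re z)).
Proof.
  unfold thales_angle. rewrite <- Im_as_Re, Im_minus, !Im_Clog.
  rewrite im_plus, re_plus, Im_minus, Re_minus, im_RtoC, re_RtoC.
  rewrite Rplus_0_l. replace ((0 - Im z) / (r - Re z)) with (- (Im z / (r - Re z)))
    by (unfold Rdiv; ring).
  rewrite atan_opp. ring.
Qed.

Lemma atan_nonneg (x : R) : 0 <= x -> 0 <= atan x.
Proof.
  intros [Hx| <-]; [|rewrite atan_0; lra]. rewrite <- atan_0. now apply Rlt_le, atan_increasing.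
Qed.

Lemma atan_le_id (x : R) : 0 <= x -> atan x <= x.
Proof.
  intros Hx.
  assert (E : x - atan x = RInt (fun t => 1 - / (1 + t ^ 2)) 0 x).
  { symmetry. apply is_RInt_unique.
    replace (x - atan x) with ((x - atan x) - (0 - atan 0)) by (rewrite atan_0; ring).
    apply (is_RInt_derive (fun t => t - atan t)).
    - intros t _. auto_derive; [easy|]. field. nra.
    - intros t _. apply ex_derive_continuous_R. auto_derive. nra. }
  assert (0 <= RInt (fun t => 1 - / (1 + t ^ 2)) 0 x); [|lra].
  apply RInt_ge_0; [easy| |].
  - apply ex_RInt_cont; [easy|]. intros t _.
    apply ex_derive_continuous_R. auto_derive. nra.
  - intros t _. assert (/ (1 + t ^ 2) <= / 1); [|lra].
    apply Rinv_le_contravar; nra.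
Qed.

Lemma thales_angle_nonneg (r : R) (z : C) :
  0 <= Im z -> Cmod z <= r -> 0 <= Re (thales_angle r z).
Proof.
  intros Hy Hz. rewrite Re_thales_angle.
  assert (Hx := Re_le_Cmod z). apply Rabs_le_between in Hx.
  assert (K : forall d, 0 <= d -> 0 <= Im z / d).
  { intros d [Hd| <-]; [now apply Rdiv_le_0_compat|]. unfold Rdiv. rewrite Rinv_0. lra. }
  apply Rplus_le_le_0_compat; apply atan_nonneg, K; lra.
Qed.

Lemma Re_lt_of_arc (r : R) (z : C) : 0 < Im z -> Cmod z <= r -> - r < Re z < r.
Proof.
  intros Hy Hz. assert (E := Cmod_sqr z). assert (P := Cmod_ge_0 z).
  assert (Re z * Re z < r * r) by nra. nra.
Qed.

Lemma thales_angle_arc (r : R) (z : C) :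
  0 < Im z -> Cmod z = r -> Re (thales_angle r z) = PI / 2.
Proof.
  intros Hy Hz. rewrite Re_thales_angle.
  destruct (Re_lt_of_arc r z Hy ltac:(lra)) as [X1 X2].
  assert (E := Cmod_sqr z). rewrite Hz in E.
  assert (P : 0 < Im z / (r + Re z)) by (apply Rdiv_lt_0_compat; lra).
  replace (Im z / (r - Re z)) with (/ (Im z / (r + Re z))).
  - rewrite atan_inv by easy. ring.
  - apply (Rmult_eq_reg_r (Im z * (r - Re z))); [|apply Rgt_not_eq; nra].
    transitivity ((r + Re z) * (r - Re z)); [field; lra|].
    transitivity (Im z * Im z); [lra|]. field. lra.
Qed.

Lemma thales_angle_far (r : R) (z : C) :
  0 < Im z -> 2 * Cmod z < r -> Re (thales_angle r z) <= 4 * Im z / r.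
Proof.
  intros Hy Hz. rewrite Re_thales_angle. assert (P := Cmod_ge_0 z).
  assert (Hx := Re_le_Cmod z). apply Rabs_le_between in Hx.
  assert (K : forall d, r / 2 <= d -> atan (Im z / d) <= 2 * Im z / r).
  { intros d Hd. eapply Rle_trans; [apply atan_le_id, Rdiv_le_0_compat; lra|].
    replace (2 * Im z / r) with (Im z * / (r / 2)) by (field; lra).
    apply Rmult_le_compat_l; [lra|]. apply Rinv_le_contravar; lra. }
  generalize (K (r + Re z) ltac:(lra)) (K (r - Re z) ltac:(lra)). lra.
Qed.

Lemma cderiv_thales_angle (r : R) (z : C) :
  - r < Re z < r -> exists l, cderiv (thales_angle r) z l.
Proof.
  intros Hz. eexists. apply cderiv_scal, cderiv_minus.
  - apply (cderiv_comp Clog (fun z => RtoC r + z)%C).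
    + apply cderiv_plus; [apply cderiv_const|apply cderiv_id].
    + apply cderiv_Clog. rewrite re_plus, re_RtoC. lra.
  - apply (cderiv_comp Clog (fun z => RtoC r - z)%C).
    + apply cderiv_minus; [apply cderiv_const|apply cderiv_id].
    + apply cderiv_Clog. rewrite Re_minus, re_RtoC. lra.
Qed.

(** Growth [o(|z|)] is the critical rate for the half-plane, so [Re f] is compared on
    the half-disc of radius [r] with the harmonic function equal to [eps r] on the
    arc and [0] on the diameter, whose value at a fixed point stays [O(eps)]. *)
Lemma half_plane_phragmen_lindelof (f : C -> C) :
  (forall z, upper_half_plane z -> exists l, cderiv f z l) ->
  (forall t eps, 0 < eps -> exists d, 0 < d /\ forall z, upper_half_plane z ->
     Cmod (z - RtoC t) < d -> Re (f z) < eps) ->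
  (forall eps, 0 < eps -> exists M, forall z, upper_half_plane z ->
     M < Cmod z -> Re (f z) <= eps * Cmod z) ->
  forall z, upper_half_plane z -> Re (f z) <= 0.
Proof.
  unfold upper_half_plane. intros Hf Hbd Hinf z0 Hz0.
  assert (PIpos := PI_RGT_0).
  apply le_epsilon. intros e0 He0. rewrite Rplus_0_l.
  set (e := e0 * PI / (8 * Im z0)).
  assert (He : 0 < e) by (apply Rdiv_lt_0_compat; nra).
  destruct (Hinf e He) as [M HM].
  set (r := Rmax (M + 1) (2 * Cmod z0 + 1)).
  assert (Hr1 : M + 1 <= r) by apply Rmax_l.
  assert (Hr2 : 2 * Cmod z0 + 1 <= r) by apply Rmax_r.
  assert (P0 := Cmod_ge_0 z0).
  set (c := 2 * e * r / PI).
  assert (Hc : 0 < c) by (apply Rdiv_lt_0_compat; nra).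
  set (F := fun z => (f z - RtoC c * thales_angle r z)%C).
  assert (ReF : forall z, Re (F z) = Re (f z) - c * Re (thales_angle r z)).
  { intros z. unfold F. now rewrite Re_minus, re_scal_l. }
  assert (DF : forall z, 0 < Im z -> Cmod z <= r -> exists l, cderiv F z l).
  { intros z Hy Hz. destruct (Hf z Hy) as [l1 H1].
    destruct (cderiv_thales_angle r z (Re_lt_of_arc r z Hy Hz)) as [l2 H2].
    eexists. apply cderiv_minus; [exact H1|]. apply cderiv_scal. exact H2. }
  set (v := fun z : C => if Rlt_dec 0 (Im z) then Re (F z) else 0).
  assert (vpos : forall z, 0 < Im z -> v z = Re (F z))
    by (intros z Hz; unfold v; destruct (Rlt_dec 0 (Im z)); [easy|lra]).
  assert (Hmax : v z0 <= 0).
  { apply (maximum_principle (fun z => 0 <= Im z /\ Cmod z <= r)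
      (fun z => Im z = 0 \/ Cmod z = r) v 0 r); [| easy| | | |].
    - intros p Hp. destruct (Rlt_dec (Im p) 0) as [Hy|Hy].
      + exists (- Im p). split; [lra|]. intros q Hq [Q _].
        assert (H := Im_diff_bounds q p). lra.
      + exists (Cmod p - r). split; [lra|]. intros q Hq [_ Q].
        generalize (Cmod_le_sum p q). rewrite (Cmod_sym p). lra.
    - intros a [Ha1 Ha2] eps Heps. destruct (Rlt_dec 0 (Im a)) as [Hy|Hy].
      + destruct (DF a Hy Ha2) as [l Hl]. apply cderiv_cont in Hl.
        destruct (ccont_usc_Re (fun _ => True) F a Hl eps Heps) as [d [Hd H]].
        exists (Rmin d (Im a)). split; [now apply Rmin_glb_lt|]. intros z _ Hz.
        assert (Hz1 := Rlt_le_trans _ _ _ Hz (Rmin_l _ _)).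
        assert (Hz2 := Rlt_le_trans _ _ _ Hz (Rmin_r _ _)).
        assert (HI := Im_diff_bounds z a).
        rewrite !vpos by lra. now apply H.
      + assert (Ea : a = RtoC (Re a)).
        { apply C_eq; [now rewrite re_RtoC|]. rewrite im_RtoC. lra. }
        destruct (Hbd (Re a) eps Heps) as [d [Hd H]]. exists d. split; [easy|].
        intros z [Hz1 Hz2] Hz. rewrite <- Ea in H.
        unfold v. destruct (Rlt_dec 0 (Im a)); [lra|]. destruct (Rlt_dec 0 (Im z)) as [Hzy|_]; [|lra].
        specialize (H z Hzy Hz). rewrite ReF.
        assert (T := thales_angle_nonneg r z Hz1 Hz2). nra.
    - intros z [Hz1 Hz2] [Hy|Hz].
      + unfold v. destruct (Rlt_dec 0 (Im z)); lra.
      + unfold v. destruct (Rlt_dec 0 (Im z)) as [Hy|_]; [|lra].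
        rewrite ReF, thales_angle_arc by easy.
        specialize (HM z Hy ltac:(lra)). rewrite Hz in HM.
        replace (c * (PI / 2)) with (e * r) by (unfold c; field; lra). lra.
    - intros a [Ha1 Ha2] HnB.
      assert (Hy : 0 < Im a) by lra. assert (Hlt : Cmod a < r) by lra.
      set (s := Rmin (Im a) (r - Cmod a) / 2).
      assert (S1 : s <= Im a / 2) by (generalize (Rmin_l (Im a) (r - Cmod a)); unfold s; lra).
      assert (S2 : s <= (r - Cmod a) / 2) by (generalize (Rmin_r (Im a) (r - Cmod a)); unfold s; lra).
      assert (S0 : 0 < s) by (apply Rdiv_lt_0_compat; [apply Rmin_glb_lt; lra|lra]).
      assert (Hin : forall z, Cmod (z - a) <= s -> 0 < Im z /\ Cmod z <= r).
      { intros z Hz. assert (HI := Im_diff_bounds z a). generalize (Cmod_le_sum z a). lra. }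
      exists s. split; [easy|]. split.
      + apply (mean_value_ext (fun z => Re (F z))); [lra| |].
        * intros z Hz. symmetry. now apply vpos, Hin.
        * apply mean_value_Re; [easy| |].
          -- destruct (DF a Hy ltac:(lra)) as [l Hl]. now apply cderiv_cont in Hl.
          -- intros z [_ Hz]. apply DF; now apply Hin.
      + intros z Hz. destruct (Hin z Hz). split; [lra|easy].
    - split; lra. }
  rewrite vpos, ReF in Hmax by easy.
  assert (T := thales_angle_far r z0 Hz0 ltac:(lra)).
  assert (c * Re (thales_angle r z0) <= c * (4 * Im z0 / r)) by (apply Rmult_le_compat_l; lra).
  replace (c * (4 * Im z0 / r)) with e0 in H by (unfold c, e; field; lra). lra.
Qed.

(** * Primitives of entire functions *)

(* integrands come with an equation in a normed module, which [ring] does not see as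
   one between real numbers *)
Ltac as_real_equation := match goal with |- @eq _ ?a ?b => change (@eq R a b) end.

Lemma ex_RInt_everywhere (f : R -> R) (a b : R) :
  (forall t, continuous f t) -> ex_RInt f a b.
Proof. intros H. apply (ex_RInt_continuous (V := R_CompleteNormedModule)). auto. Qed.

Lemma RInt_swap_sign (f : R -> R) (a b : R) :
  (forall t, continuous f t) -> RInt f b a = - RInt f a b.
Proof.
  intros H. symmetry. apply (opp_RInt_swap (V := R_CompleteNormedModule)).
  now apply ex_RInt_everywhere.
Qed.

Lemma RInt_Chasles_R (f : R -> R) (a b c : R) :
  (forall t, continuous f t) -> RInt f a c = RInt f a b + RInt f b c.
Proof.
  intros H. symmetry.
  apply (RInt_Chasles (V := R_CompleteNormedModule)); now apply ex_RInt_everywhere.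
Qed.

Lemma RInt_minus_R (f g : R -> R) (a b : R) :
  (forall t, continuous f t) -> (forall t, continuous g t) ->
  RInt (fun t => f t - g t) a b = RInt f a b - RInt g a b.
Proof.
  intros Hf Hg. apply (RInt_minus (V := R_CompleteNormedModule)); now apply ex_RInt_everywhere.
Qed.

Lemma RInt_scal_R (k : R) (f : R -> R) (a b : R) :
  (forall t, continuous f t) -> RInt (fun t => k * f t) a b = k * RInt f a b.
Proof.
  intros Hf. apply (RInt_scal f a b k). now apply ex_RInt_everywhere.
Qed.

Lemma is_derive_RInt_upper (f : R -> R) (a x : R) :
  (forall t, continuous f t) -> is_derive (fun x => RInt f a x) x (f x).
Proof.
  intros H. apply (is_derive_RInt f _ a); [|apply H].
  exists (mkposreal 1 Rlt_0_1). intros y _.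
  apply (RInt_correct (V := R_CompleteNormedModule)). now apply ex_RInt_everywhere.
Qed.

Lemma RInt_near_const_signed (f : R -> R) (a b K M : R) :
  (forall t, continuous f t) -> (forall t, Rabs (t - a) <= Rabs (b - a) -> Rabs (f t - K) <= M) ->
  Rabs (RInt f a b - (b - a) * K) <= Rabs (b - a) * M.
Proof.
  intros Hf H. destruct (Rle_dec a b) as [Hab|Hab].
  - rewrite (Rabs_right (b - a)) in * by lra. apply RInt_near_const; [easy| |].
    + now apply ex_RInt_everywhere.
    + intros t Ht. apply H. rewrite Rabs_right; lra.
  - rewrite (Rabs_left (b - a)) in * by lra. rewrite RInt_swap_sign by easy.
    replace (- RInt f b a - (b - a) * K) with (- (RInt f b a - (a - b) * K)) by ring.
    rewrite Rabs_Ropp. replace (- (b - a)) with (a - b) in * by ring.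
    apply RInt_near_const; [lra| |].
    + now apply ex_RInt_everywhere.
    + intros t Ht. apply H. rewrite Rabs_left1; lra.
Qed.

Definition entire (f : C -> C) : Prop := forall z, exists l, cderiv f z l.

Lemma entire_cont (f : C -> C) (z : C) : entire f -> ccont f z.
Proof. intros H. destruct (H z) as [l Hl]. now apply cderiv_cont in Hl. Qed.

Lemma entire_lines (f : C -> C) : entire f ->
  (forall c t, continuous (fun x => Re (f (x, c))) t) /\
  (forall c t, continuous (fun x => Im (f (x, c))) t) /\
  (forall c t, continuous (fun y => Re (f (c, y))) t) /\
  (forall c t, continuous (fun y => Im (f (c, y))) t).
Proof.
  intros H. repeat split; intros c t.
  - now apply continuous_Re_h, entire_cont.
  - now apply continuous_Im_h, entire_cont.
  - now apply continuous_Re_v, entire_cont.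
  - now apply continuous_Im_v, entire_cont.
Qed.

Lemma continuous_minus_R (f g : R -> R) :
  (forall t, continuous f t) -> (forall t, continuous g t) ->
  forall t, continuous (fun t => f t - g t) t.
Proof. intros Hf Hg t. apply (continuous_minus (V := R_NormedModule)); auto. Qed.

(** Reversing an interval changes the sign of the circulation. *)
Lemma goursat_entire (f : C -> C) (a b c d : R) :
  entire f -> rect_circulation f a b c d = 0.
Proof.
  intros H. destruct (entire_lines f H) as (Hrh & Hih & Hrv & Hiv).
  assert (Hab : forall a b c d, rect_circulation f b a c d = - rect_circulation f a b c d).
  { intros a' b' c' d'. unfold rect_circulation.
    rewrite (RInt_swap_sign (fun x => Re (f (x, c')) - Re (f (x, d'))) a' b')
      by (apply continuous_minus_R; auto).
    rewrite !RInt_minus_R by auto. ring. }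
  assert (Hcd : forall a b c d, rect_circulation f a b d c = - rect_circulation f a b c d).
  { intros a' b' c' d'. unfold rect_circulation.
    rewrite (RInt_swap_sign (fun y => Im (f (b', y)) - Im (f (a', y))) c' d')
      by (apply continuous_minus_R; auto).
    rewrite !RInt_minus_R by auto. ring. }
  assert (H0 : forall a b c d, a <= b -> c <= d -> rect_circulation f a b c d = 0)
    by (intros; apply goursat; auto).
  destruct (Rle_dec a b), (Rle_dec c d).
  - apply H0; lra.
  - rewrite Hcd, H0; lra.
  - rewrite Hab, H0; lra.
  - rewrite Hab, Hcd, H0; lra.
Qed.

(** The integral of [Re (f dz)] from the origin to [z] along the real axis and then
    vertically. *)
Definition potential (f : C -> C) (z : C) : R :=
  RInt (fun s => Re (f (s, 0))) 0 (Re z) - RInt (fun t => Im (f (Re z, t))) 0 (Im z).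

Lemma potential_increment (f : C -> C) (z : C) (eps : R) : entire f -> 0 < eps ->
  exists d, 0 < d /\ forall w, Cmod (w - z) < d ->
    Rabs (potential f w - potential f z - Re (f z * (w - z))) <= eps * Cmod (w - z).
Proof.
  intros H He. destruct (entire_lines f H) as (Hrh & Hih & Hrv & Hiv).
  destruct (entire_cont f z H (eps / 2)) as [d [Hd Hf]]; [lra|].
  exists (d / 2). split; [lra|]. intros w Hw.
  destruct z as [x y], w as [x' y'].
  assert (Mx := Re_le_Cmod ((x', y') - (x, y))). assert (My := Im_le_Cmod ((x', y') - (x, y))).
  rewrite Re_minus in Mx. rewrite Im_minus in My.
  set (m := Cmod ((x', y') - (x, y))) in *. unfold Re, Im in Mx, My. simpl in Mx, My.
  assert (G := goursat_entire f x x' 0 y H). unfold rect_circulation in G.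
  rewrite !RInt_minus_R in G by auto.
  change (potential f (x', y')) with
    (RInt (fun s => Re (f (s, 0))) 0 x' - RInt (fun t => Im (f (x', t))) 0 y').
  change (potential f (x, y)) with
    (RInt (fun s => Re (f (s, 0))) 0 x - RInt (fun t => Im (f (x, t))) 0 y).
  rewrite (RInt_Chasles_R (fun s => Re (f (s, 0))) 0 x x') by auto.
  rewrite (RInt_Chasles_R (fun t => Im (f (x', t))) 0 y y') by auto.
  assert (BH : Rabs (RInt (fun s => Re (f (s, y))) x x' - (x' - x) * Re (f (x, y)))
     <= Rabs (x' - x) * (eps / 2)).
  { apply RInt_near_const_signed; [auto|]. intros t Ht. rewrite <- Re_minus.
    eapply Rle_trans; [apply Re_le_Cmod|]. apply Rlt_le, Hf.
    eapply Rle_lt_trans; [apply Cmod_le_Re_Im|]. unfold Re, Im; simpl.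
    replace (y + - y) with 0 by ring. rewrite Rabs_R0. unfold Rminus in *. lra. }
  assert (BV : Rabs (RInt (fun t => Im (f (x', t))) y y' - (y' - y) * Im (f (x, y)))
     <= Rabs (y' - y) * (eps / 2)).
  { apply RInt_near_const_signed; [auto|]. intros t Ht. rewrite <- Im_minus.
    eapply Rle_trans; [apply Im_le_Cmod|]. apply Rlt_le, Hf.
    eapply Rle_lt_trans; [apply Cmod_le_Re_Im|]. unfold Re, Im; simpl. unfold Rminus in *. lra. }
  replace (Re (f (x, y) * ((x', y') - (x, y)))) with
    ((x' - x) * Re (f (x, y)) - (y' - y) * Im (f (x, y)))
    by (rewrite re_mult, Re_minus, Im_minus; change (Re (x', y')) with x';
        change (Re (x, y)) with x; change (Im (x', y')) with y'; change (Im (x, y)) with y; ring).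
  match goal with |- Rabs ?A <= _ => replace A with
    ((RInt (fun s => Re (f (s, y))) x x' - (x' - x) * Re (f (x, y))) -
     (RInt (fun t => Im (f (x', t))) y y' - (y' - y) * Im (f (x, y)))) end.
  2:{ simpl in G. lra. }
  eapply Rle_trans; [apply Rabs_triang|]. rewrite Rabs_Ropp. nra.
Qed.

Lemma entire_scal (k : C) (f : C -> C) : entire f -> entire (fun z => k * f z)%C.
Proof. intros H z. destruct (H z) as [l Hl]. eexists. apply cderiv_scal. exact Hl. Qed.

Definition Cprimitive (f : C -> C) (z : C) : C :=
  (potential f z, potential (fun z => - Ci * f z)%C z).

Lemma cderiv_Cprimitive (f : C -> C) (z : C) : entire f -> cderiv (Cprimitive f) z (f z).
Proof.
  intros H. apply cderiv_intro. intros e He.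
  destruct (potential_increment f z (e / 2) H) as [d1 [Hd1 H1]]; [lra|].
  destruct (potential_increment (fun z => - Ci * f z)%C z (e / 2) (entire_scal _ f H))
    as [d2 [Hd2 H2]]; [lra|].
  exists (Rmin d1 d2). split; [now apply Rmin_glb_lt|]. intros w Hw.
  specialize (H1 w (Rlt_le_trans _ _ _ Hw (Rmin_l _ _))).
  specialize (H2 w (Rlt_le_trans _ _ _ Hw (Rmin_r _ _))).
  eapply Rle_trans; [apply Cmod_le_Re_Im|].
  rewrite !Re_minus, !Im_minus.
  replace (Im (f z * (w - z))) with (Re (- Ci * f z * (w - z)))
    by (rewrite <- Cmult_assoc, <- Im_as_Re; easy).
  change (Re (Cprimitive f w)) with (potential f w).
  change (Re (Cprimitive f z)) with (potential f z).
  change (Im (Cprimitive f w)) with (potential (fun z => - Ci * f z)%C w).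
  change (Im (Cprimitive f z)) with (potential (fun z => - Ci * f z)%C z). lra.
Qed.

(** * The Gaussian integral *)

Definition gauss_int (x : R) : R := RInt (fun t => exp (- (t * t))) 0 x.

Lemma continuous_gauss (t : R) : continuous (fun t => exp (- (t * t))) t.
Proof. apply ex_derive_continuous_R. auto_derive. easy. Qed.

Lemma is_derive_gauss_int (x : R) : is_derive gauss_int x (exp (- (x * x))).
Proof. apply (is_derive_RInt_upper (fun t => exp (- (t * t)))). apply continuous_gauss. Qed.

Lemma gauss_int_0 : gauss_int 0 = 0.
Proof. apply (RInt_point (V := R_CompleteNormedModule)). Qed.

(** Up to a constant, minus the square of the Gaussian integral, in a form whose derivative in
    [x] is computed under the integral sign. *)
Definition gauss_aux (x : R) : R :=
  RInt (fun t => exp (- (x * x * (1 + t * t))) / (1 + t * t)) 0 1.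

Lemma one_plus_sqr_pos (t : R) : 0 < 1 + t * t.
Proof. nra. Qed.

Lemma continuous_gauss_aux (x t : R) :
  continuous (fun t => exp (- (x * x * (1 + t * t))) / (1 + t * t)) t.
Proof.
  apply ex_derive_continuous_R. auto_derive.
  generalize (one_plus_sqr_pos t). lra.
Qed.

Lemma is_derive_gauss_aux (x : R) :
  is_derive gauss_aux x (- 2 * exp (- (x * x)) * gauss_int x).
Proof.
  assert (D : forall u v, is_derive (fun z => exp (- (z * z * (1 + v * v))) / (1 + v * v)) u
    (- 2 * u * exp (- (u * u * (1 + v * v))))).
  { intros u v. assert (P := one_plus_sqr_pos v). auto_derive; [easy|]. field. lra. }
  assert (H := is_derive_RInt_param
    (fun x t => exp (- (x * x * (1 + t * t))) / (1 + t * t)) 0 1 x).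
  assert (E : RInt (fun t => Derive (fun u => exp (- (u * u * (1 + t * t))) / (1 + t * t)) x) 0 1
    = - 2 * exp (- (x * x)) * gauss_int x).
  { transitivity (RInt (fun t => - 2 * exp (- (x * x)) * (x * exp (- ((x * t + 0) * (x * t + 0))))) 0 1).
    - apply RInt_ext. intros t _. etransitivity; [apply is_derive_unique, D|].
      replace (- (x * x * (1 + t * t))) with (- (x * x) + - ((x * t + 0) * (x * t + 0))) by ring.
      rewrite exp_plus. as_real_equation. ring.
    - rewrite (RInt_scal_R _ (fun t => x * exp (- ((x * t + 0) * (x * t + 0))))).
      2:{ intros t. apply ex_derive_continuous_R. auto_derive. easy. }
      f_equal. etransitivity.
      + apply (RInt_comp_lin (fun t => exp (- (t * t))) x 0 0 1).
        apply ex_RInt_everywhere, continuous_gauss.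
      + unfold gauss_int. rewrite Rmult_0_r, Rmult_1_r, !Rplus_0_r. reflexivity. }
  unfold gauss_aux. rewrite <- E. apply H.
  - exists (mkposreal 1 Rlt_0_1). intros u _ v _. eexists. apply D.
  - intros t _. apply continuity_2d_pt_ext with
      (fun u v => (- 2 * u) * exp (- (u * u * (1 + v * v)))).
    { intros u v. symmetry. apply is_derive_unique, D. }
    apply continuity_2d_pt_mult.
    + apply continuity_2d_pt_mult; [apply continuity_2d_pt_const|apply continuity_2d_pt_id1].
    + apply (continuity_1d_2d_pt_comp exp (fun u v => - (u * u * (1 + v * v)))).
      * apply derivable_continuous_pt, derivable_pt_exp.
      * apply continuity_2d_pt_opp, continuity_2d_pt_mult.
        -- apply continuity_2d_pt_mult; apply continuity_2d_pt_id1.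
        -- apply continuity_2d_pt_plus; [apply continuity_2d_pt_const|].
           apply continuity_2d_pt_mult; apply continuity_2d_pt_id2.
  - exists (mkposreal 1 Rlt_0_1). intros u _.
    apply ex_RInt_everywhere. apply continuous_gauss_aux.
Qed.

(** Both summands have opposite derivatives, so their sum keeps its value at [0]. *)
Lemma gauss_identity (x : R) : gauss_int x * gauss_int x + gauss_aux x = PI / 4.
Proof.
  assert (E0 : gauss_aux 0 = PI / 4).
  { unfold gauss_aux. rewrite <- atan_1. apply is_RInt_unique.
    replace (atan 1) with (atan 1 - atan 0) by (rewrite atan_0; ring).
    apply (is_RInt_derive (V := R_CompleteNormedModule)).
    - intros t _. assert (P := one_plus_sqr_pos t). auto_derive; [easy|].
      replace (- (0 * 0 * (1 + t * t))) with 0 by ring. rewrite exp_0. field. lra.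
    - intros t _. apply (continuous_gauss_aux 0 t). }
  set (F := fun x => gauss_int x * gauss_int x + gauss_aux x).
  assert (D : forall t, is_derive F t 0).
  { intros t. apply is_derive_Reals.
    replace 0 with ((exp (- (t * t)) * gauss_int t + gauss_int t * exp (- (t * t))) +
      - 2 * exp (- (t * t)) * gauss_int t) by ring.
    apply derivable_pt_lim_plus.
    - apply (derivable_pt_lim_mult gauss_int gauss_int);
      apply is_derive_Reals, is_derive_gauss_int.
    - apply is_derive_Reals, is_derive_gauss_aux. }
  assert (E : F x = F 0).
  { destruct (Rtotal_order x 0) as [Hx|[->|Hx]]; [|easy|].
    - apply (eq_is_derive F x 0); [|easy]. intros t _. apply D.
    - symmetry. apply (eq_is_derive F 0 x); [|easy]. intros t _. apply D. }
  change (F x = PI / 4). rewrite E. unfold F. rewrite gauss_int_0, E0. ring.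
Qed.

Lemma gauss_aux_bounds (x : R) : 0 < gauss_aux x <= exp (- (x * x)).
Proof.
  split.
  - apply RInt_gt_0; [lra| |].
    + intros t _. apply Rdiv_lt_0_compat; [apply exp_pos|apply one_plus_sqr_pos].
    + intros t _. apply continuous_gauss_aux.
  - replace (exp (- (x * x))) with ((1 - 0) * exp (- (x * x))) by ring.
    eapply Rle_trans; [apply Rle_abs|]. apply abs_RInt_le_const; [lra| |].
    + apply ex_RInt_everywhere, continuous_gauss_aux.
    + intros t _. assert (P := one_plus_sqr_pos t).
      assert (Q := exp_pos (- (x * x * (1 + t * t)))).
      rewrite Rabs_right by (apply Rle_ge, Rlt_le, Rdiv_lt_0_compat; lra).
      apply Rle_trans with (exp (- (x * x * (1 + t * t)))).
      * rewrite <- (Rmult_1_r (exp (- (x * x * (1 + t * t))))) at 2. unfold Rdiv.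
        apply Rmult_le_compat_l; [lra|]. rewrite <- Rinv_1. apply Rinv_le_contravar; nra.
      * destruct (Req_dec (x * x * (t * t)) 0) as [E|E].
        -- right. f_equal. lra.
        -- left. apply exp_increasing. nra.
Qed.

Lemma gauss_int_nonneg (x : R) : 0 <= x -> 0 <= gauss_int x.
Proof.
  intros Hx. apply RInt_ge_0; [easy|apply ex_RInt_everywhere, continuous_gauss|].
  intros; apply Rlt_le, exp_pos.
Qed.

Lemma sqrt_PI_sqr : sqrt PI * sqrt PI = PI.
Proof. apply sqrt_sqrt. generalize PI_RGT_0; lra. Qed.

Lemma sqrt_PI_bounds : 1 < sqrt PI <= 2.
Proof.
  assert (H := sqrt_PI_sqr). assert (P := sqrt_pos PI).
  assert (H1 := PI_4). assert (H2 := PI2_3_2). nra.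
Qed.

Lemma gauss_int_lt (x : R) : 0 <= x -> gauss_int x < sqrt PI / 2.
Proof.
  intros Hx. assert (H := gauss_identity x). assert (H1 := gauss_aux_bounds x).
  assert (H2 := gauss_int_nonneg x Hx). assert (H3 := sqrt_PI_sqr). assert (H4 := sqrt_PI_bounds).
  nra.
Qed.

Lemma gauss_int_limit (x : R) : 0 <= x -> sqrt PI / 2 - gauss_int x <= 2 * exp (- (x * x)).
Proof.
  intros Hx. assert (H := gauss_identity x). assert (H1 := gauss_aux_bounds x).
  assert (H2 := gauss_int_nonneg x Hx). assert (H3 := sqrt_PI_sqr). assert (H4 := sqrt_PI_bounds).
  assert (H5 := gauss_int_lt x Hx). nra.
Qed.

(** * The complementary error function in the right half-plane *)

Definition gaussian (w : C) : C := cexp (- (w * w)).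

Lemma cderiv_gaussian (w : C) : cderiv gaussian w (- (2) * w * gaussian w).
Proof.
  apply cderiv_eq with (cexp (- (w * w)) * - (1 * w + w * 1))%C; [|unfold gaussian; ring].
  apply (cderiv_comp cexp (fun w => - (w * w))%C); [|apply cderiv_cexp].
  apply cderiv_opp, (cderiv_mult (fun w => w) (fun w => w)); apply cderiv_id.
Qed.

Lemma entire_gaussian : entire gaussian.
Proof. intros w. eexists. apply cderiv_gaussian. Qed.

Lemma Cmod_gaussian (w : C) : Cmod (gaussian w) = exp (- (Re w * Re w - Im w * Im w)).
Proof. unfold gaussian. rewrite Cmod_cexp, re_opp, re_mult. reflexivity. Qed.

Definition cerfc (w : C) : C := (1 - RtoC (2 / sqrt PI) * Cprimitive gaussian w)%C.

Lemma cderiv_cerfc (w : C) : cderiv cerfc w (- RtoC (2 / sqrt PI) * gaussian w).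
Proof.
  apply cderiv_eq with (0 - RtoC (2 / sqrt PI) * gaussian w)%C; [|ring].
  apply cderiv_minus; [apply cderiv_const|]. apply cderiv_scal.
  apply cderiv_Cprimitive, entire_gaussian.
Qed.

Lemma gaussian_real (x : R) : gaussian (x, 0) = RtoC (exp (- (x * x))).
Proof.
  unfold gaussian. replace (- ((x, 0) * (x, 0)))%C with (RtoC (- (x * x)))
    by (unfold Copp, Cmult, RtoC; simpl; f_equal; ring).
  unfold cexp. rewrite re_RtoC, im_RtoC, cos_0, sin_0. unfold RtoC. f_equal; ring.
Qed.

Lemma gaussian_imag (y : R) : gaussian (0, y) = RtoC (exp (y * y)).
Proof.
  unfold gaussian. replace (- ((0, y) * (0, y)))%C with (RtoC (y * y))
    by (unfold Copp, Cmult, RtoC; simpl; f_equal; ring).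
  unfold cexp. rewrite re_RtoC, im_RtoC, cos_0, sin_0. unfold RtoC. f_equal; ring.
Qed.

Lemma RInt_zero (f : R -> R) (a b : R) : (forall t, f t = 0) -> RInt f a b = 0.
Proof.
  intros H. rewrite (RInt_ext f (fun _ => 0)) by (intros; apply H).
  rewrite RInt_const. unfold scal; simpl. unfold mult; simpl. ring.
Qed.

Lemma cerfc_real (x : R) : cerfc (x, 0) = RtoC (1 - 2 / sqrt PI * gauss_int x).
Proof.
  assert (E : Cprimitive gaussian (x, 0) = RtoC (gauss_int x)).
  { unfold Cprimitive, potential, RtoC. change (Re (x, 0)) with x. change (Im (x, 0)) with 0.
    rewrite !(RInt_point).
    change (zero : R_CompleteNormedModule) with 0. f_equal.
    - rewrite Rminus_0_r. apply RInt_ext. intros t _. now rewrite gaussian_real.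
    - rewrite RInt_zero; [ring|]. intros t. rewrite <- Im_as_Re, gaussian_real. apply im_RtoC. }
  unfold cerfc. now rewrite E, <- RtoC_mult, <- RtoC_minus.
Qed.

Definition growing_gauss_int (y : R) : R := RInt (fun t => exp (t * t)) 0 y.

Lemma cerfc_imag (y : R) : cerfc (0, y) = (1, - (2 / sqrt PI * growing_gauss_int y)).
Proof.
  assert (E : Cprimitive gaussian (0, y) = (0, growing_gauss_int y)).
  { unfold Cprimitive, potential. change (Re (0, y)) with 0. change (Im (0, y)) with y.
    rewrite !(RInt_point).
    change (zero : R_CompleteNormedModule) with 0. f_equal.
    - rewrite RInt_zero; [ring|]. intros t. rewrite gaussian_imag. apply im_RtoC.
    - unfold growing_gauss_int.
      rewrite (RInt_ext _ (fun t => - 1 * exp (t * t))).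
      + rewrite (RInt_scal_R (-1) (fun t => exp (t * t))); [ring|]. intros t.
        apply ex_derive_continuous_R. auto_derive. easy.
      + intros t _. rewrite gaussian_imag. unfold Im, Ci, RtoC; simpl.
        as_real_equation. ring. }
  unfold cerfc. rewrite E. unfold Cminus, Copp, Cplus, Cmult, RtoC; simpl. f_equal; ring.
Qed.

(** The derivative bound [b'] may vary along the segment, which gives estimates uniform
    in [N] when [b] is bounded. *)
Lemma mean_value_inequality (f : C -> C) (f' : C -> C) (b b' : R -> R) (p q : C) (N : R) :
  0 <= N ->
  (forall s, 0 <= s <= N -> cderiv f (p + RtoC s * q)%C (f' (p + RtoC s * q)%C)) ->
  (forall s, 0 <= s <= N -> is_derive b s (b' s)) ->
  (forall s, 0 <= s <= N -> Cmod (f' (p + RtoC s * q)%C * q) <= b' s) ->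
  Cmod (f (p + RtoC N * q)%C - f p) <= b N - b 0.
Proof.
  intros HN Hf Hb Hle.
  (* rotate the increment onto the positive real axis *)
  set (D := (f (p + RtoC N * q) - f p)%C).
  destruct (Ceq_dec D 0) as [HD|HD].
  - rewrite HD, Cmod_0.
    destruct (MVT_gen b 0 N b') as [c [Hc E]];
      rewrite ?Rmin_left, ?Rmax_right in * by easy.
    + intros x Hx. apply Hb. lra.
    + intros x Hx. apply continuity_pt_filterlim, ex_derive_continuous_R.
      exists (b' x). now apply Hb.
    + rewrite E. apply Rmult_le_pos; [|lra].
      eapply Rle_trans; [apply Cmod_ge_0|now apply Hle].
  - assert (P : 0 < Cmod D) by now apply Cmod_gt_0.
    assert (HR : RtoC (Cmod D) <> 0) by (intros E; apply RtoC_inj in E; lra).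
    set (k := (Cconj D / RtoC (Cmod D))%C).
    assert (Hk : Cmod k = 1).
    { unfold k. rewrite Cmod_div, Cmod_conj, Cmod_R, Rabs_right by (easy || lra). field. lra. }
    assert (HkD : Re (k * D) = Cmod D).
    { unfold k. replace (Cconj D / RtoC (Cmod D) * D)%C with (D * Cconj D / RtoC (Cmod D))%C
        by (field; easy).
      rewrite <- Cmod2_conj, RtoC_pow. replace (RtoC (Cmod D) ^ 2 / RtoC (Cmod D))%C with
        (RtoC (Cmod D)) by (field; easy). apply re_RtoC. }
    set (g := fun s => b s - Re (k * f (p + RtoC s * q)%C)).
    assert (Dg : forall s, 0 <= s <= N ->
      is_derive g s (b' s - Re (k * f' (p + RtoC s * q)%C * q))).
    { intros s Hs. apply (is_derive_minus (V := R_NormedModule)); [now apply Hb|].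
      apply (cderiv_path (fun z => k * f z)%C). apply cderiv_scal. now apply Hf. }
    destruct (MVT_gen g 0 N (fun s => b' s - Re (k * f' (p + RtoC s * q)%C * q))) as [c [Hc E]];
      rewrite ?Rmin_left, ?Rmax_right in * by easy.
    + intros x Hx. apply Dg. lra.
    + intros x Hx. apply continuity_pt_filterlim, ex_derive_continuous_R.
      eexists. now apply Dg.
    + assert (0 <= g N - g 0).
      { rewrite E. apply Rmult_le_pos; [|lra].
        assert (Rabs (Re (k * f' (p + RtoC c * q)%C * q)) <= b' c).
        { eapply Rle_trans; [apply Re_le_Cmod|].
          rewrite <- Cmult_assoc, Cmod_mult, Hk, Rmult_1_l. now apply Hle. }
        generalize (Rle_abs (Re (k * f' (p + RtoC c * q)%C * q))). lra. }
      unfold g in H. replace (p + RtoC 0 * q)%C with p in H by ring.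
      rewrite <- HkD. unfold D.
      replace (k * (f (p + RtoC N * q) - f p))%C with
        (k * f (p + RtoC N * q) - k * f p)%C by ring.
      rewrite Re_minus. lra.
Qed.

Lemma exp_neg_sqr_small (N : R) : 1 <= N -> exp (- (N * N)) <= / N.
Proof.
  intros HN. rewrite exp_Ropp. apply Rinv_le_contravar; [lra|].
  generalize (exp_ineq1_le (N * N)). nra.
Qed.

Lemma exp_le_compat (x y : R) : x <= y -> exp x <= exp y.
Proof. intros [H| ->]; [now apply Rlt_le, exp_increasing|lra]. Qed.

Lemma Cmod_add_nonneg (w : C) (N : R) : 0 <= Re w -> 0 <= N -> Cmod w <= Cmod (w + RtoC N).
Proof.
  intros Hx HN. assert (E1 := Cmod_sqr w). assert (E2 := Cmod_sqr (w + RtoC N)).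
  rewrite re_plus, im_plus, re_RtoC, im_RtoC in E2.
  assert (P1 := Cmod_ge_0 w). assert (P2 := Cmod_ge_0 (w + RtoC N)). nra.
Qed.

(** Go to [Re w + N] on the real axis, where the Gaussian integral decides, and then
    vertically. *)
Lemma cerfc_to_right (w : C) (N : R) : 0 <= Re w -> 1 <= N ->
  Cmod (cerfc (w + RtoC N)) <= (4 + 2 * Rabs (Im w)) * exp (Im w * Im w) * / N.
Proof.
  intros Hx HN. assert (SP := sqrt_PI_bounds).
  assert (S2 : 0 < 2 / sqrt PI <= 2).
  { split; [apply Rdiv_lt_0_compat; lra|]. unfold Rdiv.
    rewrite <- (Rmult_1_r 2) at 2. apply Rmult_le_compat_l; [lra|].
    rewrite <- Rinv_1. apply Rinv_le_contravar; lra. }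
  set (x := Re w + N). set (y := Im w).
  assert (Hx1 : 1 <= x) by (unfold x; lra).
  assert (Ex : exp (- (x * x)) <= / N).
  { eapply Rle_trans; [now apply exp_neg_sqr_small|]. apply Rinv_le_contravar; unfold x; lra. }
  assert (Ey : 1 <= exp (y * y)) by (rewrite <- exp_0; apply exp_le_compat; nra).
  assert (PN : 0 < / N) by (apply Rinv_0_lt_compat; lra).
  assert (B1 : Cmod (cerfc (x, 0)) <= 4 * / N).
  { rewrite cerfc_real, Cmod_R.
    assert (H1 := gauss_int_lt x ltac:(lra)). assert (H2 := gauss_int_limit x ltac:(lra)).
    replace (1 - 2 / sqrt PI * gauss_int x) with (2 / sqrt PI * (sqrt PI / 2 - gauss_int x))
      by (field; lra).
    rewrite Rabs_right by nra.
    apply Rle_trans with (2 * (2 * exp (- (x * x)))); [|lra].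
    apply Rmult_le_compat; lra. }
  set (M := 2 * exp (y * y) * / N).
  assert (B2 : Cmod (cerfc ((x, 0) + RtoC 1 * (0, y)) - cerfc (x, 0)) <=
    M * Rabs y * 1 - M * Rabs y * 0).
  { apply (mean_value_inequality cerfc (fun w => - RtoC (2 / sqrt PI) * gaussian w)%C
      (fun s => M * Rabs y * s) (fun _ => M * Rabs y)).
    - lra.
    - intros s _. apply cderiv_cerfc.
    - intros s _. auto_derive; [easy|ring].
    - intros s Hs. rewrite !Cmod_mult, Cmod_opp, Cmod_R, Cmod_gaussian.
      rewrite (Rabs_right (2 / sqrt PI)) by lra.
      replace (Cmod (0, y)) with (Rabs y).
      2:{ apply Rsqr_inj; [apply Rabs_pos|apply Cmod_ge_0|].
          rewrite <- Rsqr_abs. unfold Rsqr. rewrite Cmod_sqr. unfold Re, Im; simpl. ring. }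
      apply Rmult_le_compat_r; [apply Rabs_pos|]. unfold M. rewrite Rmult_assoc.
      apply Rmult_le_compat; [lra|apply Rlt_le, exp_pos|lra|].
      rewrite re_plus, im_plus, re_scal_l, im_scal_l. unfold Re, Im; simpl.
      replace (- ((x + s * 0) * (x + s * 0) - (0 + s * y) * (0 + s * y)))
        with (s * s * (y * y) + - (x * x)) by ring.
      rewrite exp_plus. apply Rmult_le_compat; try (apply Rlt_le, exp_pos); [|easy].
      apply exp_le_compat. assert (0 <= y * y) by apply Rle_0_sqr.
      assert (s * s <= 1) by nra. nra. }
  replace ((x, 0) + RtoC 1 * (0, y))%C with (w + RtoC N)%C in B2.
  2:{ unfold x, y. clear. destruct w as [u v].
      unfold Re, Im, RtoC, Cplus, Cmult; simpl. f_equal; ring. }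
  generalize (Cmod_le_sum (cerfc (w + RtoC N)) (cerfc (x, 0))). intros T.
  unfold M in B2. assert (0 <= Rabs y) by apply Rabs_pos. nra.
Qed.

(** The error in the leading asymptotic term of [erfc]. *)
Definition erfc_defect (w : C) : C := (cerfc w - gaussian w / (RtoC (sqrt PI) * w))%C.

Lemma sqrt_PI_C_neq_0 : RtoC (sqrt PI) <> 0.
Proof. intros E. apply RtoC_inj in E. generalize sqrt_PI_bounds. lra. Qed.

Lemma cderiv_erfc_defect (w : C) : w <> 0 ->
  cderiv erfc_defect w (gaussian w / (RtoC (sqrt PI) * (w * w))).
Proof.
  intros Hw. assert (S := sqrt_PI_C_neq_0).
  apply cderiv_eq with (- RtoC (2 / sqrt PI) * gaussian w - (- (2) * w * gaussian w *
    / (RtoC (sqrt PI) * w) + gaussian w * (- (1) / (RtoC (sqrt PI) * w * (RtoC (sqrt PI) * w)) *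
      (RtoC (sqrt PI) * 1))))%C.
  - apply cderiv_minus; [apply cderiv_cerfc|].
    apply (cderiv_mult gaussian (fun w => / (RtoC (sqrt PI) * w))%C); [apply cderiv_gaussian|].
    apply (cderiv_comp (fun w => / w)%C (fun w => RtoC (sqrt PI) * w)%C).
    + apply cderiv_scal, cderiv_id.
    + apply (cderiv_Cinv (RtoC (sqrt PI) * w)%C). now apply Cmult_neq_0.
  - rewrite RtoC_div by (generalize sqrt_PI_bounds; lra). field. auto.
Qed.

(** The scaled function [exp (w^2) erfc w], bounded in the right half-plane. *)
Definition cerfcx (w : C) : C := (cexp (w * w) * cerfc w)%C.

Lemma cexp_gaussian (w : C) : (cexp (w * w) * gaussian w)%C = 1.
Proof. unfold gaussian. apply cexp_opp. Qed.

Lemma entire_cerfcx : entire cerfcx.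
Proof.
  intros w. eexists. apply cderiv_mult; [|apply cderiv_cerfc].
  apply (cderiv_comp cexp (fun w => w * w)%C); [|apply cderiv_cexp].
  apply (cderiv_mult (fun w => w) (fun w => w)); apply cderiv_id.
Qed.

(** The defect tends to [0] along the horizontal ray from [w] to the right, and there its
    derivative is dominated by a multiple of [exp (- s^2)]. *)
Lemma cerfcx_asymptotic (w : C) : 0 <= Re w -> w <> 0 ->
  Cmod (cerfcx w - / (RtoC (sqrt PI) * w)) <= / (2 * (Cmod w * Cmod w)).
Proof.
  intros Hx Hw. assert (S := sqrt_PI_C_neq_0). assert (SP := sqrt_PI_bounds).
  assert (Pw : 0 < Cmod w) by now apply Cmod_gt_0.
  assert (Pg : 0 < Cmod (gaussian w)) by (rewrite Cmod_gaussian; apply exp_pos).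
  set (A := Cmod (gaussian w) / (sqrt PI * (Cmod w * Cmod w))).
  assert (PA : 0 < A) by (apply Rdiv_lt_0_compat; [easy|]; repeat apply Rmult_lt_0_compat; lra).
  assert (Hray : forall s, 0 <= s -> Cmod (gaussian (w + RtoC s)) <=
    Cmod (gaussian w) * exp (- (s * s))).
  { intros s Hs. rewrite !Cmod_gaussian, re_plus, im_plus, re_RtoC, im_RtoC, <- exp_plus.
    apply exp_le_compat. nra. }
  assert (Hne : forall s, 0 <= s -> (w + RtoC s)%C <> 0).
  { intros s Hs. apply Cmod_gt_0. generalize (Cmod_add_nonneg w s Hx Hs). lra. }
  assert (H1 : forall N, 0 <= N ->
    Cmod (erfc_defect (w + RtoC N) - erfc_defect w) <= A * (sqrt PI / 2)).
  { intros N HN.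
    apply Rle_trans with (A * gauss_int N - A * gauss_int 0).
    - replace (w + RtoC N)%C with (w + RtoC N * 1)%C by ring.
      apply (mean_value_inequality erfc_defect
        (fun w => gaussian w / (RtoC (sqrt PI) * (w * w)))%C
        (fun s => A * gauss_int s) (fun s => A * exp (- (s * s)))); [easy| | |].
      + intros s Hs. apply cderiv_erfc_defect. rewrite Cmult_1_r. apply Hne. lra.
      + intros s _. apply (is_derive_scal gauss_int), is_derive_gauss_int.
      + intros s Hs. rewrite !Cmult_1_r.
        assert (Hn := Hne s ltac:(lra)). assert (Hm := Cmod_add_nonneg w s Hx ltac:(lra)).
        rewrite Cmod_div by (apply Cmult_neq_0; [easy|now apply Cmult_neq_0]).
        rewrite !Cmod_mult, Cmod_R, Rabs_right by lra.
        unfold A, Rdiv.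
        replace (Cmod (gaussian w) * / (sqrt PI * (Cmod w * Cmod w)) * exp (- (s * s))) with
          ((Cmod (gaussian w) * exp (- (s * s))) * / (sqrt PI * (Cmod w * Cmod w))) by ring.
        apply Rmult_le_compat; [apply Cmod_ge_0| |apply Hray; lra|].
        * apply Rlt_le, Rinv_0_lt_compat. repeat apply Rmult_lt_0_compat; lra.
        * apply Rinv_le_contravar; [repeat apply Rmult_lt_0_compat; lra|].
          apply Rmult_le_compat_l; [lra|]. apply Rmult_le_compat; lra.
    - rewrite gauss_int_0. assert (H := gauss_int_lt N HN). nra. }
  set (K := (4 + 2 * Rabs (Im w)) * exp (Im w * Im w) + A * (Cmod w * 2)).
  assert (H2 : forall N, 1 <= N -> Cmod (erfc_defect (w + RtoC N)) <= K * / N).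
  { intros N HN. unfold erfc_defect. eapply Rle_trans; [apply Cmod_triangle|].
    rewrite Cmod_opp. unfold K. rewrite Rmult_plus_distr_r. apply Rplus_le_compat.
    - now apply cerfc_to_right.
    - assert (Hn := Hne N ltac:(lra)). assert (Hm := Cmod_add_nonneg w N Hx ltac:(lra)).
      rewrite Cmod_div by now apply Cmult_neq_0.
      rewrite !Cmod_mult, Cmod_R, Rabs_right by lra.
      apply Rle_trans with (Cmod (gaussian w) * exp (- (N * N)) * / (sqrt PI * Cmod w)).
      + apply Rmult_le_compat; [apply Cmod_ge_0| |apply Hray; lra|].
        * apply Rlt_le, Rinv_0_lt_compat. apply Rmult_lt_0_compat; lra.
        * apply Rinv_le_contravar; [apply Rmult_lt_0_compat; lra|].
          apply Rmult_le_compat_l; lra.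
      + assert (E := exp_neg_sqr_small N HN). assert (PN : 0 < / N) by (apply Rinv_0_lt_compat; lra).
        replace (Cmod (gaussian w) * exp (- (N * N)) * / (sqrt PI * Cmod w)) with
          (A * Cmod w * exp (- (N * N))) by (unfold A; field; lra).
        replace (A * (Cmod w * 2) * / N) with (A * Cmod w * (2 * / N)) by ring.
        apply Rmult_le_compat_l; [|lra]. apply Rlt_le, Rmult_lt_0_compat; lra. }
  assert (PK : 0 < K).
  { unfold K. apply Rplus_le_lt_0_compat.
    - apply Rmult_le_pos; [generalize (Rabs_pos (Im w)); lra|apply Rlt_le, exp_pos].
    - apply Rmult_lt_0_compat; lra. }
  assert (H3 : Cmod (erfc_defect w) <= A * (sqrt PI / 2)).
  { apply le_epsilon. intros e He.
    set (N := Rmax 1 (K / e)).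
    assert (N1 : 1 <= N) by apply Rmax_l. assert (N2 : K / e <= N) by apply Rmax_r.
    assert (K * / N <= e).
    { apply (Rmult_le_reg_r N); [lra|]. rewrite Rmult_assoc, Rinv_l, Rmult_1_r by lra.
      apply (Rmult_le_compat_r e) in N2; [|lra]. unfold Rdiv in N2.
      rewrite Rmult_assoc, Rinv_l, Rmult_1_r in N2 by lra. lra. }
    specialize (H1 N ltac:(lra)). specialize (H2 N N1).
    rewrite Cmod_sym in H1.
    generalize (Cmod_le_sum (erfc_defect w) (erfc_defect (w + RtoC N))). lra. }
  assert (E : (cerfcx w - / (RtoC (sqrt PI) * w))%C = (cexp (w * w) * erfc_defect w)%C).
  { unfold erfc_defect, cerfcx. assert (G := cexp_gaussian w).
    replace (/ (RtoC (sqrt PI) * w))%C with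
      (cexp (w * w) * gaussian w / (RtoC (sqrt PI) * w))%C by (rewrite G; field; auto).
    field. auto. }
  rewrite E, Cmod_mult.
  assert (G := cexp_gaussian w). apply (f_equal Cmod) in G. rewrite Cmod_mult, Cmod_1 in G.
  apply Rle_trans with (Cmod (cexp (w * w)) * (A * (sqrt PI / 2))).
  - apply Rmult_le_compat_l; [apply Cmod_ge_0|easy].
  - apply Req_le. unfold A.
    transitivity ((Cmod (cexp (w * w)) * Cmod (gaussian w)) * / (2 * (Cmod w * Cmod w)));
      [field; lra|]. rewrite G. ring.
Qed.

(** * Positivity in the fourth quadrant *)

Definition quadrant4 (w : C) : Prop := 0 <= Re w /\ Im w <= 0.

Lemma gauss_int_pos (x : R) : 0 < x -> 0 < gauss_int x.
Proof.
  intros Hx. apply RInt_gt_0; [easy| |].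
  - intros; apply exp_pos.
  - intros; apply continuous_gauss.
Qed.

Lemma growing_gauss_int_neg (y : R) : y < 0 -> growing_gauss_int y < 0.
Proof.
  intros Hy. assert (Hc : forall t, continuous (fun t => exp (t * t)) t).
  { intros t. apply ex_derive_continuous_R. auto_derive. easy. }
  unfold growing_gauss_int. rewrite RInt_swap_sign by easy.
  assert (0 < RInt (fun t => exp (t * t)) y 0); [|lra].
  apply RInt_gt_0; auto. intros; apply exp_pos.
Qed.

Lemma growing_gauss_int_0 : growing_gauss_int 0 = 0.
Proof. apply (RInt_point (V := R_CompleteNormedModule)). Qed.

Lemma cerfcx_real (x : R) :
  cerfcx (x, 0) = RtoC (exp (x * x) * (1 - 2 / sqrt PI * gauss_int x)).
Proof.
  unfold cerfcx. rewrite cerfc_real, RtoC_mult. f_equal.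
  unfold cexp, Cmult, RtoC, Re, Im; simpl.
  replace (x * 0 + 0 * x) with 0 by ring. replace (x * x - 0 * 0) with (x * x) by ring.
  rewrite cos_0, sin_0. f_equal; ring.
Qed.

Lemma cerfcx_imag (y : R) : cerfcx (0, y) =
  (exp (- (y * y)), exp (- (y * y)) * - (2 / sqrt PI * growing_gauss_int y)).
Proof.
  unfold cerfcx. rewrite cerfc_imag.
  unfold cexp, Cmult, RtoC, Re, Im; simpl.
  replace (0 * y + y * 0) with 0 by ring. replace (0 * 0 - y * y) with (- (y * y)) by ring.
  rewrite cos_0, sin_0. f_equal; ring.
Qed.

Lemma two_over_sqrt_PI_pos : 0 < 2 / sqrt PI.
Proof. generalize sqrt_PI_bounds. intros H. apply Rdiv_lt_0_compat; lra. Qed.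

Lemma cerfc_real_pos (x : R) : 0 <= x -> 0 < 1 - 2 / sqrt PI * gauss_int x.
Proof.
  intros Hx. assert (H := gauss_int_lt x Hx). assert (S := sqrt_PI_bounds).
  replace 1 with (2 / sqrt PI * (sqrt PI / 2)) by (field; lra).
  generalize two_over_sqrt_PI_pos. nra.
Qed.

Lemma cerfcx_bound (w : C) : 0 <= Re w -> 1 <= Cmod w -> Cmod (cerfcx w) <= 2 / Cmod w.
Proof.
  intros Hx Hw. assert (S := sqrt_PI_bounds).
  assert (Hn : w <> 0) by (apply Cmod_gt_0; lra).
  assert (H := cerfcx_asymptotic w Hx Hn).
  assert (E : Cmod (/ (RtoC (sqrt PI) * w)) <= / Cmod w).
  { rewrite Cmod_inv by (apply Cmult_neq_0; [apply sqrt_PI_C_neq_0|easy]).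
    rewrite Cmod_mult, Cmod_R, Rabs_right by lra. apply Rinv_le_contravar; nra. }
  assert (/ (2 * (Cmod w * Cmod w)) <= / Cmod w) by (apply Rinv_le_contravar; nra).
  generalize (Cmod_le_sum (cerfcx w) (/ (RtoC (sqrt PI) * w))). unfold Rdiv. lra.
Qed.

(** The minimum principle on the part of the quadrant in a disc, so large that [Re f] is
    at least [- eps] on the arc. *)
Lemma quadrant_minimum_principle (f : C -> C) : entire f ->
  (forall x, 0 <= x -> 0 <= Re (f (x, 0))) -> (forall y, y <= 0 -> 0 <= Re (f (0, y))) ->
  (forall eps, 0 < eps -> exists M, forall w, quadrant4 w -> M <= Cmod w -> - eps <= Re (f w)) ->
  forall w, quadrant4 w -> 0 <= Re (f w).
Proof.
  intros Hf Hreal Himag Hinf w0 Hw0.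
  apply Ropp_le_cancel. rewrite Ropp_0. apply le_epsilon. intros e He. rewrite Rplus_0_l.
  destruct (Hinf e He) as [M HM].
  set (r := Rmax M (Cmod w0)).
  assert (R1 : M <= r) by apply Rmax_l. assert (R2 : Cmod w0 <= r) by apply Rmax_r.
  rewrite <- re_opp.
  assert (Hg : entire (fun w => - f w)%C).
  { intros w. destruct (Hf w) as [l Hl]. eexists. apply cderiv_opp. exact Hl. }
  apply (maximum_principle (fun w => quadrant4 w /\ Cmod w <= r)
    (fun w => Re w = 0 \/ Im w = 0 \/ Cmod w = r) (fun w => Re (- f w)) e r);
    [| easy | | | | easy].
  - intros p Hp. unfold quadrant4 in *.
    destruct (Rlt_dec (Re p) 0) as [P1|P1]; [|destruct (Rlt_dec 0 (Im p)) as [P2|P2]].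
    + exists (- Re p). split; [lra|]. intros q Hq [[Q _] _].
      assert (T := Re_diff_bounds q p). lra.
    + exists (Im p). split; [lra|]. intros q Hq [[_ Q] _].
      assert (T := Im_diff_bounds q p). lra.
    + exists (Cmod p - r). split; [lra|]. intros q Hq [_ Q].
      generalize (Cmod_le_sum p q). rewrite (Cmod_sym p). lra.
  - intros a _. apply ccont_usc_Re. now apply entire_cont.
  - intros w [[W1 W2] W3] HB. rewrite re_opp.
    destruct w as [x y]. unfold Re, Im in W1, W2, HB. simpl in W1, W2, HB.
    destruct HB as [->|[->|HB]].
    + generalize (Himag y W2). lra.
    + generalize (Hreal x W1). lra.
    + generalize (HM (x, y) (conj W1 W2) ltac:(lra)). lra.
  - intros a [[A1 A2] A3] HnB.
    assert (N1 : 0 < Re a) by lra. assert (N2 : Im a < 0) by lra. assert (N3 : Cmod a < r) by lra.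
    set (s := Rmin (Rmin (Re a) (- Im a)) (r - Cmod a)).
    assert (S0 : 0 < s) by (repeat apply Rmin_glb_lt; lra).
    assert (S1 : s <= Re a) by (eapply Rle_trans; apply Rmin_l).
    assert (S2 : s <= - Im a) by (eapply Rle_trans; [apply Rmin_l|apply Rmin_r]).
    assert (S3 : s <= r - Cmod a) by apply Rmin_r.
    exists s. split; [easy|]. split.
    + apply mean_value_Re; [easy|now apply entire_cont|]. intros z _. apply Hg.
    + intros z Hz. assert (T1 := Re_le_Cmod (z - a)). assert (T2 := Im_le_Cmod (z - a)).
      rewrite Re_minus in T1. rewrite Im_minus in T2. apply Rabs_le_between in T1, T2.
      generalize (Cmod_le_sum z a). unfold quadrant4. lra.
Qed.

Lemma cerfcx_vanishes (k : C) (eps : R) : Cmod k = 1 -> 0 < eps ->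
  exists M, forall w, quadrant4 w -> M <= Cmod w -> - eps <= Re (k * cerfcx w).
Proof.
  intros Hk He. exists (Rmax 1 (2 / eps)). intros w [Hw _] HM.
  assert (M1 : 1 <= Cmod w) by (eapply Rle_trans; [apply Rmax_l|exact HM]).
  assert (M2 : 2 / eps <= Cmod w) by (eapply Rle_trans; [apply Rmax_r|exact HM]).
  assert (B := cerfcx_bound w Hw M1).
  assert (B2 : 2 / Cmod w <= eps).
  { apply (Rmult_le_reg_r (Cmod w)); [lra|]. unfold Rdiv.
    rewrite Rmult_assoc, Rinv_l, Rmult_1_r by lra.
    apply (Rmult_le_compat_r eps) in M2; [|lra]. unfold Rdiv in M2.
    rewrite Rmult_assoc, Rinv_l, Rmult_1_r in M2 by lra. lra. }
  assert (T := Re_le_Cmod (k * cerfcx w)). rewrite Cmod_mult, Hk, Rmult_1_l in T.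
  apply Rabs_le_between in T. lra.
Qed.

(** Both parts of [cerfcx] are nonnegative on the boundary of the quadrant, by the explicit
    values there, and tend to [0] at infinity. *)
Lemma Im_cerfcx_nonneg (w : C) : quadrant4 w -> 0 <= Im (cerfcx w).
Proof.
  intros Hw. rewrite Im_as_Re.
  apply (quadrant_minimum_principle (fun w => - Ci * cerfcx w)%C); [| | | |easy].
  - apply entire_scal, entire_cerfcx.
  - intros x Hx. rewrite <- Im_as_Re, cerfcx_real, im_RtoC. lra.
  - intros y Hy. rewrite <- Im_as_Re, cerfcx_imag. unfold Im; simpl.
    apply Rmult_le_pos; [apply Rlt_le, exp_pos|].
    assert (growing_gauss_int y <= 0).
    { destruct Hy as [Hy| ->]; [now apply Rlt_le, growing_gauss_int_neg|].
      rewrite growing_gauss_int_0. lra. }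
    generalize two_over_sqrt_PI_pos. nra.
  - intros eps. apply cerfcx_vanishes. rewrite Cmod_opp. apply Cmod_Ci.
Qed.

Lemma Re_cerfcx_nonneg (w : C) : quadrant4 w -> 0 <= Re (cerfcx w).
Proof.
  intros Hw. rewrite <- (Cmult_1_l (cerfcx w)).
  apply (quadrant_minimum_principle (fun w => 1 * cerfcx w)%C); [| | | |easy].
  - apply entire_scal, entire_cerfcx.
  - intros x Hx. rewrite Cmult_1_l, cerfcx_real, re_RtoC.
    apply Rmult_le_pos; [apply Rlt_le, exp_pos|]. now apply Rlt_le, cerfc_real_pos.
  - intros y Hy. rewrite Cmult_1_l, cerfcx_imag. unfold Re; simpl. apply Rlt_le, exp_pos.
  - intros eps. apply cerfcx_vanishes, Cmod_1.
Qed.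

Lemma RInt_pos_of_point (f : R -> R) (a b c : R) : a < c < b ->
  (forall t, continuous f t) -> (forall t, 0 <= f t) -> 0 < f c -> 0 < RInt f a b.
Proof.
  intros Hc Hf Hpos Hfc.
  assert (Hl := Hf c). apply continuity_pt_filterlim in Hl.
  destruct (Hl (f c) Hfc) as [d [Hd H]].
  set (e := Rmin (d / 2) (Rmin (c - a) (b - c))).
  assert (E1 : e <= d / 2) by apply Rmin_l.
  assert (E2 : e <= c - a) by (eapply Rle_trans; [apply Rmin_r|apply Rmin_l]).
  assert (E3 : e <= b - c) by (eapply Rle_trans; [apply Rmin_r|apply Rmin_r]).
  assert (E0 : 0 < e) by (repeat apply Rmin_glb_lt; lra).
  rewrite (RInt_Chasles_R f a (c - e) b), (RInt_Chasles_R f (c - e) (c + e) b) by easy.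
  assert (0 <= RInt f a (c - e)) by (apply RInt_ge_0; [lra|now apply ex_RInt_everywhere|auto]).
  assert (0 <= RInt f (c + e) b) by (apply RInt_ge_0; [lra|now apply ex_RInt_everywhere|auto]).
  assert (0 < RInt f (c - e) (c + e)); [|lra].
  apply RInt_gt_0; [lra| |auto]. intros x Hx.
  destruct (Req_dec x c) as [->|Hn]; [easy|].
  assert (T : Rabs (f x - f c) < f c).
  { apply (H x). split; [split; [easy|congruence]|]. simpl. unfold R_dist. apply Rabs_def1; lra. }
  apply Rabs_def2 in T. lra.
Qed.

(** At an interior point [Re (cerfcx w)] is its mean over the largest circle inside the
    quadrant; that circle touches the boundary, where the real part is positive. *)
Lemma Re_cerfcx_pos (w : C) : quadrant4 w -> 0 < Re (cerfcx w).
Proof.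
  intros [Hx Hy].
  assert (Bx : forall x, 0 <= x -> 0 < Re (cerfcx (x, 0))).
  { intros x Hx'. rewrite cerfcx_real, re_RtoC.
    apply Rmult_lt_0_compat; [apply exp_pos|now apply cerfc_real_pos]. }
  assert (By : forall y, 0 < Re (cerfcx (0, y))).
  { intros y. rewrite cerfcx_imag. unfold Re; simpl. apply exp_pos. }
  destruct Hx as [Hx|Hx].
  2:{ replace w with ((0, Im w) : C) by (rewrite Hx; symmetry; apply surjective_pairing). apply By. }
  destruct Hy as [Hy|Hy].
  2:{ replace w with ((Re w, 0) : C) by (rewrite <- Hy; symmetry; apply surjective_pairing).
      apply Bx. lra. }
  assert (PIpos := PI_RGT_0).
  set (s := Rmin (Re w) (- Im w)).
  assert (S0 : 0 < s) by (apply Rmin_glb_lt; lra).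
  assert (S1 : s <= Re w) by apply Rmin_l. assert (S2 : s <= - Im w) by apply Rmin_r.
  destruct (mean_value_Re cerfcx w s S0 (entire_cont _ _ entire_cerfcx)
    (fun z _ => entire_cerfcx z)) as [_ Hm].
  assert (Hpos : forall t, 0 <= Re (cerfcx (circ w s t))).
  { intros t. apply Re_cerfcx_nonneg. unfold quadrant4, circ. unfold Re at 1, Im at 2; simpl.
    generalize (COS_bound t) (SIN_bound t). intros. split; nra. }
  assert (Hc : forall t, continuous (fun t => Re (cerfcx (circ w s t))) t).
  { intros t. apply (continuous_ext (fun t => Re (cerfcx (w + cexp (ln s, t))%C))).
    { intros t'. now rewrite circ_cexp, exp_ln. }
    apply (continuous_Re_v (fun v => cerfcx (w + cexp v)%C)).
    apply (ccont_comp cerfcx (fun v => w + cexp v)%C); [|apply entire_cont, entire_cerfcx].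
    apply ccont_plus; [apply ccont_const|]. eapply cderiv_cont, cderiv_cexp. }
  assert (Hint : 0 < RInt (fun t => Re (cerfcx (circ w s t))) 0 (2 * PI)).
  { destruct (Rle_dec (Re w) (- Im w)) as [Hle|Hle].
    - apply (RInt_pos_of_point _ 0 (2 * PI) PI); auto; [lra|].
      replace (circ w s PI) with ((0, Im w) : C); [apply By|].
      unfold circ, s. rewrite cos_PI, sin_PI, Rmin_left by easy. f_equal; ring.
    - apply (RInt_pos_of_point _ 0 (2 * PI) (PI / 2)); auto; [lra|].
      replace (circ w s (PI / 2)) with ((Re w, 0) : C); [apply Bx; lra|].
      unfold circ, s. rewrite cos_PI2, sin_PI2, Rmin_right by lra. f_equal; ring. }
  rewrite Hm in Hint. nra.
Qed.

(** * The explicit conformal map *)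

(** The square root of [-z] in the fourth quadrant, for [z] in the closed upper
    half-plane.  The formula is continuous on the whole plane, which spares
    one-sided limits at the boundary. *)
Definition root_neg (z : C) : C :=
  (sqrt ((Cmod z - Re z) / 2), - sqrt ((Cmod z + Re z) / 2)).

Lemma Cmod_Re_bounds (z : C) : 0 <= (Cmod z - Re z) / 2 /\ 0 <= (Cmod z + Re z) / 2.
Proof. assert (H := Re_le_Cmod z). apply Rabs_le_between in H. lra. Qed.

Lemma root_neg_quadrant (z : C) : quadrant4 (root_neg z).
Proof.
  unfold quadrant4, root_neg, Re at 1, Im at 1; simpl.
  generalize (sqrt_pos ((Cmod z - Re z) / 2)) (sqrt_pos ((Cmod z + Re z) / 2)). lra.
Qed.

Lemma ccont_root_neg (z : C) : ccont root_neg z.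
Proof.
  destruct (Cmod_Re_bounds z) as [H1 H2].
  assert (HC : ccont (fun w => RtoC (Cmod w)) z) by (apply (ccont_Cmod (fun w => w)), ccont_id).
  assert (HR : ccont (fun w => RtoC (Re w)) z) by (apply (ccont_Re (fun w => w)), ccont_id).
  apply ccont_pair.
  - apply (ccont_real_comp sqrt (fun w => (Cmod w - Re w) / 2)).
    + now apply continuity_pt_sqrt.
    + apply (ccont_ext_loc (fun w => RtoC (/ 2) * (RtoC (Cmod w) + - (1) * RtoC (Re w)))%C 
        _ z 1 Rlt_0_1).
      * intros w _. unfold RtoC, Cplus, Cmult, Copp; simpl. f_equal; field.
      * apply ccont_rotate, ccont_plus; [easy|]. now apply ccont_rotate.
  - apply (ccont_real_comp (fun x => - sqrt x) (fun w => (Cmod w + Re w) / 2)).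
    + now apply continuity_pt_opp, continuity_pt_sqrt.
    + apply (ccont_ext_loc (fun w => RtoC (/ 2) * (RtoC (Cmod w) + RtoC (Re w)))%C _ z 1 Rlt_0_1).
      * intros w _. unfold RtoC, Cplus, Cmult; simpl. f_equal; field.
      * now apply ccont_rotate, ccont_plus.
Qed.

Lemma root_neg_sqr (z : C) : 0 <= Im z -> (root_neg z * root_neg z)%C = (- z)%C.
Proof.
  intros Hy. destruct (Cmod_Re_bounds z) as [H1 H2].
  assert (E1 := sqrt_sqrt _ H1). assert (E2 := sqrt_sqrt _ H2).
  assert (E3 : sqrt ((Cmod z - Re z) / 2) * sqrt ((Cmod z + Re z) / 2) = Im z / 2).
  { rewrite <- sqrt_mult by easy. apply sqrt_lem_1; [nra|lra|].
    assert (E := Cmod_sqr z). nra. }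
  apply C_eq; unfold root_neg; [rewrite re_mult, re_opp|rewrite im_mult, im_opp];
    unfold Re at 1 2, Im at 1 2; simpl.
  - unfold Re, Im; simpl. unfold Re, Im in *. lra.
  - unfold Re, Im; simpl. unfold Re, Im in *. lra.
Qed.

Lemma Cmod_root_neg (z : C) : 0 <= Im z -> Cmod (root_neg z) * Cmod (root_neg z) = Cmod z.
Proof. intros Hy. rewrite <- Cmod_mult, root_neg_sqr by easy. apply Cmod_opp. Qed.

Lemma root_neg_interior (z : C) : 0 < Im z -> 0 < Re (root_neg z) /\ Im (root_neg z) < 0.
Proof.
  intros Hy. destruct (root_neg_quadrant z) as [H1 H2].
  assert (E := root_neg_sqr z (Rlt_le _ _ Hy)). apply (f_equal Im) in E.
  rewrite im_mult, im_opp in E. split; nra.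
Qed.

Lemma cderiv_root_neg (z : C) : 0 < Im z -> cderiv root_neg z (/ (- (2) * root_neg z)).
Proof.
  intros Hy. assert (Hn : root_neg z <> 0).
  { apply Re_pos_neq_0. now apply root_neg_interior. }
  apply (cderiv_inverse_function (fun w => - (w * w))%C root_neg z _ (Im z) Hy).
  - intros w Hw. rewrite root_neg_sqr; [ring|].
    assert (T := Im_diff_bounds w z). lra.
  - apply ccont_root_neg.
  - apply cderiv_eq with (- (1 * root_neg z + root_neg z * 1))%C; [|ring].
    apply cderiv_opp, (cderiv_mult (fun w => w) (fun w => w)); apply cderiv_id.
  - apply Cmult_neq_0; [|easy]. intros E. apply (f_equal Re) in E.
    rewrite re_opp, !re_RtoC in E. lra.
Qed.

Lemma root_neg_nonpos (t : R) : t <= 0 -> root_neg (RtoC t) = (sqrt (- t), 0).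
Proof.
  intros Ht. unfold root_neg. rewrite Cmod_R, re_RtoC, Rabs_left1 by easy.
  replace ((- t - t) / 2) with (- t) by field. replace ((- t + t) / 2) with 0 by field.
  rewrite sqrt_0, Ropp_0. reflexivity.
Qed.

Lemma root_neg_nonneg (t : R) : 0 <= t -> root_neg (RtoC t) = (0, - sqrt t).
Proof.
  intros Ht. unfold root_neg. rewrite Cmod_R, re_RtoC, Rabs_right by lra.
  replace ((t - t) / 2) with 0 by field. replace ((t + t) / 2) with t by field.
  now rewrite sqrt_0.
Qed.

(** [log (erfc (sqrt (-z)))], written so that only the principal logarithm of a number
    with positive real part occurs. *)
Definition log_erfc_map (z : C) : C := (z + Clog (cerfcx (root_neg z)))%C.

Lemma Re_cerfcx_root_pos (z : C) : 0 < Re (cerfcx (root_neg z)).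
Proof. apply Re_cerfcx_pos, root_neg_quadrant. Qed.

Lemma ccont_log_erfc_map (z : C) : ccont log_erfc_map z.
Proof.
  apply ccont_plus; [apply ccont_id|].
  apply (ccont_comp Clog (fun z => cerfcx (root_neg z))); [|apply ccont_Clog, Re_cerfcx_root_pos].
  apply (ccont_comp cerfcx root_neg); [apply ccont_root_neg|apply entire_cont, entire_cerfcx].
Qed.

Lemma cderiv_log_erfc_map (z : C) : 0 < Im z -> exists l, cderiv log_erfc_map z l.
Proof.
  intros Hy. destruct (entire_cerfcx (root_neg z)) as [l Hl].
  eexists. apply cderiv_plus; [apply cderiv_id|].
  apply (cderiv_comp Clog (fun z => cerfcx (root_neg z))); [|apply cderiv_Clog, Re_cerfcx_root_pos].
  apply (cderiv_comp cerfcx root_neg); [now apply cderiv_root_neg|exact Hl].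
Qed.

Lemma cexp_log_erfc_map (z : C) : 0 <= Im z -> cexp (log_erfc_map z) = cerfc (root_neg z).
Proof.
  intros Hy. unfold log_erfc_map. rewrite cexp_plus, cexp_Clog by apply Re_cerfcx_root_pos.
  unfold cerfcx. rewrite root_neg_sqr by easy.
  rewrite Cmult_assoc, cexp_opp. ring.
Qed.

Lemma Im_log_erfc_map (z : C) : Im z <= Im (log_erfc_map z) < Im z + PI / 2.
Proof.
  unfold log_erfc_map. rewrite im_plus, Im_Clog.
  assert (H1 := Re_cerfcx_root_pos z).
  assert (H2 := Im_cerfcx_nonneg _ (root_neg_quadrant z)).
  assert (0 <= atan (Im (cerfcx (root_neg z)) / Re (cerfcx (root_neg z)))).
  { apply atan_nonneg. now apply Rdiv_le_0_compat. }
  generalize (atan_bound (Im (cerfcx (root_neg z)) / Re (cerfcx (root_neg z)))). lra.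
Qed.

Lemma Re_cerfc_boundary (t : R) : Re (cerfc (root_neg (RtoC t))) <= 1.
Proof.
  destruct (Rle_dec t 0) as [Ht|Ht].
  - rewrite root_neg_nonpos, cerfc_real, re_RtoC by easy.
    generalize two_over_sqrt_PI_pos (gauss_int_nonneg _ (sqrt_pos (- t))). nra.
  - rewrite root_neg_nonneg, cerfc_imag by lra. unfold Re; simpl. lra.
Qed.

(** Along a vertical segment [Re erfc (sqrt (-z))] has derivative
    [- Im (exp z / (sqrt pi sqrt (-z)))], which is negative for heights below [pi/2]. *)
Lemma Re_cerfc_lt_1 (x y : R) : 0 < y < PI / 2 -> Re (cerfc (root_neg (x, y))) < 1.
Proof.
  intros Hy.
  set (phi := fun s => Re (cerfc (root_neg (RtoC x + RtoC s * Ci)%C))).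
  (* the mean value theorem may return the end point [0], where the derivative formula is
     not available; any negative value serves there *)
  set (dphi := fun s => if Rle_dec s 0 then - 1 else
    Re (- RtoC (2 / sqrt PI) * gaussian (root_neg (RtoC x + RtoC s * Ci)) *
    / (- (2) * root_neg (RtoC x + RtoC s * Ci)) * Ci)).
  assert (Him : forall s, Im (RtoC x + RtoC s * Ci)%C = s).
  { intros s. rewrite im_plus, im_RtoC, im_scal_l. unfold Im, Ci; simpl. ring. }
  assert (SP := sqrt_PI_bounds).
  destruct (MVT_gen phi 0 y dphi) as [c [Hc E]]; rewrite ?Rmin_left, ?Rmax_right in * by lra.
  - intros s Hs. unfold dphi. destruct (Rle_dec s 0); [lra|].
    apply (cderiv_path (fun z => cerfc (root_neg z))).
    apply (cderiv_comp cerfc root_neg); [|apply cderiv_cerfc].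
    apply cderiv_root_neg. rewrite Him. lra.
  - intros s _. apply continuity_pt_filterlim.
    apply (ccont_Re_line (fun z => cerfc (root_neg z))).
    apply (ccont_comp cerfc root_neg); [apply ccont_root_neg|].
    eapply cderiv_cont, cderiv_cerfc.
  - assert (Hphi0 : phi 0 <= 1).
    { unfold phi. replace (RtoC x + RtoC 0 * Ci)%C with (RtoC x) by ring. apply Re_cerfc_boundary. }
    replace (Re (cerfc (root_neg (x, y)))) with (phi y) by (unfold phi; now rewrite vertical_line).
    assert (Hneg : forall s, s < PI / 2 -> dphi s < 0).
    { intros s Hs. unfold dphi. destruct (Rle_dec s 0); [lra|]. set (z := (RtoC x + RtoC s * Ci)%C).
      assert (Hz : 0 < Im z) by (unfold z; rewrite Him; lra).
      destruct (root_neg_interior z Hz) as [P1 P2].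
      assert (Hr : root_neg z <> 0) by now apply Re_pos_neq_0.
      set (W := (cexp z / root_neg z)%C).
      replace (- RtoC (2 / sqrt PI) * gaussian (root_neg z) * / (- (2) * root_neg z) * Ci)%C
        with (RtoC (/ sqrt PI) * (W * Ci))%C.
      2:{ unfold W, gaussian. rewrite root_neg_sqr by lra.
          rewrite RtoC_div by lra. rewrite RtoC_inv by lra.
          replace (- - z)%C with z by ring. field.
          split; [exact Hr|exact sqrt_PI_C_neq_0]. }
      rewrite re_scal_l, re_mult_Ci.
      assert (EW : (W * root_neg z)%C = cexp z) by (unfold W; field; easy).
      assert (E1 := f_equal Re EW). assert (E2 := f_equal Im EW).
      rewrite re_mult, Re_cexp in E1. rewrite im_mult, Im_cexp in E2.
      replace (Im z) with s in E1, E2 by (symmetry; apply Him).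
      assert (C1 : 0 < cos s) by (apply cos_gt_0; lra).
      assert (C2 : 0 < sin s) by (apply sin_gt_0; lra).
      assert (X := exp_pos (Re z)).
      assert (T1 : 0 < exp (Re z) * cos s) by now apply Rmult_lt_0_compat.
      assert (T2 : 0 < exp (Re z) * sin s) by now apply Rmult_lt_0_compat.
      assert (HW : 0 < Im W).
      { rewrite <- E1 in T1. rewrite <- E2 in T2.
        assert (0 < Im W * (Re (root_neg z) * Re (root_neg z) + 
          Im (root_neg z) * Im (root_neg z))) by nra.
        nra. }
      assert (0 < / sqrt PI) by (apply Rinv_0_lt_compat; lra). nra. }
    specialize (Hneg c ltac:(lra)). nra.
Qed.

Lemma acos_lt_of_cos_lt (m c : R) : 0 < m < PI -> cos m < c -> c <= 1 -> acos c < m.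
Proof.
  intros Hm H1 H2. apply Rnot_le_lt. intros Hle.
  assert (B := acos_bound c). assert (B2 := COS_bound m).
  assert (cos (acos c) <= cos m) by (apply cos_decr_1; lra).
  rewrite cos_acos in H by lra. lra.
Qed.

(** Since the argument of [cerfcx] is nonnegative, the height of the image is at least
    that of [z].  A point at height below [pi/2] is therefore the image of a point
    to which the previous estimate applies, and [Re (exp w) < 1] describes the region
    there. *)
Lemma log_erfc_map_in_region (z : C) : 0 < Im z -> region_above lower_boundary (log_erfc_map z).
Proof.
  intros Hy. assert (PIpos := PI_RGT_0). unfold region_above, lower_boundary.
  destruct (Im_log_erfc_map z) as [H1 _].
  set (w := log_erfc_map z) in *.
  destruct (Rle_dec 0 (Re w)) as [Hx|Hx]; [|lra].
  assert (P := exp_pos (- Re w)).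
  assert (L1 : exp (- Re w) <= 1) by (rewrite <- exp_0; apply exp_le_compat; lra).
  destruct (Rlt_dec (Im w) (PI / 2)) as [Hw|Hw].
  - apply acos_lt_of_cos_lt; [lra| |easy].
    assert (E := f_equal Re (cexp_log_erfc_map z (Rlt_le _ _ Hy))). fold w in E.
    assert (B := Re_cerfc_lt_1 (Re z) (Im z) ltac:(lra)).
    replace ((Re z, Im z) : C) with z in B by apply surjective_pairing.
    rewrite <- E, Re_cexp in B.
    apply (Rmult_lt_compat_r (exp (- Re w))) in B; [|easy].
    replace (exp (Re w) * cos (Im w) * exp (- Re w)) with (cos (Im w)) in B; [lra|].
    rewrite exp_Ropp. field. apply Rgt_not_eq, exp_pos.
  - apply Rlt_le_trans with (PI / 2); [|lra].
    apply acos_lt_of_cos_lt; [lra| |easy]. now rewrite cos_PI2.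
Qed.

Lemma Im_cerfcx_real (x : R) : Im (cerfcx (x, 0)) = 0.
Proof. rewrite cerfcx_real. apply im_RtoC. Qed.

(** On the negative axis the image is real; on the positive axis its exponential has real
    part [1], which is the equation of the boundary curve. *)
Lemma log_erfc_map_boundary (t : R) : ~ region_above lower_boundary (log_erfc_map (RtoC t)).
Proof.
  unfold region_above, lower_boundary. assert (PIpos := PI_RGT_0).
  destruct (Im_log_erfc_map (RtoC t)) as [H1 H2]. rewrite im_RtoC in H1, H2.
  destruct (Rle_dec t 0) as [Ht|Ht].
  - replace (Im (log_erfc_map (RtoC t))) with 0.
    + destruct (Rle_dec _ _); [|lra].
      generalize (acos_bound (exp (- Re (log_erfc_map (RtoC t))))). lra.
    + unfold log_erfc_map. rewrite im_plus, im_RtoC, Im_Clog, root_neg_nonpos by easy.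
      rewrite Im_cerfcx_real. unfold Rdiv. rewrite Rmult_0_l, atan_0. ring.
  - assert (E := f_equal Re (cexp_log_erfc_map (RtoC t) ltac:(rewrite im_RtoC; lra))).
    rewrite root_neg_nonneg, cerfc_imag in E by lra.
    set (w := log_erfc_map (RtoC t)) in *.
    rewrite Re_cexp in E. change (exp (Re w) * cos (Im w) = 1) in E.
    assert (Ec : cos (Im w) = exp (- Re w)).
    { rewrite exp_Ropp. apply (Rmult_eq_reg_l (exp (Re w))).
      - rewrite E. field. apply Rgt_not_eq, exp_pos.
      - apply Rgt_not_eq, exp_pos. }
    assert (B := COS_bound (Im w)).
    destruct (Rle_dec 0 (Re w)) as [Hx|Hx].
    + rewrite <- Ec, acos_cos by lra. lra.
    + assert (exp 0 < exp (- Re w)) by (apply exp_increasing; lra). rewrite exp_0 in H. lra.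
Qed.

Lemma log_erfc_map_zero (t : R) : log_erfc_map (RtoC t) = 0 -> t = 0.
Proof.
  intros H. assert (E := cexp_log_erfc_map (RtoC t) ltac:(rewrite im_RtoC; lra)).
  rewrite H, cexp_0 in E. assert (S := two_over_sqrt_PI_pos).
  destruct (Rtotal_order t 0) as [Ht|[Ht|Ht]]; [|easy|].
  - rewrite root_neg_nonpos, cerfc_real in E by lra. apply RtoC_inj in E.
    assert (0 < gauss_int (sqrt (- t))) by (apply gauss_int_pos, sqrt_lt_R0; lra). nra.
  - rewrite root_neg_nonneg, cerfc_imag in E by lra. apply (f_equal Im) in E.
    unfold Im, RtoC in E. simpl in E.
    assert (growing_gauss_int (- sqrt t) < 0).
    { apply growing_gauss_int_neg. generalize (sqrt_lt_R0 t Ht). lra. }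
    nra.
Qed.

Lemma cerfcx_modulus_bounds (w : C) : 0 <= Re w -> 2 <= Cmod w ->
  / (4 * Cmod w) <= Cmod (cerfcx w) <= 1.
Proof.
  intros Hx Hw. assert (S := sqrt_PI_bounds).
  assert (Hn : w <> 0) by (apply Cmod_gt_0; lra).
  split.
  - assert (H := cerfcx_asymptotic w Hx Hn).
    assert (E : / (2 * Cmod w) <= Cmod (/ (RtoC (sqrt PI) * w))).
    { rewrite Cmod_inv by (apply Cmult_neq_0; [apply sqrt_PI_C_neq_0|easy]).
      rewrite Cmod_mult, Cmod_R, Rabs_right by lra.
      apply Rinv_le_contravar; [apply Rmult_lt_0_compat; lra|].
      apply Rmult_le_compat_r; lra. }
    assert (/ (2 * (Cmod w * Cmod w)) <= / (4 * Cmod w)) by (apply Rinv_le_contravar; nra).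
    replace (/ (2 * Cmod w)) with (2 * / (4 * Cmod w)) in E by (field; lra).
    generalize (Cmod_le_sum (/ (RtoC (sqrt PI) * w)) (cerfcx w)).
    rewrite (Cmod_sym (/ (RtoC (sqrt PI) * w))). lra.
  - eapply Rle_trans; [apply cerfcx_bound; lra|].
    apply (Rmult_le_reg_r (Cmod w)); [lra|]. unfold Rdiv.
    rewrite Rmult_assoc, Rinv_l by lra. lra.
Qed.

Lemma ln_le_id (x : R) : 0 < x -> ln x <= x.
Proof.
  intros Hx. generalize (exp_ineq1_le (ln x)). rewrite exp_ln by easy. lra.
Qed.

(** The difference is a logarithm of [cerfcx], of size [O(log |z|)]. *)
Lemma log_erfc_map_asymptotic (eps : R) : 0 < eps ->
  exists M, forall z, 0 <= Im z -> M < Cmod z -> Cmod (log_erfc_map z - z) <= eps * Cmod z.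
Proof.
  intros He. exists (Rmax 4 (25 / (eps * eps))). intros z Hy HM.
  assert (M1 := Rle_lt_trans _ _ _ (Rmax_l _ _) HM).
  assert (M2 := Rle_lt_trans _ _ _ (Rmax_r _ _) HM).
  assert (Er := Cmod_root_neg z Hy). set (r := root_neg z) in *.
  assert (Pr := Cmod_ge_0 r). assert (R2 : 2 <= Cmod r) by nra.
  assert (R5 : 5 <= eps * Cmod r).
  { rewrite <- Er in M2. apply (Rmult_lt_compat_r (eps * eps)) in M2; [|nra].
    unfold Rdiv in M2. rewrite Rmult_assoc, Rinv_l, Rmult_1_r in M2 by nra.
    assert (0 <= eps * Cmod r) by (apply Rmult_le_pos; lra).
    apply Rnot_lt_le. intros Hlt. nra. }
  assert (Hq := root_neg_quadrant z). fold r in Hq.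
  destruct (cerfcx_modulus_bounds r (proj1 Hq) R2) as [B1 B2].
  unfold log_erfc_map. fold r. replace (z + Clog (cerfcx r) - z)%C with (Clog (cerfcx r)) by ring.
  eapply Rle_trans; [apply (Cmod_le_Re_Im (Clog (cerfcx r)))|].
  rewrite (Re_Clog (cerfcx r)), (Im_Clog (cerfcx r)).
  assert (PIpos := PI_RGT_0). assert (PI4 := PI_4).
  assert (A1 : Rabs (atan (Im (cerfcx r) / Re (cerfcx r))) <= 2).
  { generalize (atan_bound (Im (cerfcx r) / Re (cerfcx r))). intros. apply Rabs_le. lra. }
  assert (A2 : Rabs (ln (Cmod (cerfcx r))) <= 4 * Cmod r).
  { assert (Hpos : 0 < / (4 * Cmod r)) by (apply Rinv_0_lt_compat; lra).
    assert (L1 : ln (/ (4 * Cmod r)) <= ln (Cmod (cerfcx r))) by (apply ln_le; lra).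
    assert (L2 : ln (Cmod (cerfcx r)) <= ln 1) by (apply ln_le; lra).
    rewrite ln_1 in L2. rewrite ln_Rinv in L1 by lra.
    generalize (ln_le_id (4 * Cmod r) ltac:(lra)). intros. apply Rabs_le. lra. }
  rewrite <- Er. nra.
Qed.

(** * Identification of the conformal map *)

Lemma is_boundary_value_iff (f : C -> C) (t : R) (l : C) :
  is_boundary_value f t l <-> forall eps, 0 < eps -> exists d, 0 < d /\
    forall z, upper_half_plane z -> Cmod (z - RtoC t) < d -> Cmod (f z - l) < eps.
Proof.
  assert (Hball : forall (x y : C) (e : R), ball (M := C_UniformSpace) x e y ->
    Cmod (y - x) < 2 * e).
  { intros x y e [H1 H2]. eapply Rle_lt_trans; [apply Cmod_le_Re_Im|].
    rewrite Re_minus, Im_minus. change (Rabs (Re y - Re x) < e) in H1.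
    change (Rabs (Im y - Im x) < e) in H2. lra. }
  assert (Hball2 : forall (x y : C) (e : R), Cmod (y - x) < e ->
    ball (M := C_UniformSpace) x e y).
  { intros x y e H. split.
    - change (Rabs (Re y - Re x) < e). rewrite <- Re_minus.
      eapply Rle_lt_trans; [apply Re_le_Cmod|easy].
    - change (Rabs (Im y - Im x) < e). rewrite <- Im_minus.
      eapply Rle_lt_trans; [apply Im_le_Cmod|easy]. }
  split.
  - intros H e He.
    destruct (H (fun y => Cmod (y - l) < e)) as [d Hd].
    { assert (He2 : 0 < e / 2) by lra. exists (mkposreal _ He2). intros y Hy.
      apply Hball in Hy. simpl in Hy. lra. }
    exists d. split; [apply cond_pos|]. intros z Hz Hzt. apply (Hd z); [|easy].
    now apply Hball2.
  - intros H P [e He]. destruct (H e (cond_pos e)) as [d [Hd H1]].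
    assert (Hd2 : 0 < d / 2) by lra.
    exists (mkposreal _ Hd2). intros z Hz HU. apply He, Hball2, H1; [easy|].
    apply Hball in Hz. simpl in Hz. lra.
Qed.

Lemma asymptotic_to_identity (f : C -> C) :
  filterlim (fun z : C => (f z / z)%C) (within upper_half_plane C_infinity) (locally (RtoC 1)) ->
  forall eps, 0 < eps -> exists M, forall z, upper_half_plane z ->
    M < Cmod z -> Cmod (f z - z) <= eps * Cmod z.
Proof.
  intros H e He.
  destruct (H (fun y => Cmod (y - 1) < e)) as [M HM].
  { assert (He2 : 0 < e / 2) by lra. exists (mkposreal _ He2). intros y [H1 H2].
    simpl in H1, H2. eapply Rle_lt_trans; [apply Cmod_le_Re_Im|].
    rewrite Re_minus, Im_minus. change (Rabs (Re y - Re 1) < e / 2) in H1.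
    change (Rabs (Im y - Im 1) < e / 2) in H2. lra. }
  exists M. intros z Hz HzM. specialize (HM z HzM Hz). simpl in HM.
  assert (Hn : z <> 0).
  { intros ->. unfold upper_half_plane in Hz. rewrite im_RtoC in Hz. lra. }
  replace (f z - z)%C with ((f z / z - 1) * z)%C by (field; easy).
  rewrite Cmod_mult. apply Rmult_le_compat_r; [apply Cmod_ge_0|lra].
Qed.

Lemma upper_half_plane_open : set_open upper_half_plane.
Proof.
  intros p Hp. exists (Im p / 2). unfold upper_half_plane in *. split; [lra|].
  intros q Hq. assert (T := Im_diff_bounds q p). lra.
Qed.

Lemma lower_boundary_bounds (x : R) : 0 <= lower_boundary x < PI / 2.
Proof.
  assert (PIpos := PI_RGT_0). unfold lower_boundary. destruct (Rle_dec 0 x); [|lra].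
  assert (P := exp_pos (- x)). split; [apply acos_bound|].
  apply acos_lt_of_cos_lt; [lra|now rewrite cos_PI2|].
  rewrite <- exp_0. apply exp_le_compat. lra.
Qed.

(** A derivative [l] with both [Im l] and [Im (i l)] zero vanishes. *)
Lemma real_valued_holomorphic_constant (f : C -> C) :
  (forall z, upper_half_plane z -> exists l, cderiv f z l) ->
  (forall z, upper_half_plane z -> Im (f z) = 0) ->
  forall z w, upper_half_plane z -> upper_half_plane w -> f z = f w.
Proof.
  intros Hf Him z w Hz Hw. unfold upper_half_plane in *.
  apply cderiv_zero_constant. intros s Hs.
  set (p := (z + RtoC s * (w - z))%C).
  assert (Hp : 0 < Im p).
  { unfold p. rewrite im_plus, im_scal_l, Im_minus. nra. }
  destruct (Hf p Hp) as [l Hl].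
  assert (Hdir : forall q, Cmod q = 1 -> Im (l * q) = 0).
  { intros q Hq. destruct (cderiv_path f p q l 0) as [_ H1].
    { replace (p + RtoC 0 * q)%C with p by ring. easy. }
    apply is_derive_unique in H1. rewrite <- H1. apply is_derive_unique.
    apply (is_derive_ext_loc (fun _ => 0)); [|apply (is_derive_const (V := R_NormedModule))].
    exists (mkposreal _ Hp). intros s' Hs'. symmetry. apply Him.
    change (Rabs (s' - 0) < Im p) in Hs'. rewrite Rminus_0_r in Hs'.
    rewrite im_plus, im_scal_l. assert (T := Im_le_Cmod q). rewrite Hq in T.
    assert (T2 : Rabs (s' * Im q) < Im p).
    { rewrite Rabs_mult. assert (P1 := Rabs_pos s'). assert (P2 := Rabs_pos (Im q)). nra. }
    apply Rabs_def2 in T2. lra. }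
  assert (E1 := Hdir 1 Cmod_1). rewrite Cmult_1_r in E1.
  assert (E2 := Hdir Ci Cmod_Ci). rewrite im_mult in E2. unfold Ci, Re, Im in E1, E2.
  simpl in E1, E2.
  replace (RtoC 0) with l; [exact Hl|]. apply C_eq; unfold Re, Im, RtoC; simpl; lra.
Qed.

(** Throughout this section [h] is the holomorphic inverse of [H]. *)
Section Uniqueness.

Variable H h : C -> C.
Let Omega : C -> Prop := region_above lower_boundary.
Hypothesis H_cont : forall z, upper_half_plane z -> ccont H z.
Hypothesis H_region : forall z, upper_half_plane z -> Omega (H z).
Hypothesis H_inj : forall z w, upper_half_plane z -> upper_half_plane w -> H z = H w -> z = w.
Hypothesis h_inverse : forall w, Omega w ->
  upper_half_plane (h w) /\ H (h w) = w /\ exists l, cderiv h w l.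
Hypothesis H_asym : forall eps, 0 < eps -> exists M, forall z, upper_half_plane z ->
  M < Cmod z -> Cmod (H z - z) <= eps * Cmod z.

Lemma inverse_on_segment (p q : C) (r : R) :
  (forall s, 0 <= s <= 1 -> Omega (p + RtoC s * q)%C /\ Cmod (h (p + RtoC s * q)%C) <> r) ->
  Cmod (h p) < r -> Cmod (h (p + q)%C) < r.
Proof.
  intros Hs Hp. apply Rnot_le_lt. intros Hle.
  set (g := fun s => Re (RtoC (Cmod (h (p + RtoC s * q)%C))) - r).
  assert (Eg : forall s, g s = Cmod (h (p + RtoC s * q)%C) - r)
    by (intros s; unfold g; now rewrite re_RtoC).
  destruct (IVT_interv g 0 1) as [s [Hs1 Hs2]].
  - intros s Hs'. apply continuity_pt_minus; [|apply continuity_pt_const; intros ? ?; easy].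
    apply continuity_pt_filterlim. apply (ccont_Re_line (fun z => RtoC (Cmod (h z)))).
    apply (ccont_Cmod h). destruct (h_inverse _ (proj1 (Hs s Hs'))) as (_ & _ & l & Hl).
    now apply cderiv_cont in Hl.
  - lra.
  - rewrite Eg. replace (p + RtoC 0 * q)%C with p by ring. lra.
  - rewrite Eg. assert (H1 := proj2 (Hs 1 ltac:(lra))).
    replace (p + RtoC 1 * q)%C with (p + q)%C in * by ring. lra.
  - rewrite Eg in Hs2. apply (proj2 (Hs s Hs1)). lra.
Qed.

(** Any point of the region far from the origin is joined within the region, by a
    vertical and a horizontal segment far from the origin, to the image of a high point of the
    imaginary axis.  Along this path the preimage cannot cross a circle whose image
    under [H] is not that far out. *)
Lemma inverse_unbounded (M : R) :
  exists M', forall w, Omega w -> M' < Cmod w -> M < Cmod (h w).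
Proof.
  destruct (H_asym (1 / 2)) as [M0 HM0]; [lra|].
  set (r := Rmax M (Rmax M0 0) + 1).
  assert (R1 : M + 1 <= r) by (unfold r; generalize (Rmax_l M (Rmax M0 0)); lra).
  assert (R2 : M0 + 1 <= r /\ 1 <= r).
  { unfold r. generalize (Rmax_r M (Rmax M0 0)) (Rmax_l M0 0) (Rmax_r M0 0). lra. }
  exists (2 * r + 2). intros w Hw Hwm. apply Rnot_le_lt. intros Hle.
  assert (Hcirc : forall v, Omega v -> 2 * r < Cmod v -> Cmod (h v) <> r).
  { intros v Hv Hvm E. destruct (h_inverse v Hv) as (Uv & Ev & _).
    specialize (HM0 (h v) Uv ltac:(lra)). rewrite Ev, E in HM0.
    generalize (Cmod_le_sum v (h v)). lra. }
  assert (PI4 := PI_4).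
  assert (Hhigh : forall v, PI / 2 <= Im v -> Omega v).
  { intros v Hv. unfold Omega, region_above. generalize (lower_boundary_bounds (Re v)). lra. }
  assert (HwI : lower_boundary (Re w) < Im w) by exact Hw.
  set (Y := 2 * (Cmod w + r + 4)).
  assert (Pw := Cmod_ge_0 w). assert (Iw := Im_le_Cmod w). apply Rabs_le_between in Iw.
  assert (HY : Cmod (RtoC Y * Ci) = Y).
  { rewrite Cmod_mult, Cmod_R, Cmod_Ci, Rabs_right; unfold Y; lra. }
  assert (IY : Im (RtoC Y * Ci) = Y) by (rewrite im_scal_l; unfold Im, Ci; simpl; ring).
  assert (UY : upper_half_plane (RtoC Y * Ci)%C).
  { unfold upper_half_plane. rewrite IY. unfold Y. lra. }
  set (v := H (RtoC Y * Ci)%C).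
  assert (Iv : Y / 2 <= Im v).
  { specialize (HM0 _ UY ltac:(rewrite HY; unfold Y; lra)). fold v in HM0. rewrite HY in HM0.
    assert (T := Im_le_Cmod (v - RtoC Y * Ci)). rewrite Im_minus, IY in T.
    apply Rabs_le_between in T. lra. }
  assert (Y2 : Y / 2 = Cmod w + r + 4) by (unfold Y; field).
  (* the corner of the path *)
  set (u := ((Re w, Im v) : C)).
  assert (Step1 : Cmod (h u) < r).
  { replace u with (w + RtoC (Im v - Im w) * Ci)%C.
    2:{ apply C_eq; [rewrite re_plus, re_scal_l|rewrite im_plus, im_scal_l];
        unfold u, Re, Im, Ci; simpl; ring. }
    apply inverse_on_segment; [|lra]. intros s Hs.
    set (p := (w + RtoC s * (RtoC (Im v - Im w) * Ci))%C).
    assert (Ep : Re p = Re w /\ Im p = Im w + s * (Im v - Im w)).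
    { unfold p. rewrite re_plus, im_plus, !re_scal_l, !im_scal_l.
      unfold Ci, Re, Im; simpl. split; ring. }
    assert (Hp : Im w <= Im p) by (rewrite (proj2 Ep); nra).
    assert (Op : Omega p).
    { unfold Omega, region_above. rewrite (proj1 Ep). lra. }
    split; [easy|]. apply Hcirc; [easy|].
    assert (Cmod w <= Cmod p); [|lra].
    assert (E1 := Cmod_sqr w). assert (E2 := Cmod_sqr p). rewrite (proj1 Ep) in E2.
    assert (P := Cmod_ge_0 p). generalize (lower_boundary_bounds (Re w)). intros B. nra. }
  assert (Step2 : Cmod (h v) < r).
  { replace v with (u + RtoC (Re v - Re w))%C.
    2:{ apply C_eq; [rewrite re_plus, re_RtoC|rewrite im_plus, im_RtoC];
        unfold u, Re, Im; simpl; ring. }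
    apply inverse_on_segment; [|easy]. intros s Hs.
    set (p := (u + RtoC s * RtoC (Re v - Re w))%C).
    assert (Ep : Im p = Im v).
    { unfold p. rewrite im_plus, im_scal_l, im_RtoC. unfold u, Im; simpl. ring. }
    assert (Op : Omega p) by (apply Hhigh; rewrite Ep; lra).
    split; [easy|]. apply Hcirc; [easy|].
    assert (T := Im_le_Cmod p). rewrite Ep in T. apply Rabs_le_between in T. lra. }
  destruct (h_inverse v (H_region _ UY)) as (Uv & Ev & _).
  rewrite (H_inj _ _ Uv UY Ev), HY in Step2. unfold Y in Step2. lra.
Qed.

Let psi (z : C) : C := h (log_erfc_map z).

Lemma psi_spec (z : C) : upper_half_plane z ->
  upper_half_plane (psi z) /\ H (psi z) = log_erfc_map z /\ exists l, cderiv psi z l.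
Proof.
  intros Hz. destruct (h_inverse _ (log_erfc_map_in_region z Hz)) as (U & E & l & Hl).
  repeat split; try easy.
  destruct (cderiv_log_erfc_map z Hz) as [l' Hl']. eexists.
  apply (cderiv_comp h log_erfc_map); eassumption.
Qed.

(** Both [H] and [log_erfc_map] are asymptotic to the identity, and [psi z] is far out
    when [z] is. *)
Lemma psi_asymptotic (eps : R) : 0 < eps -> exists M, forall z, upper_half_plane z ->
  M < Cmod z -> Cmod (psi z - z) <= eps * Cmod z.
Proof.
  intros He. set (e := Rmin (eps / 4) (1 / 4)).
  assert (E1 : e <= eps / 4) by apply Rmin_l. assert (E2 : e <= 1 / 4) by apply Rmin_r.
  assert (E0 : 0 < e) by (apply Rmin_glb_lt; lra).
  destruct (H_asym e E0) as [M1 HM1]. destruct (log_erfc_map_asymptotic e E0) as [M2 HM2].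
  destruct (inverse_unbounded M1) as [M' HM'].
  exists (Rmax M2 (2 * M')). intros z Hz HzM.
  assert (Z1 := Rle_lt_trans _ _ _ (Rmax_l _ _) HzM).
  assert (Z2 := Rle_lt_trans _ _ _ (Rmax_r _ _) HzM).
  specialize (HM2 z (Rlt_le _ _ Hz) Z1).
  destruct (psi_spec z Hz) as (U & E & _).
  assert (Pz := Cmod_ge_0 z).
  assert (Hfar : M1 < Cmod (psi z)).
  { apply HM'; [now apply log_erfc_map_in_region|].
    generalize (Cmod_le_sum z (log_erfc_map z)). rewrite (Cmod_sym z). nra. }
  specialize (HM1 _ U Hfar). rewrite E in HM1.
  assert (T1 := Cmod_sub_triangle (psi z) (log_erfc_map z) z).
  assert (T2 := Cmod_le_sum (psi z) z). rewrite (Cmod_sym (psi z) (log_erfc_map z)) in T1.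
  assert (P3 := Cmod_ge_0 (psi z - z)). nra.
Qed.

(** Near a real point [psi] stays bounded, and [H] maps a compact set of points of height
    at least [eps] into the region, away from the boundary point to which
    [log_erfc_map] converges. *)
Lemma psi_boundary (t eps : R) : 0 < eps -> exists d, 0 < d /\
  forall z, upper_half_plane z -> Cmod (z - RtoC t) < d -> Im (psi z) < eps.
Proof.
  intros He. destruct (H_asym (1 / 2)) as [M0 HM0]; [lra|].
  set (b := log_erfc_map (RtoC t)).
  set (r := Rmax M0 (2 * (Cmod b + 1))).
  assert (R1 : M0 <= r) by apply Rmax_l. assert (R2 : 2 * (Cmod b + 1) <= r) by apply Rmax_r.
  destruct (continuous_nonvanishing_bounded_below
    (fun w => Cmod w <= r /\ eps <= Im w) (fun w => H w - b)%C r) as [m [Hm HmK]].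
  - intros p Hp. destruct (Rlt_dec (Im p) eps) as [P1|P1].
    + exists (eps - Im p). split; [lra|]. intros q Hq [_ Q].
      assert (T := Im_diff_bounds q p). lra.
    + exists (Cmod p - r). split; [lra|]. intros q Hq [Q _].
      generalize (Cmod_le_sum p q). rewrite (Cmod_sym p). lra.
  - easy.
  - intros w [_ Hw]. apply ccont_plus; [|apply ccont_const].
    apply H_cont. unfold upper_half_plane. lra.
  - intros w [_ Hw] E. apply Ceq_minus in E. apply (log_erfc_map_boundary t).
    fold b. rewrite <- E. apply H_region. unfold upper_half_plane. lra.
  - destruct (ccont_log_erfc_map (RtoC t) (Rmin 1 m)) as [d [Hd Hc]].
    { apply Rmin_glb_lt; lra. }
    exists d. split; [easy|]. intros z Hz Hzt. specialize (Hc z Hzt). fold b in Hc.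
    assert (C1 := Rlt_le_trans _ _ _ Hc (Rmin_l _ _)).
    assert (C2 := Rlt_le_trans _ _ _ Hc (Rmin_r _ _)).
    destruct (psi_spec z Hz) as (U & E & _).
    apply Rnot_le_lt. intros Hle.
    assert (Hr : Cmod (psi z) <= r).
    { apply Rnot_lt_le. intros Hlt. specialize (HM0 _ U ltac:(lra)). rewrite E in HM0.
      generalize (Cmod_le_sum (psi z) (log_erfc_map z)) (Cmod_le_sum (log_erfc_map z) b).
      rewrite (Cmod_sym (psi z)). lra. }
    specialize (HmK _ (conj Hr Hle)). rewrite E in HmK. lra.
Qed.

(** [Im psi - Im z] and its negative have nonpositive upper limits at the real axis, the
    first because [Im psi] tends to [0] and the second because [Im psi > 0]; both are
    [o(|z|)]. *)
Lemma psi_imaginary_part (z : C) : upper_half_plane z -> Im (psi z) = Im z.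
Proof.
  intros Hz.
  assert (Dpsi : forall k w, upper_half_plane w ->
    exists l, cderiv (fun w => k * (psi w - w))%C w l).
  { intros k w Hw. destruct (psi_spec w Hw) as (_ & _ & l & Hl). eexists.
    apply cderiv_scal, cderiv_minus; [exact Hl|apply cderiv_id]. }
  assert (Grow : forall k, Cmod k = 1 -> forall eps, 0 < eps -> exists M, forall w,
    upper_half_plane w -> M < Cmod w -> Re (k * (psi w - w)) <= eps * Cmod w).
  { intros k Hk eps He. destruct (psi_asymptotic eps He) as [M HM]. exists M.
    intros w Hw HwM. specialize (HM w Hw HwM).
    assert (T := Re_le_Cmod (k * (psi w - w))). rewrite Cmod_mult, Hk in T.
    apply Rabs_le_between in T. lra. }
  apply Rle_antisym.
  - apply Rminus_le. rewrite <- Im_minus, Im_as_Re.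
    apply (half_plane_phragmen_lindelof (fun w => - Ci * (psi w - w))%C); [| | |easy].
    + apply Dpsi.
    + intros t eps He. destruct (psi_boundary t eps He) as [d [Hd Hb]]. exists d.
      split; [easy|]. intros w Hw Hwt. specialize (Hb w Hw Hwt).
      rewrite <- Im_as_Re, Im_minus. unfold upper_half_plane in Hw. lra.
    + apply Grow. now rewrite Cmod_opp, Cmod_Ci.
  - apply Rminus_le. replace (Im z - Im (psi z)) with (Re (Ci * (psi z - z))).
    2:{ rewrite Cmult_comm, re_mult_Ci, Im_minus. ring. }
    apply (half_plane_phragmen_lindelof (fun w => Ci * (psi w - w))%C); [| | |easy].
    + apply Dpsi.
    + intros t eps He. exists eps. split; [easy|]. intros w Hw Hwt.
      rewrite Cmult_comm, re_mult_Ci, Im_minus.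
      destruct (psi_spec w Hw) as (U & _). unfold upper_half_plane in U.
      assert (T := Im_le_Cmod (w - RtoC t)). rewrite Im_minus, im_RtoC in T.
      apply Rabs_le_between in T. lra.
    + apply Grow, Cmod_Ci.
Qed.

(** As [psi - z] has imaginary part [0], it is a real constant [c].  So
    [log_erfc_map z = H (z + c)] tends to [0] at [- c] by the normalization of [H], and
    [0] is the only real zero of [log_erfc_map]. *)
Lemma conformal_map_unique (H_zero : is_boundary_value H 0 (RtoC 0)) (z : C) :
  upper_half_plane z -> H z = log_erfc_map z.
Proof.
  assert (Hconst : forall z w, upper_half_plane z -> upper_half_plane w ->
    (psi z - z)%C = (psi w - w)%C).
  { apply (real_valued_holomorphic_constant (fun z => psi z - z)%C).
    - intros w Hw. destruct (psi_spec w Hw) as (_ & _ & l & Hl). eexists.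
      apply cderiv_minus; [exact Hl|apply cderiv_id].
    - intros w Hw. rewrite Im_minus, psi_imaginary_part by easy. ring. }
  assert (UCi : upper_half_plane Ci) by (unfold upper_half_plane, Im, Ci; simpl; lra).
  set (c := Re (psi Ci - Ci)).
  assert (Hc : forall w, upper_half_plane w -> psi w = (w + RtoC c)%C).
  { intros w Hw. replace (psi w) with (w + (psi w - w))%C by ring. f_equal.
    rewrite (Hconst w Ci Hw UCi). apply C_eq; [now rewrite re_RtoC|].
    rewrite im_RtoC, Im_minus, psi_imaginary_part by easy. ring. }
  assert (Hshift : forall w, upper_half_plane w -> H (w + RtoC c)%C = log_erfc_map w).
  { intros w Hw. rewrite <- Hc by easy. now apply psi_spec. }
  assert (Hzero : log_erfc_map (RtoC (- c)) = 0).
  { apply Cmod_eq_0. apply Rle_antisym; [|apply Cmod_ge_0].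
    apply le_epsilon. intros e He. rewrite Rplus_0_l.
    destruct (ccont_log_erfc_map (RtoC (- c)) (e / 2)) as [d1 [Hd1 H1]]; [lra|].
    apply is_boundary_value_iff with (eps := e / 2) in H_zero; [|lra].
    destruct H_zero as [d2 [Hd2 H2]].
    set (s := Rmin d1 d2 / 2).
    assert (S0 : 0 < s) by (apply Rdiv_lt_0_compat; [apply Rmin_glb_lt; lra|lra]).
    assert (S1 : s < d1) by (generalize (Rmin_l d1 d2); unfold s in *; lra).
    assert (S2 : s < d2) by (generalize (Rmin_r d1 d2); unfold s in *; lra).
    assert (Ms : Cmod (RtoC s * Ci) = s).
    { rewrite Cmod_mult, Cmod_R, Cmod_Ci, Rabs_right; lra. }
    assert (Is : Im (RtoC s * Ci) = s) by (rewrite im_scal_l; unfold Im, Ci; simpl; ring).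
    specialize (H1 (RtoC (- c) + RtoC s * Ci)%C).
    specialize (H2 (RtoC s * Ci)%C).
    replace (RtoC (- c) + RtoC s * Ci - RtoC (- c))%C with (RtoC s * Ci)%C in H1 by ring.
    replace (RtoC s * Ci - RtoC 0)%C with (RtoC s * Ci)%C in H2 by ring.
    rewrite Ms in H1, H2. specialize (H1 S1).
    specialize (H2 ltac:(unfold upper_half_plane; rewrite Is; lra) S2).
    rewrite <- Hshift in H1
      by (unfold upper_half_plane; rewrite im_plus, im_RtoC, Is; lra).
    replace (RtoC (- c) + RtoC s * Ci + RtoC c)%C with (RtoC s * Ci)%C in H1
      by (rewrite RtoC_opp; ring).
    replace (H (RtoC s * Ci) - RtoC 0)%C with (H (RtoC s * Ci)) in H2 by ring.
    generalize (Cmod_le_sum (log_erfc_map (RtoC (- c))) (H (RtoC s * Ci)%C)).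
    rewrite (Cmod_sym (log_erfc_map (RtoC (- c)))). lra. }
  apply log_erfc_map_zero in Hzero.
  intros Hz. rewrite <- Hshift by easy. replace c with 0 by lra. f_equal. ring.
Qed.

End Uniqueness.

(** * The logarithmic integral *)

Definition normalized_erfcx (w : C) : C := ((1 + RtoC (sqrt PI) * w) * cerfcx w)%C.

Definition log_normalized (w : C) : C :=
  (Clog (1 + RtoC (sqrt PI) * w) + Clog (cerfcx w))%C.

Lemma Re_affine_pos (w : C) : quadrant4 w -> 0 < Re (1 + RtoC (sqrt PI) * w).
Proof.
  intros [H _]. rewrite re_plus, re_RtoC, re_scal_l. generalize sqrt_PI_bounds. nra.
Qed.

Lemma Re_log_normalized (w : C) : quadrant4 w ->
  Re (log_normalized w) = ln (Cmod (normalized_erfcx w)).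
Proof.
  intros Hw. unfold log_normalized, normalized_erfcx.
  rewrite re_plus, !Re_Clog, Cmod_mult, ln_mult; [easy| |].
  - now apply Re_pos_Cmod, Re_affine_pos.
  - now apply Re_pos_Cmod, Re_cerfcx_pos.
Qed.

Lemma cderiv_log_normalized (w : C) : quadrant4 w -> exists l, cderiv log_normalized w l.
Proof.
  intros Hw. destruct (entire_cerfcx w) as [l Hl]. eexists. apply cderiv_plus.
  - apply (cderiv_comp Clog (fun w => 1 + RtoC (sqrt PI) * w)%C).
    + apply cderiv_plus; [apply cderiv_const|apply cderiv_scal, cderiv_id].
    + now apply cderiv_Clog, Re_affine_pos.
  - apply (cderiv_comp Clog cerfcx); [exact Hl|]. now apply cderiv_Clog, Re_cerfcx_pos.
Qed.

Lemma ln_near_1 (eps : R) : 0 < eps ->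
  exists d, 0 < d /\ forall g : C, Cmod (g - 1) < d -> Rabs (ln (Cmod g)) < eps.
Proof.
  intros He.
  assert (Hl : continuity_pt ln 1).
  { apply derivable_continuous_pt. exists (/ 1). apply derivable_pt_lim_ln. lra. }
  destruct (Hl eps He) as [d [Hd H]]. exists d. split; [easy|]. intros g Hg.
  destruct (Req_dec (Cmod g) 1) as [->|Hn]; [now rewrite ln_1, Rabs_R0|].
  specialize (H (Cmod g)). simpl in H. unfold R_dist in H. rewrite ln_1, Rminus_0_r in H.
  apply H. split; [split; [easy|congruence]|].
  generalize (Cmod_le_sum g 1) (Cmod_le_sum 1 g). rewrite (Cmod_sym 1 g), Cmod_1.
  intros. apply Rabs_def1; lra.
Qed.

(** The factor [1 + sqrt pi w] cancels the decay of [cerfcx] at infinity without changing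
    the value [1] at the origin. *)
Lemma log_normalized_vanishes (eps : R) : 0 < eps -> exists x0 x1,
  forall w, quadrant4 w -> 0 < Cmod w -> ln (Cmod w) < x0 \/ x1 < ln (Cmod w) ->
  Rabs (Re (log_normalized w)) <= eps.
Proof.
  intros He. destruct (ln_near_1 eps He) as [d [Hd Hln]].
  assert (SP := sqrt_PI_bounds).
  assert (C0 : ccont normalized_erfcx 0).
  { apply ccont_mult; [|apply entire_cont, entire_cerfcx].
    apply ccont_plus; [apply ccont_const|]. apply ccont_rotate, ccont_id. }
  assert (E0 : normalized_erfcx 0 = 1).
  { unfold normalized_erfcx. change (RtoC 0) with ((0, 0) : C) at 2.
    rewrite cerfcx_real, gauss_int_0.
    replace (exp (0 * 0) * (1 - 2 / sqrt PI * 0)) with 1 by (rewrite Rmult_0_l, exp_0; ring).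
    ring. }
  destruct (C0 d Hd) as [r [Hr H0]]. rewrite E0 in H0.
  exists (ln r), (ln (Rmax 1 (3 / d))). intros w Hw Pw Hcase.
  rewrite Re_log_normalized by easy. apply Rlt_le, Hln. destruct Hcase as [Hc|Hc].
  - apply ln_lt_inv in Hc; [|easy|easy]. apply H0.
    now replace (w - 0)%C with w by ring.
  - assert (P1 : 0 < Rmax 1 (3 / d)) by (generalize (Rmax_l 1 (3 / d)); lra).
    apply ln_lt_inv in Hc; [|easy|easy].
    assert (W1 := Rle_lt_trans _ _ _ (Rmax_l _ _) Hc).
    assert (W2 := Rle_lt_trans _ _ _ (Rmax_r _ _) Hc).
    assert (Hn : w <> 0) by now apply Cmod_gt_0.
    assert (S := sqrt_PI_C_neq_0).
    replace (normalized_erfcx w - 1)%C with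
      (cerfcx w + RtoC (sqrt PI) * w * (cerfcx w - / (RtoC (sqrt PI) * w)))%C
      by (unfold normalized_erfcx; field; auto).
    assert (B1 := cerfcx_bound w (proj1 Hw) ltac:(lra)).
    assert (B2 := cerfcx_asymptotic w (proj1 Hw) Hn).
    eapply Rle_lt_trans; [apply Cmod_triangle|]. rewrite !Cmod_mult, Cmod_R, Rabs_right by lra.
    apply Rle_lt_trans with (2 / Cmod w + 2 * Cmod w * / (2 * (Cmod w * Cmod w))).
    + apply Rplus_le_compat; [easy|]. apply Rmult_le_compat; try lra; [|apply Cmod_ge_0|].
      * apply Rmult_le_pos; lra.
      * apply Rmult_le_compat_r; lra.
    + replace (2 / Cmod w + 2 * Cmod w * / (2 * (Cmod w * Cmod w))) with (3 / Cmod w)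
        by (field; lra).
      apply (Rmult_lt_reg_r (Cmod w)); [easy|]. unfold Rdiv.
      rewrite Rmult_assoc, Rinv_l, Rmult_1_r by lra.
      apply (Rmult_lt_compat_r d) in W2; [|easy]. unfold Rdiv in W2.
      rewrite Rmult_assoc, Rinv_l, Rmult_1_r in W2 by lra. lra.
Qed.

(** Here [x] is the logarithmic coordinate of the point [- i exp x], which is [root_neg t]
    for [t = exp (2 x)]. *)
Definition boundary_arg (x : R) : R := Im (Clog (cerfcx (0, - exp x))).

Lemma cexp_lower_edge (x : R) : cexp (x, - (PI / 2)) = (0, - exp x).
Proof.
  unfold cexp, Re, Im; simpl. rewrite cos_neg, sin_neg, cos_PI2, sin_PI2. f_equal; ring.
Qed.

Lemma continuous_boundary_arg (x : R) : continuous boundary_arg x.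
Proof.
  unfold boundary_arg.
  apply (continuous_ext (fun x => Im (Clog (cerfcx (cexp (x, - (PI / 2))))))).
  { intros t. now rewrite cexp_lower_edge. }
  apply (continuous_Im_h (fun w => Clog (cerfcx (cexp w)))).
  assert (Hq : quadrant4 (cexp (x, - (PI / 2)))).
  { rewrite cexp_lower_edge. unfold quadrant4, Re, Im; simpl. generalize (exp_pos x). lra. }
  apply (ccont_comp Clog (fun w => cerfcx (cexp w))).
  - apply (ccont_comp cerfcx cexp); [|apply entire_cont, entire_cerfcx].
    eapply cderiv_cont, cderiv_cexp.
  - now apply ccont_Clog, Re_cerfcx_pos.
Qed.

Definition comparison_arg (x : R) : R := atan (sqrt PI * exp x).

Lemma continuous_comparison_arg (x : R) : continuous comparison_arg x.
Proof.
  apply ex_derive_continuous_R. unfold comparison_arg. auto_derive.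
  easy.
Qed.

Lemma cexp_quadrant (x y : R) : - (PI / 2) <= y <= 0 -> quadrant4 (cexp (x, y)).
Proof.
  intros Hy. unfold quadrant4. rewrite Re_cexp, Im_cexp. unfold Re, Im; simpl.
  assert (P := exp_pos x). assert (0 <= cos y) by (apply cos_ge_0; lra).
  assert (0 <= sin (- y)) by (apply sin_ge_0; generalize PI_RGT_0; lra).
  rewrite sin_neg in H0. split; nra.
Qed.

(** Goursat's theorem for [log_normalized w dw / w] on a quarter annulus, in logarithmic
    coordinates: the real axis contributes nothing to the imaginary part, and
    the contributions of both arcs tend to [0]. *)
Lemma boundary_arg_integral (eps : R) : 0 < eps -> exists x0 x1, forall a b,
  a < x0 -> x1 < b -> a <= b -> Rabs (RInt (fun x => boundary_arg x - comparison_arg x) a b) <= eps.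
Proof.
  intros He. assert (PIpos := PI_RGT_0). assert (PI4 := PI_4).
  destruct (log_normalized_vanishes (eps / 4)) as [x0 [x1 Hv]]; [lra|].
  exists x0, x1. intros a b Ha Hb Hab.
  set (g := fun w => (- Ci * log_normalized (cexp w))%C).
  assert (Dg : forall x y, - (PI / 2) <= y <= 0 -> exists l, cderiv g (x, y) l).
  { intros x y Hy. destruct (cderiv_log_normalized _ (cexp_quadrant x y Hy)) as [l Hl].
    eexists. apply cderiv_scal, (cderiv_comp log_normalized cexp); [apply cderiv_cexp|exact Hl]. }
  assert (G := goursat g a b (- (PI / 2)) 0 Hab ltac:(lra) (fun x y _ Hy => Dg x y Hy)).
  unfold rect_circulation in G.
  rewrite (RInt_ext _
    (fun x => boundary_arg x - comparison_arg x)) in G.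
  2:{ intros x _. unfold g. rewrite <- !Im_as_Re. unfold log_normalized.
      rewrite cexp_lower_edge.
      replace (cexp (x, 0)) with ((exp x, 0) : C).
      2:{ unfold cexp, Re, Im; simpl. rewrite cos_0, sin_0. f_equal; ring. }
      rewrite !im_plus, !Im_Clog, Im_cerfcx_real. unfold boundary_arg, comparison_arg.
      rewrite Im_Clog.
      rewrite !im_plus, !re_plus, !im_scal_l, !re_scal_l, !im_RtoC, !re_RtoC.
      change (Re (0, - exp x)) with 0. change (Im (0, - exp x)) with (- exp x).
      change (Re (exp x, 0)) with (exp x). change (Im (exp x, 0)) with 0.
      replace ((0 + sqrt PI * - exp x) / (1 + sqrt PI * 0)) with (- (sqrt PI * exp x))
        by (field; lra).
      replace ((0 + sqrt PI * 0) / (1 + sqrt PI * exp x)) with 0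
        by (unfold Rdiv; ring).
      unfold Rdiv at 2. rewrite Rmult_0_l, atan_0, atan_opp.
      as_real_equation. ring. }
  assert (B : Rabs (RInt (fun y => Im (g (b, y)) - Im (g (a, y))) (- (PI / 2)) 0) <=
    (0 - - (PI / 2)) * (eps / 2)).
  { apply abs_RInt_le_const; [lra| |].
    - apply (ex_RInt_minus (V := R_NormedModule)); apply ex_RInt_cont; try lra;
      intros y Hy; apply continuous_Im_v; [destruct (Dg b y Hy) as [l Hl]|
        destruct (Dg a y Hy) as [l Hl]]; now apply cderiv_cont in Hl.
    - intros y Hy.
      assert (Hg : forall x, Im (g (x, y)) = - Re (log_normalized (cexp (x, y)))).
      { intros x. unfold g. rewrite Im_as_Re.
        replace (- Ci * (- Ci * log_normalized (cexp (x, y))))%C with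
          (- log_normalized (cexp (x, y)))%C; [apply re_opp|].
        replace (- Ci * (- Ci * log_normalized (cexp (x, y))))%C with
          (Ci * Ci * log_normalized (cexp (x, y)))%C by ring.
        replace (Ci * Ci)%C with (- (1))%C; [ring|].
        unfold Ci, Cmult, Copp, RtoC; simpl. f_equal; ring. }
      rewrite !Hg.
      assert (Hx : forall x, x < x0 \/ x1 < x ->
        Rabs (Re (log_normalized (cexp (x, y)))) <= eps / 4).
      { intros x Hx. apply Hv; [now apply cexp_quadrant| |];
        rewrite Cmod_cexp; change (Re (x, y)) with x; [apply exp_pos|now rewrite ln_exp]. }
      generalize (Hx a (or_introl Ha)) (Hx b (or_intror Hb)). intros T1 T2.
      apply Rabs_le_between in T1, T2. apply Rabs_le. lra. }
  apply Rminus_diag_uniq in G. rewrite G.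
  eapply Rle_trans; [exact B|]. nra.
Qed.

Definition atan_exp_int (x : R) : R := RInt (fun s => atan (exp s)) 0 x.

Lemma continuous_atan_exp (s : R) : continuous (fun s => atan (exp s)) s.
Proof. apply ex_derive_continuous_R. auto_derive. easy. Qed.

Lemma atan_exp_int_minus (p q : R) :
  atan_exp_int q - atan_exp_int p = RInt (fun s => atan (exp s)) p q.
Proof.
  unfold atan_exp_int.
  rewrite (RInt_Chasles_R (fun s => atan (exp s)) 0 p q) by apply continuous_atan_exp. ring.
Qed.

(** Both sides have the same derivative because [atan (exp s) + atan (exp (- s)) = pi/2]. *)
Lemma atan_exp_int_reflection (x : R) :
  atan_exp_int x = atan_exp_int (- x) + PI / 2 * x.
Proof.
  set (F := fun x => atan_exp_int x - atan_exp_int (- x) - PI / 2 * x).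
  assert (D0 : forall t, is_derive atan_exp_int t (atan (exp t))).
  { intros t. apply (is_derive_RInt_upper (fun s => atan (exp s))). apply continuous_atan_exp. }
  assert (D : forall t, is_derive F t 0).
  { intros t. unfold F.
    assert (E : atan (exp t) - - 1 * atan (exp (- t)) - PI / 2 * 1 = 0).
    { rewrite exp_Ropp, atan_inv by apply exp_pos. ring. }
    rewrite <- E.
    apply (is_derive_minus (V := R_NormedModule)).
    - apply (is_derive_minus (V := R_NormedModule)); [apply D0|].
      apply (is_derive_comp atan_exp_int (fun t => - t)); [apply D0|].
      auto_derive; [easy|ring].
    - auto_derive; [easy|ring]. }
  assert (E : F x = F 0).
  { destruct (Rtotal_order x 0) as [Hx|[->|Hx]]; [|easy|].
    - apply (eq_is_derive F x 0); [|easy]. intros t _. apply D.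
    - symmetry. apply (eq_is_derive F 0 x); [|easy]. intros t _. apply D. }
  unfold F in E. rewrite Ropp_0 in E. lra.
Qed.

Lemma atan_exp_int_diff (p q : R) : Rabs (atan_exp_int p - atan_exp_int q) <= exp p + exp q.
Proof.
  assert (K : forall p q, p <= q -> Rabs (atan_exp_int q - atan_exp_int p) <= exp q).
  { intros p' q' Hpq.
    rewrite atan_exp_int_minus.
    rewrite Rabs_right.
    2:{ apply Rle_ge, RInt_ge_0; [easy|apply ex_RInt_everywhere, continuous_atan_exp|].
        intros s _. apply atan_nonneg, Rlt_le, exp_pos. }
    apply Rle_trans with (exp q' - exp p'); [|generalize (exp_pos p'); lra].
    assert (HI : is_RInt exp p' q' (exp q' - exp p')).
    { apply (is_RInt_derive exp).
      - intros s _. auto_derive; [easy|ring].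
      - intros s _. apply continuous_exp. }
    rewrite <- (is_RInt_unique _ _ _ _ HI).
    apply RInt_le; [easy|apply ex_RInt_everywhere, continuous_atan_exp|now exists (exp q' - exp p')|].
    intros s _. apply atan_le_id, Rlt_le, exp_pos. }
  assert (Pp := exp_pos p). assert (Pq := exp_pos q).
  destruct (Rle_dec p q) as [H|H].
  - rewrite Rabs_minus_sym. generalize (K p q H). lra.
  - generalize (K q p ltac:(lra)). lra.
Qed.

Lemma comparison_arg_integral (a b : R) : RInt comparison_arg a b =
  atan_exp_int (b + ln (sqrt PI)) - atan_exp_int (a + ln (sqrt PI)).
Proof.
  set (s := ln (sqrt PI)).
  transitivity (RInt (fun x => atan (exp x)) (1 * a + s) (1 * b + s)).
  - rewrite <- (RInt_comp_lin (fun x => atan (exp x)) 1 s a b)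
      by apply ex_RInt_everywhere, continuous_atan_exp.
    apply RInt_ext. intros x _. unfold comparison_arg, scal; simpl. unfold mult; simpl.
    as_real_equation.
    rewrite !Rmult_1_l, exp_plus. unfold s. rewrite exp_ln by (generalize sqrt_PI_bounds; lra).
    now rewrite (Rmult_comm (exp x)).
  - rewrite !Rmult_1_l.
    symmetry. apply atan_exp_int_minus.
Qed.

Lemma Im_log_erfc_map_exp (x : R) : Im (log_erfc_map (RtoC (exp (2 * x)))) = boundary_arg x.
Proof.
  assert (P := exp_pos (2 * x)).
  unfold log_erfc_map, boundary_arg. rewrite im_plus, im_RtoC, root_neg_nonneg by lra.
  replace (sqrt (exp (2 * x))) with (exp x); [ring|].
  symmetry. replace (2 * x) with (x + x) by ring. rewrite exp_plus.
  apply sqrt_square. apply Rlt_le, exp_pos.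
Qed.

Lemma continuous_Im_boundary (t : R) : 0 < t ->
  continuous (fun t => Im (log_erfc_map (RtoC t)) / t) t.
Proof.
  intros Ht.
  apply (continuous_mult (K := R_AbsRing) (fun t => Im (log_erfc_map (RtoC t))) (fun t => / t)).
  - apply (continuous_ext (fun t => Im (log_erfc_map (0 + RtoC t * 1)%C))).
    + intros s. do 2 f_equal. ring.
    + apply ccont_Im_line, ccont_log_erfc_map.
  - apply ex_derive_continuous_R. auto_derive. lra.
Qed.

(** The substitution [t = exp (2 x)], under which [sqrt t = exp x]. *)
Lemma boundary_integral_log_coordinates (a b : R) : 0 < a -> a <= b ->
  RInt (fun t => Im (log_erfc_map (RtoC t)) / t) a b =
  2 * RInt boundary_arg (ln a / 2) (ln b / 2).
Proof.
  intros Ha Hab.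
  assert (E : forall c, 0 < c -> exp (2 * (ln c / 2)) = c).
  { intros c Hc. replace (2 * (ln c / 2)) with (ln c) by field. now apply exp_ln. }
  rewrite <- (E a Ha) at 1. rewrite <- (E b ltac:(lra)) at 1.
  rewrite <- (RInt_comp
    (fun t => Im (log_erfc_map (RtoC t)) / t) (fun x => exp (2 * x)) (fun x => 2 * exp (2 * x))).
  - rewrite <- RInt_scal_R by apply continuous_boundary_arg.
    apply RInt_ext. intros x _. rewrite Im_log_erfc_map_exp.
    unfold scal; simpl. unfold mult; simpl.
    as_real_equation.
    field. apply Rgt_not_eq, exp_pos.
  - intros x _. apply continuous_Im_boundary, exp_pos.
  - intros x _. split; [auto_derive; [easy|ring]|].
    apply ex_derive_continuous_R. auto_derive. easy.
Qed.

Definition log_integrand (t : R) : R :=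
  (Im (log_erfc_map (RtoC t)) - PI / 2 * chi_2_infty t) / t.

Lemma is_RInt_log_integrand (a b : R) : 0 < a -> a < 2 -> 2 < b ->
  is_RInt log_integrand a b
    (RInt (fun t => Im (log_erfc_map (RtoC t)) / t) a b - PI / 2 * (ln b - ln 2)).
Proof.
  intros Ha H2a H2b.
  set (f := fun t => Im (log_erfc_map (RtoC t)) / t).
  assert (Ef : forall c d, 0 < c -> c <= d -> ex_RInt f c d).
  { intros c d Hc Hcd. apply ex_RInt_cont; [easy|]. intros t Ht.
    apply continuous_Im_boundary. lra. }
  assert (I1 : is_RInt log_integrand a 2 (RInt f a 2)).
  { apply (is_RInt_ext f).
    - intros t Ht. rewrite Rmin_left, Rmax_right in Ht by lra.
      unfold log_integrand, chi_2_infty, f. destruct (Rle_dec 2 t); [lra|].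
      as_real_equation. field. lra.
    - apply (RInt_correct (V := R_CompleteNormedModule)). apply Ef; lra. }
  assert (I2 : is_RInt log_integrand 2 b (RInt f 2 b - PI / 2 * (ln b - ln 2))).
  { apply (is_RInt_ext (fun t => f t - PI / 2 * / t)).
    - intros t Ht. rewrite Rmin_left, Rmax_right in Ht by lra.
      unfold log_integrand, chi_2_infty, f. destruct (Rle_dec 2 t); [|lra].
      as_real_equation. field. lra.
    - apply (is_RInt_minus f (fun t => PI / 2 * / t)).
      + apply (RInt_correct (V := R_CompleteNormedModule)). apply Ef; lra.
      + apply (is_RInt_scal (fun t => / t)).
        apply (is_RInt_derive ln).
        * intros t Ht. rewrite Rmin_left, Rmax_right in Ht by lra.
          apply is_derive_Reals, derivable_pt_lim_ln. lra.
        * intros t Ht. rewrite Rmin_left, Rmax_right in Ht by lra.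
          apply ex_derive_continuous_R. auto_derive. lra. }
  rewrite <- (RInt_Chasles f a 2 b) by (apply Ef; lra).
  assert (I := is_RInt_Chasles _ _ _ _ _ _ I1 I2).
  unfold plus in *. simpl in *.
  replace (RInt f a 2 + RInt f 2 b - PI / 2 * (ln b - ln 2)) with
    (RInt f a 2 + (RInt f 2 b - PI / 2 * (ln b - ln 2))) by ring. exact I.
Qed.

(** With [x = ln a / 2] and [y = ln b / 2] the integral over [a, b] is
    [2 (I + S (y + s) - S (x + s)) - pi/2 (2 y - ln 2)], where [I] is the integral of
    [boundary_arg - comparison_arg] over [x, y], [s = ln (sqrt pi)] and [S] is [atan_exp_int].
    By reflection [S (y + s) = S (- (y + s)) + pi/2 (y + s)], and [S (- (y + s)) - S (x + s)]
    tends to [0]; the terms in [y] cancel and [pi s + pi/2 ln 2 = pi/2 ln (2 pi)] remains. *)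
Lemma is_RInt_gen_log_integrand :
  is_RInt_gen log_integrand (at_right 0) (Rbar_locally p_infty) (PI / 2 * ln (2 * PI)).
Proof.
  intros P [e HP]. unfold filtermapi.
  assert (PIpos := PI_RGT_0). assert (SP := sqrt_PI_bounds). assert (He := cond_pos e).
  set (s := ln (sqrt PI)).
  assert (Es : PI * s = PI / 2 * ln PI).
  { assert (E : ln (sqrt PI * sqrt PI) = s + s) by (apply ln_mult; lra).
    rewrite sqrt_PI_sqr in E. rewrite E. field. }
  destruct (boundary_arg_integral (e / 8)) as [x0 [x1 HI]]; [lra|].
  set (l := ln (e / 16)).
  set (A := Rmin x0 (l - s)). set (B := Rmax x1 (- l - s)).
  apply (Filter_prod _ _ _ (fun a => 0 < a < Rmin 2 (exp (2 * A)))
    (fun b => Rmax 2 (exp (2 * B)) < b)).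
  - assert (Hd : 0 < Rmin 2 (exp (2 * A))) by (apply Rmin_glb_lt; [lra|apply exp_pos]).
    exists (mkposreal _ Hd). intros a Ha Hpos.
    change (Rabs (a - 0) < Rmin 2 (exp (2 * A))) in Ha.
    rewrite Rminus_0_r, Rabs_right in Ha by lra. lra.
  - now exists (Rmax 2 (exp (2 * B))).
  - intros a b [Ha1 Ha2] Hb.
    assert (A1 := Rlt_le_trans _ _ _ Ha2 (Rmin_l _ _)).
    assert (A2 := Rlt_le_trans _ _ _ Ha2 (Rmin_r _ _)).
    assert (B1 := Rle_lt_trans _ _ _ (Rmax_l _ _) Hb).
    assert (B2 := Rle_lt_trans _ _ _ (Rmax_r _ _) Hb).
    apply ln_increasing in A2; [|easy]. rewrite ln_exp in A2.
    apply ln_increasing in B2; [|apply exp_pos]. rewrite ln_exp in B2.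
    assert (LA1 : A <= x0) by apply Rmin_l. assert (LA2 : A <= l - s) by apply Rmin_r.
    assert (LB1 : x1 <= B) by apply Rmax_l. assert (LB2 : - l - s <= B) by apply Rmax_r.
    eexists. split; [simpl; now apply is_RInt_log_integrand|].
    apply HP.
    match goal with |- ball _ _ ?y => change (Rabs (y - PI / 2 * ln (2 * PI)) < e) end.
    rewrite boundary_integral_log_coordinates by lra.
    set (x := ln a / 2). set (y := ln b / 2).
    assert (Hxy : x <= y) by (assert (ln a < ln b) by (apply ln_increasing; lra); unfold x, y; lra).
    specialize (HI x y ltac:(unfold x; lra) ltac:(unfold y; lra) Hxy).
    rewrite RInt_minus_R in HI by (apply continuous_boundary_arg || apply continuous_comparison_arg).
    rewrite comparison_arg_integral, (atan_exp_int_reflection (y + ln (sqrt PI))) in HI.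
    fold s in HI.
    assert (D := atan_exp_int_diff (- (y + s)) (x + s)).
    assert (X1 : exp (- (y + s)) <= e / 16).
    { rewrite <- (exp_ln (e / 16)) by lra. apply exp_le_compat. fold l. unfold y. lra. }
    assert (X2 : exp (x + s) <= e / 16).
    { rewrite <- (exp_ln (e / 16)) by lra. apply exp_le_compat. fold l. unfold x. lra. }
    rewrite ln_mult by lra.
    replace (ln b) with (2 * y) by (unfold y; field).
    assert (Ey : PI / 2 * (y + s) = PI / 2 * y + PI / 2 * s) by ring.
    set (I := RInt boundary_arg x y) in *.
    set (T1 := atan_exp_int (- (y + s))) in *. set (T2 := atan_exp_int (x + s)) in *.
    rewrite Ey in HI. apply Rabs_le_between in HI, D.
    apply Rabs_def1; nra.
Qed.

(** * The integral formula *)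

Theorem mainTheorem6 (H : C -> C)
  (H_conformal :
     conformal_onto upper_half_plane (region_above lower_boundary) H)
  (H_zero : is_boundary_value H 0 (RtoC 0))
  (H_infinity :
     filterlim (fun z : C => (H z / z)%C)
       (within upper_half_plane C_infinity) (locally (RtoC 1))) :
  exists Hb : R -> C,
    (forall t : R, is_boundary_value H t (Hb t)) /\
    let u := fun t : R => (Im (Hb t) - PI / 2 * chi_2_infty t) / t in
    ex_RInt_gen u (at_right 0) (Rbar_locally p_infty) /\
    1 / PI * RInt_gen u (at_right 0) (Rbar_locally p_infty)
      = 1 / 2 * ln (2 * PI).
Proof.
  destruct (conformal_inverse _ _ _ upper_half_plane_open H_conformal) as [h Hh].
  destruct H_conformal as [Hd [Hinj Honto]].
  assert (HK : forall z, upper_half_plane z -> H z = log_erfc_map z).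
  { intros z Hz. apply (conformal_map_unique H h); try easy.
    - intros w Hw. destruct (Hd w Hw) as [l Hl].
      now apply is_derive_to_cderiv, cderiv_cont in Hl.
    - intros w Hw. apply Honto. now exists w.
    - now apply asymptotic_to_identity. }
  exists (fun t => log_erfc_map (RtoC t)). split.
  - intros t. apply is_boundary_value_iff. intros e He.
    destruct (ccont_log_erfc_map (RtoC t) e He) as [d [Hd0 Hc]]. exists d.
    split; [easy|]. intros z Hz Hzt. rewrite HK by easy. now apply Hc.
  - intros u. assert (Hu := is_RInt_gen_log_integrand).
    split; [now exists (PI / 2 * ln (2 * PI))|].
    change u with log_integrand. rewrite (is_RInt_gen_unique _ _ Hu). field. apply PI_neq0.
Qed.
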